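(* Let $\mathcal{T}\subseteq[0,\infty)$ be a convex set with non-empty interior, and let $Z=(t_1,t_2)$ be observed on $\mathcal{T}^2$ with Lebesgue density given, up to a normalizing constant, by $$f_{\eta_0}(t_1,t_2)=\int_{\mathbb{R}\times[0,\infty)}\frac{\alpha_2^2}{t_1^{3/2}t_2^{3/2}}\exp\Big(-\frac{(\alpha_1t_1-\alpha_2)^2}{2t_1}-\frac{(\alpha_1t_2-\alpha_2)^2}{2t_2}\Big)d\eta_0(\alpha_1,\alpha_2).$$ Assume UH $\alpha=(\alpha_1,\alpha_2)$ is nonparametric. Then the CDFs and quantiles of UH are not regularly identified. That is: the CDF value $\mathbb{E}_{\eta_0}[1(\alpha_1\le\alpha_{10})1(\alpha_2\le\alpha_{20})]$ at a point $(\alpha_{10},\alpha_{20})$ in the interior of the support of $\eta_0$ is not regularly identified; and for $k\in\{1,2\}$ and $\tau\in(0,1)$, the $\tau$-quantile $q$ of $\alpha_k$ is not regularly identified, provided the distribution of $\alpha_k$ has a strictly positive Lebesgue density in a neighborhood of $q$ and some point of the interior of the support of $\eta_0$ has $k$-th coordinate $q$.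
   Context: Setting: $\alpha=(\alpha_1,\alpha_2)\in\mathbb{R}\times[0,\infty)$ is unobserved heterogeneity (UH) with unknown distribution $\eta_0\in H$, a class of distributions. Write $f_{z/\alpha}(t_1,t_2)=C\,\alpha_2^2t_1^{-3/2}t_2^{-3/2}\exp(-(\alpha_1t_1-\alpha_2)^2/(2t_1)-(\alpha_1t_2-\alpha_2)^2/(2t_2))$ with $C>0$ the normalizing constant (not depending on $t_1,t_2,\alpha$), so the normalized density of $Z$ on $\mathcal{T}^2$ is $f_{\eta_0}=\int f_{z/\alpha}\,d\eta_0(\alpha)$; $\mathbb{P}$ is the law of $Z$. $L_2^0(\nu)$ denotes zero-$\nu$-mean functions in $L_2(\nu)$. Tangent space: a path $\eta_t\in H$, $t\in[0,\varepsilon)$, has score $b\in L_2(\eta_0)$ if $\int[(d\eta_t^{1/2}-d\eta_0^{1/2})/t-\tfrac12 b\,d\eta_0^{1/2}]^2\to0$ as $t\downarrow0$. $T(\eta_0)$ is the linear span of all such $b$. UH is nonparametric if $T(\eta_0)$ is dense in $L_2^0(\eta_0)$. Regular identification: the score operator is $Ab(z)=\int b(\alpha)f_{z/\alpha}(z)d\eta_0(\alpha)/f_{\eta_0}(z)$, centered to have zero $\mathbb{P}$-mean. A functional $\phi:H\to\mathbb{R}$ is differentiable with gradient $r_\phi\in L_2^0(\eta_0)$ if $\lim_{t\to0}(\phi(\eta_t)-\phi(\eta_0))/t=\mathbb{E}_{\eta_0}[r_\phi b]$ along all such paths; for $\phi(\eta)=\mathbb{E}_\eta[r(\alpha)]$,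 $r_\phi=r-\phi(\eta_0)$; for the $\tau$-quantile $q$ of $\alpha_k$ with marginal density $\dot\eta_{0k}$, $r_\phi(\alpha)=-\{1(\alpha_k<q)-\tau\}/\dot\eta_{0k}(q)$. The efficiency bound is $\sup_{b\in T(\eta_0)}(\mathbb{E}_{\eta_0}[r_\phi b])^2/\mathbb{E}[(Ab(Z))^2]$ (with $0/0=0$, $c/0=\infty$ for $c>0$). $\phi(\eta_0)$ is regularly identified if it is identified (determined by the law of $Z$ within the model) with a finite efficiency bound. *)

(* Defs.v *)
From HB Require Import structures.
From mathcomp Require Import all_boot all_order all_algebra.
From mathcomp Require Import all_classical all_reals all_analysis.

Set Implicit Arguments.
Unset Strict Implicit.
Unset Printing Implicit Defensive.

Import Order.TTheory GRing.Theory Num.Theory.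
Import numFieldNormedType.Exports.

Local Open Scope classical_set_scope.
Local Open Scope ring_scope.

(* Heterogeneity alpha = (a.1, a.2) and outcomes z = (t1, t2) both live in the
   measurable space R * R. *)
Definition UHdom (R : realType) : set (R * R) := [set a | 0 <= a.2].

Definition lebesgue2 (R : realType) :=
  (@lebesgue_measure R \x @lebesgue_measure R)%E.

(* The value at t1 = 0 or t2 = 0 (a Lebesgue null set) is 0, because
   0 `^ (3/2) = 0 and 0^-1 = 0. *)
Definition kernel_z (R : realType) (a z : R * R) : R :=
  a.2 ^+ 2 / (z.1 `^ (3%:R / 2%:R) * z.2 `^ (3%:R / 2%:R)) *
  expR (- ((a.1 * z.1 - a.2) ^+ 2 / (2%:R * z.1))
        - ((a.1 * z.2 - a.2) ^+ 2 / (2%:R * z.2))).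

(* The constant C.  It depends on eta, since the kernel does not have the same
   total mass over T x T for all a; this is why scores have to be centered.
   It is a positive real unless eta is carried by {a.2 = 0}, in which case the
   mixture density below is identically 0 and is not the law of any Z. *)
Definition norm_const (R : realType) (T : set R)
    (eta : probability (R * R)%type R) : \bar R :=
  ((\int[@lebesgue2 R]_(z in T `*` T)
     \int[eta]_(a in @UHdom R) (kernel_z a z)%:E)^-1)%E.

Definition cond_dens (R : realType) (T : set R)
    (eta : probability (R * R)%type R) (a z : R * R) : \bar R :=
  (norm_const T eta * (kernel_z a z)%:E)%E.

Definition dens (R : realType) (T : set R) (eta : probability (R * R)%type R)
    (z : R * R) : \bar R :=
  (\int[eta]_(a in @UHdom R) cond_dens T eta a z)%E.

Definition lawZ (R : realType) (T : set R) (eta : probability (R * R)%type R)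
    (A : set (R * R)) : \bar R :=
  (\int[@lebesgue2 R]_(z in A `&` (T `*` T)) dens T eta z)%E.

Definition expectZ (R : realType) (T : set R) (eta : probability (R * R)%type R)
    (h : R * R -> R) : \bar R :=
  (\int[@lebesgue2 R]_(z in T `*` T) ((h z)%:E * dens T eta z))%E.

Definition L20 (R : realType) (eta : probability (R * R)%type R)
    (b : R * R -> R) : Prop :=
  b \in Lfun eta 2%:E /\ ('E_eta[b] = 0)%E.

(* [f] is the density of [mu] with respect to [nu]. *)
Definition is_density (R : realType) (mu : probability (R * R)%type R)
    (nu : {sigma_finite_measure set (R * R)%type -> \bar R})
    (f : R * R -> R) : Prop :=
  [/\ measurable_fun [set: (R * R)%type] f, (forall a, 0 <= f a) &
      forall A, measurable A -> (mu A = \int[nu]_(a in A) (f a)%:E)%E].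

(* The path [eta] in H (only its values on [0, eps[ matter) starts at [eta0]
   and has score [b].  As usual d eta^(1/2) is the square root of the density
   with respect to a dominating measure [nu t] of eta t and eta0; the integral
   does not depend on the choice of [nu t] and of the versions of the
   densities [p t] of eta t and [p0 t] of eta0. *)
Definition path_with_score (R : realType) (H : set (probability (R * R)%type R))
    (eta0 : probability (R * R)%type R) (eta : R -> probability (R * R)%type R)
    (b : R * R -> R) : Prop :=
  b \in Lfun eta0 2%:E /\
  exists eps : R,
  exists nu : R -> {sigma_finite_measure set (R * R)%type -> \bar R},
  exists p : R -> R * R -> R, exists p0 : R -> R * R -> R,
    [/\ 0 < eps, eta 0 = eta0,
        (forall t, 0 <= t < eps -> H (eta t)),
        (forall t, 0 < t < eps ->
           is_density (eta t) (nu t) (p t) /\ is_density eta0 (nu t) (p0 t)) &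
        (\int[nu t]_a
           (((Num.sqrt (p t a) - Num.sqrt (p0 t a)) / t
             - 2%:R^-1 * b a * Num.sqrt (p0 t a)) ^+ 2)%:E)%E
          @[t --> 0^'+] --> 0%E].

Definition is_score (R : realType) (H : set (probability (R * R)%type R))
    (eta0 : probability (R * R)%type R) (b : R * R -> R) : Prop :=
  exists eta : R -> probability (R * R)%type R, path_with_score H eta0 eta b.

Definition tangent_space (R : realType) (H : set (probability (R * R)%type R))
    (eta0 : probability (R * R)%type R) : set (R * R -> R) :=
  [set b | exists n : nat, exists c : 'I_n -> R, exists s : 'I_n -> R * R -> R,
     (forall i, is_score H eta0 (s i)) /\
     b = (fun a => \sum_(i < n) c i * s i a)].

Definition nonparametric (R : realType) (H : set (probability (R * R)%type R))
    (eta0 : probability (R * R)%type R) : Prop :=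
  forall h, L20 eta0 h -> forall e : R, 0 < e ->
  exists2 b, tangent_space H eta0 b &
    ('N[eta0]_2%:E[EFin \o (h \- b)%R] < e%:E)%E.

Definition score_op_raw (R : realType) (T : set R)
    (eta0 : probability (R * R)%type R)
    (b : R * R -> R) (z : R * R) : R :=
  fine ((\int[eta0]_(a in @UHdom R) ((b a)%:E * cond_dens T eta0 a z))
        / dens T eta0 z)%E.

Definition score_op (R : realType) (T : set R)
    (eta0 : probability (R * R)%type R)
    (b : R * R -> R) (z : R * R) : R :=
  score_op_raw T eta0 b z - fine (expectZ T eta0 (score_op_raw T eta0 b)).

Definition is_gradient (R : realType) (H : set (probability (R * R)%type R))
    (eta0 : probability (R * R)%type R) (phi : probability (R * R)%type R -> R)
    (r : R * R -> R) : Prop :=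
  L20 eta0 r /\
  forall eta b, path_with_score H eta0 eta b ->
    ((phi (eta t) - phi eta0) / t)%:E @[t --> 0^'+] --> ('E_eta0[r \* b])%E.

Definition identified (R : realType) (T : set R)
    (H : set (probability (R * R)%type R))
    (eta0 : probability (R * R)%type R)
    (phi : probability (R * R)%type R -> R) : Prop :=
  forall eta, H eta ->
    (forall A, measurable A -> lawZ T eta A = lawZ T eta0 A) ->
    phi eta = phi eta0.

(* In \bar R, 0^-1 = +oo and 0 * +oo = 0, so that 0 / 0 = 0 and c / 0 = +oo
   for c > 0. *)
Definition efficiency_bound (R : realType) (T : set R)
    (H : set (probability (R * R)%type R)) (eta0 : probability (R * R)%type R)
    (r : R * R -> R) : \bar R :=
  ereal_sup [set (('E_eta0[r \* b]) ^+ 2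
                  / expectZ T eta0 (fun z => (score_op T eta0 b z ^+ 2)%R))%E
            | b in tangent_space H eta0].

(* [r] is meant to be the gradient of [phi] at [eta0]. *)
Definition regularly_identified (R : realType) (T : set R)
    (H : set (probability (R * R)%type R)) (eta0 : probability (R * R)%type R)
    (phi : probability (R * R)%type R -> R) (r : R * R -> R) : Prop :=
  identified T H eta0 phi /\ (efficiency_bound T H eta0 r < +oo)%E.

Definition supp (R : realType)
    (eta : probability (R * R)%type R) : set (R * R) :=
  [set a | forall U : set (R * R), open U -> U a -> (0 < eta U)%E].

Definition cdf_integrand (R : realType) (a0 a : R * R) : R :=
  \1_[set x : R | x <= a0.1] a.1 * \1_[set x : R | x <= a0.2] a.2.

Definition cdf_value (R : realType) (a0 : R * R)
    (eta : probability (R * R)%type R) : R :=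
  fine ('E_eta[cdf_integrand a0])%E.

Definition cdf_gradient (R : realType) (eta0 : probability (R * R)%type R)
    (a0 a : R * R) : R :=
  cdf_integrand a0 a - cdf_value a0 eta0.

Definition ucoord (R : realType) (k : 'I_2) (a : R * R) : R :=
  if k == ord0 then a.1 else a.2.

Definition quantile (R : realType) (k : 'I_2) (tau : R)
    (eta : probability (R * R)%type R) : R :=
  inf [set x : R | (tau%:E <= eta [set a | (ucoord k a <= x)%R])%E].

Definition quantile_gradient (R : realType) (k : 'I_2) (tau q : R) (g : R -> R)
    (a : R * R) : R :=
  - ((\1_[set x : R | x < q] (ucoord k a) - tau) / g q).

Definition positive_density_near (R : realType)
    (eta : probability (R * R)%type R) (k : 'I_2) (q : R) (g : R -> R) : Prop :=
  exists d : R,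
    [/\ 0 < d, measurable_fun `]q - d, q + d[ g,
        (forall x, x \in `]q - d, q + d[ -> 0 < g x) &
        forall A : set R, measurable A -> A `<=` `]q - d, q + d[ ->
          (eta (ucoord k @^-1` A) =
           \int[@lebesgue_measure R]_(x in A) (g x)%:E)%E].

(* Main.v *)
(** Both efficiency bounds are infinite, so identification plays no role.
    Completing the squares, [kernel_z a z] is a factor depending on [a] times
    the exponential of [- a.1^2/2 (z.1 + z.2) - a.2^2/2 (z.1^-1 + z.2^-1)]
    times a factor free of [a].  Therefore, as [a] tends to an interior point
    [p] of the support with [p.1 != 0], [kernel_z a - kernel_z p] becomes
    negligible, uniformly in [z], with respect to the mixture, which also
    charges parameters closer to the origin than [p].  The direction
    [w 1_U/eta0(U) - w' 1_U'/eta0(U')], with [U] and [U'] small sets near [p]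
    and [p'] and [w kernel_z p = w' kernel_z p'], thus has an arbitrarily small
    score, whereas its covariance with the gradient does not vanish when [U]
    and [U'] lie on the two sides of the jump of the gradient.  Since the
    tangent space is dense and the score operator is bounded (the kernel has
    uniformly bounded mass), such directions can be taken in the tangent space.

    Differentiability along a path follows from an expansion that is uniform
    over measurable functions bounded by 1; for quantiles, it sandwiches the
    quantile of [eta t] between [q + t (L - e)] and [q + t (L + e)]. *)
Require Import Defs.
From HB Require Import structures.
From mathcomp Require Import all_boot all_order all_algebra.
From mathcomp Require Import all_classical all_reals all_analysis.
From mathcomp Require Import measurable_realfun ring lra.
Import Order.TTheory GRing.Theory Num.Theory.
Import numFieldNormedType.Exports.

Set Implicit Arguments.
Unset Strict Implicit.
Unset Printing Implicit Defensive.

Local Open Scope classical_set_scope.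
Local Open Scope ring_scope.

(** * Estimates on the kernel, uniform in the observation *)

Section kernel_estimates.
Context {R : realType}.
Implicit Types a p z : R * R.

(** The times in [z] may come arbitrarily close to 0 or grow without bound, where the mixture itself
    decays, so closeness of two kernels has to be measured relative to the mixture. The link is a
    common majorant [dominator u v]. If [l] in ]0, 1[ is such that the point l p is still in the
    support, take u strictly between (l p.1)^2 and p.1^2, and v strictly between (l p.2)^2 and
    p.2^2: parameters near l p keep the mixture above a fixed multiple of [dominator u v], while
    kernel differences near p stay below an arbitrarily small multiple of it.

    This leaves no room for u when p.1 = 0. Where the jump set of the gradient is not contained in
    the line a.1 = 0, p is chosen on it with p.1 != 0. The jump of the gradient for the quantile 0
    of the first coordinate is exactly that line; there two mirror points (d, a.2) and (- d, a.2) on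
    either side replace p. Their kernels are proportional, and the weights w and w' make them
    cancel. *)

Let P z : R := (z.1 `^ (3%:R / 2%:R) * z.2 `^ (3%:R / 2%:R))^-1.

(* Sub-Gaussian majorant: up to a factor free of [z], this is the kernel at
   [(Num.sqrt u, Num.sqrt v)]. *)
Definition dominator (u v : R) z : R :=
  P z * expR (- (u / 2 * (z.1 + z.2)) - v / 2 * (z.1^-1 + z.2^-1)).

(** Each square, divided by 2 t, contributes the cross term a.1 a.2, in which t cancels; the two
    times together give the exponent 2 a.1 a.2. *)
Definition kernel_factor a : R := a.2 ^+ 2 * expR (2 * a.1 * a.2).

Lemma dominator_ge0 u v z : 0 <= dominator u v z.
Proof. by rewrite mulr_ge0 ?expR_ge0// invr_ge0 mulr_ge0// powR_ge0. Qed.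

Lemma dominator_gt0 u v z : 0 < z.1 -> 0 < z.2 -> 0 < dominator u v z.
Proof.
by move=> z1 z2; rewrite mulr_gt0 ?expR_gt0// invr_gt0 mulr_gt0// powR_gt0.
Qed.

Lemma kernel_zE a z : 0 <= z.1 -> 0 <= z.2 ->
  kernel_z a z = kernel_factor a * dominator (a.1 ^+ 2) (a.2 ^+ 2) z.
Proof.
rewrite /kernel_z /dominator /P /kernel_factor.
(* On the boundary both sides are 0, because 0 to the power 3/2 and the inverse of 0 are 0. *)
rewrite le_eqVlt => /predU1P[<-|z1].
  by rewrite !powR0 ?mul0r ?invr0 ?mulr0 ?mul0r ?mulr0//; apply/eqP; lra.
rewrite le_eqVlt => /predU1P[<-|z2].
  by rewrite !powR0 ?mul0r ?invr0 ?mulr0 ?mul0r ?invr0 ?mulr0 ?mul0r ?mulr0//; apply/eqP; lra.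
rewrite [RHS]mulrACA -expRD.
congr (_ * expR _).
field; lra.
Qed.

Lemma kernel_z_ge0 a z : 0 <= kernel_z a z.
Proof.
by rewrite /kernel_z mulr_ge0 ?expR_ge0// divr_ge0 ?sqr_ge0// mulr_ge0 ?powR_ge0.
Qed.

(** For x <= y the difference is e^(-x) (1 - e^(-(y - x))), and 1 - e^(-s) <= s. *)
Lemma expRN_lipschitz (x y k : R) : k <= x -> k <= y ->
  `|expR (- x) - expR (- y)| <= expR (- k) * `|x - y|.
Proof.
wlog xy : x y / x <= y.
  move=> H kx ky; have [/H|/ltW/H] := leP x y; first exact.
  by rewrite distrC (distrC x); apply.
move=> kx ky; rewrite ger0_norm; last by rewrite subr_ge0 ler_expR; lra.
rewrite distrC ger0_norm ?subr_ge0//.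
have -> : - y = - x + (- (y - x)) by lra.
rewrite expRD -{1}(mulr1 (expR _)) -mulrBr.
apply: ler_pM; rewrite ?expR_ge0//.
- by rewrite subr_ge0 -expR0 ler_expR; lra.
- by rewrite ler_expR; lra.
- by have := expR_ge1Dx (- (y - x)); lra.
Qed.

(** The Lipschitz constant s e^(-k s) is at most 1/k, since k s <= e^(k s). The bound is thus free
    of [s], which will stand for the unbounded quantities z.1 + z.2 and z.1^-1 + z.2^-1. *)
Lemma expRN_scaled_lipschitz (k x y s : R) : 0 < k -> k <= x -> k <= y ->
  0 <= s -> `|expR (- (x * s)) - expR (- (y * s))| <= `|x - y| / k.
Proof.
move=> k0 kx ky s0.
have := @expRN_lipschitz (x * s) (y * s) (k * s).
rewrite !ler_wpM2r// => /(_ isT isT) /le_trans; apply.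
rewrite -mulrBl normrM (ger0_norm s0) mulrCA ler_wpM2l//.
rewrite -(mul1r k^-1) ler_pdivlMr// -mulrA (mulrC s) expRN [leLHS]mulrC.
rewrite ler_pdivrMr ?expR_gt0// mul1r.
by have := expR_ge1Dx (k * s); lra.
Qed.

Lemma kernel_factor_cvg p : kernel_factor @ p --> kernel_factor p.
Proof.
rewrite /kernel_factor.
have c1 : (fun a : R * R => a.1) @ p --> p.1 by exact: cvg_fst.
have c2 : (fun a : R * R => a.2) @ p --> p.2 by exact: cvg_snd.
apply: cvgM; first by rewrite expr2; apply: cvgM.
apply: continuous_cvg; first exact: continuous_expR.
by apply: cvgM => //; apply: cvgM => //; exact: cvg_cst.
Qed.


Lemma kernel_factor_gt0 a : a.2 != 0 -> 0 < kernel_factor a.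
Proof. by move=> a2; rewrite mulr_gt0 ?expR_gt0// exprn_even_gt0//= a2 orbT. Qed.

Lemma kernel_factor_ge0 a : 0 <= kernel_factor a.
Proof. by rewrite mulr_ge0 ?expR_ge0// sqr_ge0. Qed.

Lemma dominator_shift (u v u' v' : R) z :
  dominator u' v' z = dominator u v z *
    (expR (- ((u' - u) / 2 * (z.1 + z.2))) *
     expR (- ((v' - v) / 2 * (z.1^-1 + z.2^-1)))).
Proof. by rewrite /dominator -[RHS]mulrA -!expRD; congr (_ * expR _); ring. Qed.

(* Dividing [kernel_z] by the dominator leaves [expR] of a linear form in
   [(z.1 + z.2, z.1^-1 + z.2^-1)] with both coefficients bounded away from 0;
   hence the modulus of continuity in [a] is uniform in [z]. *)
Lemma kernel_z_near (u v h : R) p : u < p.1 ^+ 2 -> v < p.2 ^+ 2 -> 0 < h ->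
  \forall a \near p, forall z, 0 <= z.1 -> 0 <= z.2 ->
    `|kernel_z a z - kernel_z p z| <= h * dominator u v z.
Proof.
move=> up vp h0.
set A0 := (p.1 ^+ 2 - u) / 2; set B0 := (p.2 ^+ 2 - v) / 2.
have A00 : 0 < A0 by rewrite divr_gt0// subr_gt0.
have B00 : 0 < B0 by rewrite divr_gt0// subr_gt0.
have c0 := kernel_factor_ge0 p; set c := kernel_factor p in c0 *.
have c1 : (fun a : R * R => (a.1 ^+ 2 - u) / 2) @ p --> A0.
  apply: cvgM; last exact: cvg_cst.
  apply: cvgB; last exact: cvg_cst.
  by rewrite expr2; apply: cvgM; exact: cvg_fst.
have c2 : (fun a : R * R => (a.2 ^+ 2 - v) / 2) @ p --> B0.
  apply: cvgM; last exact: cvg_cst.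
  apply: cvgB; last exact: cvg_cst.
  by rewrite expr2; apply: cvgM; exact: cvg_snd.
(* The difference of kernels splits into three terms, each allowed h/3. [A0 / 2] and [B0 / 2] are
   the rates in the Lipschitz bounds, and c + 1 replaces the factor c, which may be 0. *)
have eA : 0 < h * (A0 / 2) / (3 * (c + 1)) by rewrite divr_gt0 ?mulr_gt0//; lra.
have eB : 0 < h * (B0 / 2) / (3 * (c + 1)) by rewrite divr_gt0 ?mulr_gt0//; lra.
have h3 : 0 < h / 3 by rewrite divr_gt0.
near=> a => z z1 z2.
have Aa : A0 / 2 < (a.1 ^+ 2 - u) / 2.
  by near: a; apply: (cvgr_gt _ c1); lra.
have Ba : B0 / 2 < (a.2 ^+ 2 - v) / 2.
  by near: a; apply: (cvgr_gt _ c2); lra.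
have dA : `|(a.1 ^+ 2 - u) / 2 - A0| < h * (A0 / 2) / (3 * (c + 1)).
  by near: a; apply: (@cvgr_distC_lt R R^o _ _ _ _ _ c1).
have dB : `|(a.2 ^+ 2 - v) / 2 - B0| < h * (B0 / 2) / (3 * (c + 1)).
  by near: a; apply: (@cvgr_distC_lt R R^o _ _ _ _ _ c2).
have dc : `|kernel_factor a - c| < h / 3.
  by near: a; apply: (@cvgr_distC_lt R R^o _ _ _ _ _ (@kernel_factor_cvg p)).
rewrite !kernel_zE// (dominator_shift u v (a.1 ^+ 2)) (dominator_shift u v (p.1 ^+ 2)).
rewrite -/c -/A0 -/B0.
set A := (_ - u) / 2 in Aa dA *; set B := (_ - v) / 2 in Ba dB *.
have s0 : 0 <= z.1 + z.2 by rewrite addr_ge0.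
have w0 : 0 <= z.1^-1 + z.2^-1 by rewrite addr_ge0// invr_ge0.
have A20 : 0 < A0 / 2 by rewrite divr_gt0.
have B20 : 0 < B0 / 2 by rewrite divr_gt0.
have A02 : A0 / 2 <= A0 by clear -A00; lra.
have B02 : B0 / 2 <= B0 by clear -B00; lra.
have lA := expRN_scaled_lipschitz A20 (ltW Aa) A02 s0.
have lB := expRN_scaled_lipschitz B20 (ltW Ba) B02 w0.
have e1 x y : 0 <= x -> 0 <= y -> expR (- (x * y)) <= 1 :> R.
  by move=> x0 y0; rewrite -expR0 ler_expR oppr_le0 mulr_ge0.
have A_ge0 : 0 <= A := ltW (lt_trans A20 Aa).
have B_ge0 : 0 <= B := ltW (lt_trans B20 Ba).
have c1_gt0 : 0 < c + 1 by rewrite ltr_wpDl.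
have c_le1 : c <= c + 1 by rewrite lerDl.
move: lA lB (e1 _ _ A_ge0 s0) (e1 _ _ B_ge0 w0) (e1 _ _ (ltW A00) s0).
have := expR_ge0 (- (A * (z.1 + z.2))); have := expR_ge0 (- (B * (z.1^-1 + z.2^-1))).
have := expR_ge0 (- (A0 * (z.1 + z.2))).
set X := expR (- (A * _)); set Y := expR (- (B * _)).
set X0 := expR (- (A0 * _)); set Y0 := expR (- (B0 * _)).
move=> X00 Y_0 X_0 lA lB X1 Y1 X01.
have bA : c * (`|A - A0| / (A0 / 2)) <= h / 3.
  apply: (@le_trans _ _ ((c + 1) * (`|A - A0| / (A0 / 2)))).
    by apply: ler_wpM2r => //; apply: divr_ge0 => //; exact: ltW.
  rewrite mulrA ler_pdivrMr// -ler_pdivlMl//.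
  by apply/ltW/(lt_le_trans dA); rewrite le_eqVlt; apply/predU1P; left; clear -c1_gt0; field; lra.
have bB : c * (`|B - B0| / (B0 / 2)) <= h / 3.
  apply: (@le_trans _ _ ((c + 1) * (`|B - B0| / (B0 / 2)))).
    by apply: ler_wpM2r => //; apply: divr_ge0 => //; exact: ltW.
  rewrite mulrA ler_pdivrMr// -ler_pdivlMl//.
  by apply/ltW/(lt_le_trans dB); rewrite le_eqVlt; apply/predU1P; left; clear -c1_gt0; field; lra.
set D := dominator u v z.
have D0 : 0 <= D := dominator_ge0 u v z.
set ka := kernel_factor a in dc *.
clearbody X Y X0 Y0 ka D.
(* Telescoping: the three factors of the kernel are changed one at a time. *)
rewrite (_ : _ - _ = ((ka - c) * (X * Y) + c * ((X - X0) * Y) + c * (X0 * (Y - Y0))) * D);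
  last by ring.
rewrite normrM (ger0_norm D0) ler_wpM2r//.
have t1 : `|(ka - c) * (X * Y)| <= h / 3.
  rewrite normrM (ger0_norm (mulr_ge0 X_0 Y_0)) -[leRHS]mulr1.
  by rewrite ler_pM// ?mulr_ge0 ?mulr_ile1// ltW.
have t2 : `|c * ((X - X0) * Y)| <= h / 3.
  apply: le_trans bA; rewrite normrM (ger0_norm c0) ler_wpM2l// normrM (ger0_norm Y_0).
  by rewrite -[leRHS]mulr1 ler_pM.
have t3 : `|c * (X0 * (Y - Y0))| <= h / 3.
  apply: le_trans bB; rewrite normrM (ger0_norm c0) ler_wpM2l// normrM (ger0_norm X00).
  by rewrite -[leRHS]mul1r ler_pM.
rewrite (le_trans (ler_normD _ _))// (_ : h = h / 3 + h / 3 + h / 3); last by clear; lra.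
by rewrite lerD// (le_trans (ler_normD _ _))// lerD.
Unshelve. all: by end_near. Qed.

(** Near p the squares of the coordinates remain below u and v, so the exponent of the kernel beats
    that of the dominator, and by continuity [kernel_factor] stays above half its value at p, which
    is positive because p.2 != 0. *)
Lemma kernel_z_lower_bound (u v : R) p :
  p.1 ^+ 2 < u -> p.2 ^+ 2 < v -> p.2 != 0 ->
  exists2 c : R, 0 < c & \forall a \near p, forall z, 0 <= z.1 -> 0 <= z.2 ->
    c * dominator u v z <= kernel_z a z.
Proof.
move=> pu pv p2; have c0 := kernel_factor_gt0 p2.
exists (kernel_factor p / 2); first by rewrite divr_gt0.
have c1 : (fun a : R * R => a.1 ^+ 2) @ p --> p.1 ^+ 2.
  by rewrite expr2; apply: cvgM; exact: cvg_fst.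
have c2 : (fun a : R * R => a.2 ^+ 2) @ p --> p.2 ^+ 2.
  by rewrite expr2; apply: cvgM; exact: cvg_snd.
near=> a => z z1 z2.
have au : a.1 ^+ 2 < u by near: a; exact: (cvgr_lt _ c1).
have av : a.2 ^+ 2 < v by near: a; exact: (cvgr_lt _ c2).
have ca : kernel_factor p / 2 < kernel_factor a.
  by near: a; apply: (cvgr_gt _ (@kernel_factor_cvg p)); lra.
rewrite kernel_zE// ler_pM// ?dominator_ge0//; [|exact: ltW|].
  by rewrite divr_ge0// ltW.
rewrite /dominator ler_wpM2l ?ler_expR ?invr_ge0 ?mulr_ge0 ?powR_ge0//.
by rewrite lerB ?lerN2// ler_wpM2r ?addr_ge0 ?invr_ge0// ler_pM2r ?invr_gt0// ltW.
Unshelve. all: by end_near. Qed.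

End kernel_estimates.

(** * Sigma-finiteness of a product measure *)

Section product_sigma_finite.
Context d1 d2 (T1 : measurableType d1) (T2 : measurableType d2) (R : realType).
Variables (m1 : {sigma_finite_measure set T1 -> \bar R})
          (m2 : {sigma_finite_measure set T2 -> \bar R}).

Lemma sigma_finite_product : sigma_finite setT (m1 \x m2)%E.
Proof.
have /sigma_finiteP[F [TF ndF Foo]] := sigma_finiteT m1.
have /sigma_finiteP[G [TG ndG Goo]] := sigma_finiteT m2.
exists (fun n => F n `*` G n).
  apply/seteqP; split=> [[x y] _|//].
  have [n _ Fx] : (\bigcup_i F i) x by rewrite -TF.
  have [m _ Gy] : (\bigcup_i G i) y by rewrite -TG.
  (* Both exhausting sequences are nondecreasing, so one index serves both coordinates. *)
  exists (maxn n m) => //; split=> /=.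
    by move: x Fx; exact/subsetPset/ndF/leq_maxl.
  by move: y Gy; exact/subsetPset/ndG/leq_maxr.
move=> n; have [mF Fn] := Foo n; have [mG Gn] := Goo n.
split; first exact: measurableX.
by rewrite product_measure1E// lte_mul_pinfty// ge0_fin_numE.
Qed.

(* The library declares this structure on [m1 \x m2] for subprobabilities
   first, so that inference does not find it for sigma-finite measures. *)
Definition product_sigma_finite :
    {sigma_finite_measure set (T1 * T2)%type -> \bar R} :=
  HB.pack (m1 \x m2)%E (Measure_isSigmaFinite.Build _ _ _ (m1 \x m2)%E
    sigma_finite_product).

End product_sigma_finite.

(** * A bound on the mass of the inverse Gaussian density, uniform in its parameters *)

Section inverse_gaussian_mass.
Context {R : realType}.
Notation mu := (@lebesgue_measure R).

Lemma measurable_invr : measurable_fun [set: R] (@GRing.inv R).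
Proof.
rewrite -(setUv [set 0]); apply/measurable_funU => //; first exact: measurableC.
split; first exact: measurable_fun_set1.
apply: open_continuous_measurable_fun.
  by apply: closed_openC; exact: closed_eq.
by move=> x /set_mem /= /eqP x0; exact: inv_continuous.
Qed.

(** Up to the factor (2 pi)^(-1/2), the density of the first passage time at level [a2] of a
    Brownian motion with drift [a1]. The kernel is a product of two of these. *)
Definition ig_dens (a1 a2 t : R) : R :=
  a2 / t `^ (3%:R / 2%:R) * expR (- ((a1 * t - a2) ^+ 2 / (2%:R * t))).

Lemma kernel_z_prod (a z : R * R) :
  kernel_z a z = ig_dens a.1 a.2 z.1 * ig_dens a.1 a.2 z.2.
Proof.
by rewrite /kernel_z /ig_dens mulrACA -expRD invfM expr2 mulrACA mulrA.
Qed.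

Lemma measurable_ig_dens_prod :
  measurable_fun [set: R * (R * R)] (fun x => ig_dens x.2.1 x.2.2 x.1).
Proof.
have m1 : measurable_fun [set: R * (R * R)] (fun x => x.2.1).
  exact: (measurableT_comp measurable_fst measurable_snd).
have m2 : measurable_fun [set: R * (R * R)] (fun x => x.2.2).
  exact: (measurableT_comp measurable_snd measurable_snd).
have m0 : measurable_fun [set: R * (R * R)] fst by exact: measurable_fst.
rewrite /ig_dens; apply: measurable_funM.
  apply: measurable_funM => //; apply: (measurableT_comp measurable_invr).
  exact: (measurableT_comp (@measurable_powR R _) m0).
apply: (measurableT_comp (@measurable_expR R)); apply: (measurableT_comp (@oppr_measurable R _)).
apply: measurable_funM.
  by apply/measurable_funX/measurable_funB => //; exact: measurable_funM.
by apply: (measurableT_comp measurable_invr); exact: measurable_funM.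
Qed.

Lemma measurable_ig_dens a1 a2 : measurable_fun [set: R] (ig_dens a1 a2).
Proof.
exact: (measurableT_comp measurable_ig_dens_prod (@pair2_measurable _ _ _ _ (a1, a2))).
Qed.

Lemma measurable_kernel_z :
  measurable_fun [set: (R * R) * (R * R)] (fun x => kernel_z x.2 x.1).
Proof.
have m1 : measurable_fun [set: (R * R) * (R * R)] (fun x => (x.1.1, x.2)).
  by apply/measurable_fun_pair => //; exact: (measurableT_comp measurable_fst measurable_fst).
have m2 : measurable_fun [set: (R * R) * (R * R)] (fun x => (x.1.2, x.2)).
  by apply/measurable_fun_pair => //; exact: (measurableT_comp measurable_snd measurable_fst).
under eq_fun do rewrite kernel_z_prod.
apply: measurable_funM; first exact: (measurableT_comp measurable_ig_dens_prod m1).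
exact: (measurableT_comp measurable_ig_dens_prod m2).
Qed.


Lemma ig_dens_ge0 (a1 a2 t : R) : 0 <= a2 -> 0 <= ig_dens a1 a2 t.
Proof. by move=> a20; rewrite mulr_ge0 ?expR_ge0// divr_ge0// powR_ge0. Qed.

(** A majorant with an explicit primitive: [dpsi] is the derivative of [psi] and [h] that of 4
    atan(psi). The absolute value of [a1] makes [psi] increasing for either sign of the drift when
    a2 >= 0. *)
Let psi (a1 a2 t : R) : R := `|a1| * Num.sqrt t - a2 * (Num.sqrt t)^-1.
Let dpsi (a1 a2 t : R) : R :=
  (`|a1| * (Num.sqrt t)^-1 + a2 * (Num.sqrt t)^-1 ^+ 3) / 2.
Let h (a1 a2 t : R) : R := 4 * (dpsi a1 a2 t * (1 + psi a1 a2 t ^+ 2)^-1).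

Lemma powR32 (t : R) : 0 <= t -> t `^ (3%:R / 2%:R) = Num.sqrt t ^+ 3.
Proof.
move=> t0; have -> : 3%:R / 2%:R = 2^-1 * 3%:R :> R by rewrite mulrC.
by rewrite powRrM powR12_sqrt// powR_mulrn// sqrtr_ge0.
Qed.

(** The prefactor a2 t^(-3/2) is at most 2 [dpsi], and the exponential is at most e^(-psi^2/2) <= 2
    / (1 + psi^2); these two factors 2 make the 4 in [h]. *)
Let ig_dens_le (a1 a2 t : R) : 0 <= a2 -> 0 < t -> ig_dens a1 a2 t <= h a1 a2 t.
Proof.
move=> a20 t0; rewrite /ig_dens powR32; last exact: ltW.
have st : 0 < Num.sqrt t by rewrite sqrtr_gt0.
have tE : t = Num.sqrt t ^+ 2 by rewrite sqr_sqrtr// ltW.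
have a2s : 0 <= a2 / Num.sqrt t ^+ 3 by rewrite divr_ge0// exprn_ge0// ltW.
rewrite /h (_ : 4 * _ = (2 * dpsi a1 a2 t) * (2 * (1 + psi a1 a2 t ^+ 2)^-1)); last by ring.
apply: ler_pM; [exact: a2s|exact: expR_ge0| |].
  have : 0 <= `|a1| * (Num.sqrt t)^-1 by rewrite mulr_ge0// invr_ge0 ltW.
  by rewrite /dpsi exprVn; clear; lra.
(* Replacing a1 by its absolute value can only lower the square, as a2 t >= 0. *)
have psi2 : psi a1 a2 t ^+ 2 <= (a1 * t - a2) ^+ 2 / t.
  have -> : psi a1 a2 t ^+ 2 = (`|a1| * t - a2) ^+ 2 / t.
    by move: st tE; rewrite /psi; move: (Num.sqrt t) => s s0 ->; field; rewrite gt_eqF.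
  rewrite ler_pM2r ?invr_gt0//.
  rewrite !sqrrB !exprMn real_normK ?num_real// lerD2r lerD2l lerN2.
  rewrite lerMn2r/= -mulrA -[leRHS]mulrA ler_wpM2r ?ler_norm//.
  by rewrite mulr_ge0// ltW.
apply: (@le_trans _ _ (expR (- (psi a1 a2 t ^+ 2 / 2)))).
  rewrite ler_expR lerN2 [leRHS](_ : _ = (a1 * t - a2) ^+ 2 / t / 2).
    by rewrite ler_pM2r.
  by field; rewrite gt_eqF.
have p0 : 0 <= psi a1 a2 t ^+ 2 by exact: sqr_ge0.
have p1 : 0 < 1 + psi a1 a2 t ^+ 2 by rewrite ltr_pwDl.
rewrite expRN -[leLHS]div1r ler_pdivrMr ?expR_gt0// mulrAC ler_pdivlMr//.
by have := expR_ge1Dx (psi a1 a2 t ^+ 2 / 2); clear; lra.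
Qed.

Let is_derive_h (a1 a2 t : R) : 0 < t ->
  is_derive t 1 (fun x => 4 * atan (psi a1 a2 x)) (h a1 a2 t).
Proof.
move=> t0.
have ds := is_derive1_sqrt t0.
have s0 : Num.sqrt t != 0 by rewrite sqrtr_eq0 -ltNge.
have dv : is_derive t 1 (fun x : R => (Num.sqrt x)^-1) (- (Num.sqrt t)^-2 * (2 * Num.sqrt t)^-1).
  exact: is_deriveV.
have dp : is_derive t 1 (psi a1 a2) (dpsi a1 a2 t).
  apply: (@is_derive_eq _ _ _ _ _ _ _ _ (is_deriveB (is_deriveZ `|a1| ds) (is_deriveZ a2 dv))).
  by rewrite /dpsi /GRing.scale/=; field.
apply: (@is_derive_eq _ _ _ _ _ _ _ _ (is_deriveZ 4 (is_derive1_comp (is_derive1_atan _) dp))).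
by rewrite /h /GRing.scale/= [X in _ = 4 * X]mulrC.
Qed.

Let continuous_h (a1 a2 t : R) : 0 < t -> {for t, continuous (h a1 a2)}.
Proof.
move=> t0.
have s0 : Num.sqrt t != 0 by rewrite sqrtr_eq0 -ltNge.
have cs : Num.sqrt x @[x --> t] --> Num.sqrt t by exact: sqrt_continuous.
have cv : (Num.sqrt x)^-1 @[x --> t] --> (Num.sqrt t)^-1 by exact: cvgV.
have cp : psi a1 a2 x @[x --> t] --> psi a1 a2 t.
  by apply: cvgB; apply: cvgM => //; exact: cvg_cst.
apply: cvgM; first exact: cvg_cst.
apply: cvgM.
  apply: cvgM; last exact: cvg_cst.
  apply: cvgD; first by apply: cvgM => //; exact: cvg_cst.
  apply: cvgM; first exact: cvg_cst.
  by apply: (@continuous_cvg _ _ _ _ _ _ (fun y : R => y ^+ 3)) => //; exact: exprn_continuous.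
apply: cvgV; first by rewrite gt_eqF// ltr_pwDl// sqr_ge0.
apply: cvgD; first exact: cvg_cst.
by apply: (@continuous_cvg _ _ _ _ _ _ (fun y : R => y ^+ 2)) => //; exact: exprn_continuous.
Qed.

(** The arctangent varies by at most pi, whatever the parameters and the interval. *)
Let integral_h_le (a1 a2 a b : R) : 0 < a -> a < b ->
  (\int[mu]_(t in `[a, b]) (h a1 a2 t)%:E <= (4 * pi)%:E)%E.
Proof.
move=> a0 ab.
have d (t : R) : 0 < t -> is_derive t 1 (fun x => 4 * atan (psi a1 a2 x)) (h a1 a2 t).
  exact: is_derive_h.
have c (t : R) : 0 < t -> {for t, continuous (fun x => 4 * atan (psi a1 a2 x))}.
  by move=> t0; apply: differentiable_continuous; apply/derivable1_diffP; have [] := d t t0.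
rewrite (@continuous_FTC2 _ _ (fun x => 4 * atan (psi a1 a2 x)) _ _ ab).
- rewrite -EFinB lee_fin.
  have := atan_ltpi2 (psi a1 a2 b); have := atan_gtNpi2 (psi a1 a2 a).
  by clear; lra.
- apply: continuous_in_subspaceT => x /set_mem/=; rewrite ?in_itv/= => /andP[ax _].
  by apply: continuous_h; exact: lt_le_trans ax.
- split.
  + by move=> x; rewrite ?in_itv/= => /andP[ax _]; have [] := d x (lt_trans a0 ax).
  + by apply: cvg_at_right_filter; exact: c.
  + by apply: cvg_at_left_filter; apply: c; exact: lt_trans ab.
- move=> x; rewrite ?in_itv/= => /andP[ax _]; rewrite derive1E.
  by have /@derive_val := d x (lt_trans a0 ax).
Qed.

Lemma ig_dens_mass (a1 a2 : R) : 0 <= a2 ->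
  (\int[mu]_(t in `]0%R, +oo[) (ig_dens a1 a2 t)%:E <= (4 * pi)%:E)%E.
Proof.
(* The fundamental theorem is applied on compact intervals exhausting the half-line. Starting at 2
   rather than 1 keeps the end points distinct. *)
move=> a20; pose F n : set R := `[n.+2%:R^-1, n.+2%:R]%classic.
have -> : `]0%R, +oo[%classic = \bigcup_n F n.
  apply/seteqP; split=> [x|x [n _]]/=.
    rewrite ?in_itv/= andbT => x0.
    have [n nx] := ltr_add_invr x0.
    have nx' : n.+1%:R^-1 < x by rewrite add0r in nx.
    exists (n + Num.truncn x)%N => //=; rewrite ?in_itv/=; apply/andP; split.
      apply: le_trans (ltW nx'); rewrite lef_pV2 ?posrE// ler_nat.
      by rewrite ltnS (leq_trans (leq_addr (Num.truncn x) n)).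
    apply: (le_trans (ltW (truncnS_gt _))).
    by rewrite ler_nat ltnS (leq_trans (leq_addl n _)).
  by rewrite /F/= ?in_itv/= ?andbT => /andP[+ _]; apply: lt_le_trans.
have nd : nondecreasing_seq F.
  move=> m n mn; rewrite subsetEset => x; rewrite /F/= ?in_itv/= => /andP[mx xm].
  apply/andP; split; last by apply: (le_trans xm); rewrite ler_nat.
  by apply: le_trans mx; rewrite lef_pV2 ?posrE// ler_nat.
have mig n : measurable_fun (F n) (EFin \o ig_dens a1 a2).
  apply: measurable_funTS; apply/measurable_EFinP; exact: measurable_ig_dens.
have cF : (\int[mu]_(t in F n) (ig_dens a1 a2 t)%:E)%E @[n --> \oo] -->
    (\int[mu]_(t in \bigcup_n F n) (ig_dens a1 a2 t)%:E)%E.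
  apply: ge0_nondecreasing_set_cvg_integral => //.
  - by move=> n; exact: measurable_itv.
  - by move=> n x _; rewrite lee_fin ig_dens_ge0.
rewrite -(cvg_lim _ cF)//; apply: lime_le; first by apply/cvg_ex; eexists; exact: cF.
near=> n.
have Fpos x : F n x -> 0 < x.
  by rewrite /F/= ?in_itv/= => /andP[+ _]; apply: lt_le_trans.
have ab : n.+2%:R^-1 < n.+2%:R :> R.
  by rewrite (@lt_trans _ _ 1)// ?invf_lt1// ltr1n.
apply: le_trans (integral_h_le a1 a2 _ ab); last by rewrite invr_gt0.
apply: ge0_le_integral => //.
- exact: measurable_itv.
- by move=> x Fx; rewrite lee_fin ig_dens_ge0.
- exact: mig.
- apply/measurable_EFinP; apply: subspace_continuous_measurable_fun; first exact: measurable_itv.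
  apply: continuous_in_subspaceT => x /set_mem Fx; apply: continuous_h.
  exact: Fpos.
- by move=> x Fx; rewrite lee_fin ig_dens_le// Fpos.
Unshelve. all: by end_near. Qed.

End inverse_gaussian_mass.

Lemma integrable_ge0 d (T : measurableType d) {R : realType}
    (mu : {measure set T -> \bar R}) (f : T -> R) :
  measurable_fun [set: T] f -> (forall x, 0 <= f x) ->
  (\int[mu]_x (f x)%:E < +oo)%E -> mu.-integrable [set: T] (EFin \o f).
Proof.
move=> mf f0 foo; apply/integrableP; split; first exact/measurable_EFinP.
rewrite (eq_integral (fun x => (f x)%:E))// => x _ /=.
by rewrite ger0_norm.
Qed.

(** * Second moments under a weighted measure *)

Section weighted_second_moment.
Context d (T : measurableType d) {R : realType} (mu : {measure set T -> \bar R}).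
Variables w X : T -> R.
Hypotheses (mw : measurable_fun [set: T] w) (mX : measurable_fun [set: T] X).
Hypothesis w0 : forall t, 0 <= w t.
Hypothesis iw : mu.-integrable [set: T] (EFin \o w).
Hypothesis iXX : mu.-integrable [set: T] (EFin \o (fun t => X t ^+ 2 * w t)).

Lemma weighted_integrable : mu.-integrable [set: T] (EFin \o (fun t => X t * w t)).
Proof.
apply: (le_integrable measurableT _ _ (integrableD measurableT iw iXX)).
  by apply/measurable_EFinP/measurable_funM.
move=> t _ /=; rewrite lee_fin normrM (ger0_norm (w0 t)).
rewrite [leRHS]ger0_norm; last by rewrite addr_ge0// mulr_ge0// sqr_ge0.
rewrite -{2}[w t]mul1r -mulrDl ler_wpM2r//.
(* It remains to see that y <= 1 + y^2, which follows from (y - 1/2)^2 >= 0. *)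
rewrite -(real_normK (num_real (X t))); set y := `|X t|.
by have := sqr_ge0 (y - 2^-1); rewrite sqrrB; lra.
Qed.

Let shifted e : (fun t => (X t - e) ^+ 2 * w t) =
  (fun t => X t ^+ 2 * w t + (- (2 * e) * (X t * w t) + e ^+ 2 * w t)).
Proof. by apply/funext => t; ring. Qed.

Let iE e : mu.-integrable [set: T]
  (EFin \o (fun t => - (2 * e) * (X t * w t) + e ^+ 2 * w t)).
Proof.
under [X in _.-integrable _ X]funext do rewrite /= EFinD !EFinM.
apply: integrableD => //; last exact: integrableZl.
exact: (integrableZl measurableT _ weighted_integrable).
Qed.

Lemma integrable_shifted e :
  mu.-integrable [set: T] (EFin \o (fun t => (X t - e) ^+ 2 * w t)).
Proof.
rewrite shifted; under [X in _.-integrable _ X]funext do rewrite /= EFinD.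
exact: (integrableD measurableT iXX (iE e)).
Qed.

Lemma Rintegral_shifted e :
  \int[mu]_t ((X t - e) ^+ 2 * w t) =
  \int[mu]_t (X t ^+ 2 * w t) - 2 * e * \int[mu]_t (X t * w t)
    + e ^+ 2 * \int[mu]_t w t.
Proof.
rewrite shifted (RintegralD measurableT iXX (iE e)) -addrA; congr (_ + _).
rewrite RintegralD//.
- rewrite RintegralZl//; last exact: weighted_integrable.
  by rewrite RintegralZl// mulNr.
- exact: (integrableZl measurableT _ weighted_integrable).
- exact: (integrableZl measurableT _ iw).
Qed.

(** The shifted second moment is nonnegative; the shift c / W is the one that minimizes it. *)
Lemma weighted_cauchy_schwarz : 0 < \int[mu]_t w t ->
  (\int[mu]_t (X t * w t)) ^+ 2 <= \int[mu]_t w t * \int[mu]_t (X t ^+ 2 * w t).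
Proof.
set W := \int[mu]_t w t; set c := \int[mu]_t (X t * w t) => W0.
have : 0 <= \int[mu]_t ((X t - c / W) ^+ 2 * w t).
  by apply: Rintegral_ge0 => t _; rewrite mulr_ge0// sqr_ge0.
rewrite Rintegral_shifted -/W -/c; set Q := \int[mu]_t (X t ^+ 2 * w t).
have -> : Q - 2 * (c / W) * c + (c / W) ^+ 2 * W = (W * Q - c ^+ 2) / W.
  by field; rewrite gt_eqF.
by rewrite pmulr_lge0 ?invr_gt0// subr_ge0.
Qed.

Lemma weighted_variance_le : \int[mu]_t w t = 1 ->
  \int[mu]_t ((X t - \int[mu]_t (X t * w t)) ^+ 2 * w t) <=
  \int[mu]_t (X t ^+ 2 * w t).
Proof.
move=> w1; rewrite Rintegral_shifted w1; set c := \int[mu]_t (X t * w t).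
have -> : forall Q, Q - 2 * c * c + c ^+ 2 * 1 = Q - c ^+ 2 by move=> Q; ring.
by rewrite gerBl sqr_ge0.
Qed.

End weighted_second_moment.

(** From (p + c)^2 <= 2 p^2 + 2 c^2. In the application [W] is the density of the observation, [p]
    the contribution of the direction with small score, and [c] that of the approximation error,
    whose bound is Cauchy-Schwarz. *)
Lemma sqr_add_le (R : realFieldType) (p c q h W : R) :
  c ^+ 2 <= W * q -> p ^+ 2 <= h ^+ 2 * W ^+ 2 ->
  (p + c) ^+ 2 <= (2 * h ^+ 2 * W + 2 * q) * W.
Proof.
move=> cq ph; have : 0 <= (p - c) ^+ 2 by exact: sqr_ge0.
rewrite sqrrB sqrrD.
have -> : (2 * h ^+ 2 * W + 2 * q) * W = 2 * (h ^+ 2 * W ^+ 2) + 2 * (W * q) by ring.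
lra.
Qed.

(** * Conditional means in an abstract mixture model *)

Section conditional_mean.
Context d1 d2 (X : measurableType d1) (Y : measurableType d2) {R : realType}.
Variables (mu : {sigma_finite_measure set X -> \bar R}) (eta : probability Y R).
Variable k : X * Y -> R.
Hypotheses (mk : measurable_fun [set: X * Y] k) (k0 : forall p, 0 <= k p).
Variable K : R.
Hypothesis kK : forall y, (\int[mu]_x (k (x, y))%:E <= K%:E)%E.
Hypothesis k1 : (\int[mu]_x \int[eta]_y (k (x, y))%:E = 1)%E.

Let D x := (\int[eta]_y (k (x, y))%:E)%E.
Let N (b : Y -> R) x := (\int[eta]_y (b y * k (x, y))%:E)%E.

(** Abstract form of the uncentered score operator: the posterior mean of [b] given [x]. The value
    is 0 by convention where the density [D x] is 0 or infinite, or where the numerator is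
    infinite. *)
Definition cond_mean (b : Y -> R) (x : X) : R := fine (N b x / D x)%E.

Let mkx x : measurable_fun [set: Y] (fun y => k (x, y)).
Proof. exact: measurableT_comp. Qed.

Let measurable_snd_mul (f : Y -> R) : measurable_fun [set: Y] f ->
  measurable_fun [set: X * Y] (fun p => f p.2 * k p).
Proof.
by move=> mf; apply: measurable_funM => //; exact: (measurableT_comp mf measurable_snd).
Qed.

Let mD : measurable_fun [set: X] D.
Proof.
apply: (measurable_fun_fubini_tonelli_F (EFin \o k)).
  exact/measurable_EFinP.
by move=> p; rewrite lee_fin.
Qed.

Let D0 x : (0 <= D x)%E.
Proof. by apply: integral_ge0 => y _; rewrite lee_fin. Qed.

Let mN b : measurable_fun [set: Y] b -> measurable_fun [set: X] (N b).
Proof.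
move=> mb; pose g p := (b p.2 * k p)%:E.
have mg : measurable_fun [set: X * Y] g.
  by apply/measurable_EFinP; exact: measurable_snd_mul.
have -> : N b = (fun x => (fubini_F eta g^\+ x - fubini_F eta g^\- x)%E).
  apply/funext => x; rewrite /N [LHS]integralE; congr (_ - _)%E.
    by apply: eq_integral => y _; rewrite !funeposE.
  by apply: eq_integral => y _; rewrite !funenegE.
apply: emeasurable_funB.
  by apply: measurable_fun_fubini_tonelli_F => //; exact: measurable_funepos.
by apply: measurable_fun_fubini_tonelli_F => //; exact: measurable_funeneg.
Qed.

(** The extended and the real quotient agree in the degenerate cases too: if D x = 0 then k (x, .)
    vanishes almost everywhere and so does the numerator, and infinite values are sent to 0 by
    [fine] on both sides. *)
Let cond_meanE b x : measurable_fun [set: Y] b ->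
  cond_mean b x = fine (N b x) / fine (D x).
Proof.
move=> mb; rewrite /cond_mean; have := D0 x.
case DE : (D x) => [r| |]//.
- rewrite lee_fin le_eqVlt => /predU1P[r0|r0].
    have -> : N b x = 0%E.
      have : ae_eq eta [set: Y] (fun y => (k (x, y))%:E) (cst 0%E).
        apply/ae_eq_integral_abs => //; first exact/measurable_EFinP.
        under eq_integral do rewrite gee0_abs ?lee_fin//.
        by rewrite -/(D x) DE -r0.
      move=> kae; rewrite /N -(integral0 eta [set: Y]).
      apply: ae_eq_integral => //.
        by apply/measurable_EFinP/measurable_funM.
      by apply: filterS kae => y /= /(_ I)[->] _; rewrite mulr0.
    by rewrite -r0 mul0e /= mul0r.
  rewrite inver gt_eqF//=; case: (N b x) => [s| |]//=.
    by rewrite gt0_mulye ?lte_fin ?invr_gt0// mul0r.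
  by rewrite gt0_mulNye ?lte_fin ?invr_gt0// mul0r.
- by move=> _; rewrite invey mule0/= invr0 mulr0.
Qed.

Let measurable_cond_mean b : measurable_fun [set: Y] b ->
  measurable_fun [set: X] (cond_mean b).
Proof.
move=> mb; rewrite (_ : cond_mean b = fun x => fine (N b x) / fine (D x)); last first.
  by apply/funext => x; exact: cond_meanE.
apply: measurable_funM; first exact: (measurableT_comp (@fine_measurable R _ measurableT) (mN mb)).
apply: (measurableT_comp measurable_invr).
exact: (measurableT_comp (@fine_measurable R _ measurableT) mD).
Qed.

Let w x := fine (D x).

Let w0 x : 0 <= w x. Proof. exact: fine_ge0. Qed.

Let mw : measurable_fun [set: X] w.
Proof. exact: (measurableT_comp (@fine_measurable R _ measurableT) mD). Qed.

Let iD : mu.-integrable [set: X] D.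
Proof.
apply/integrableP; split => //.
by under eq_integral do rewrite gee0_abs//; rewrite k1 ltry.
Qed.

Let Dw : {ae mu, forall x, D x = (w x)%:E}.
Proof.
have := integrable_ae measurableT iD.
by apply: filterS => x /(_ I) Dx; rewrite /w fineK.
Qed.

Let integral_mulD (f : X -> R) : measurable_fun [set: X] f ->
  (\int[mu]_x ((f x)%:E * D x) = \int[mu]_x (f x * w x)%:E)%E.
Proof.
move=> mf; apply: ae_eq_integral => //.
- by apply: emeasurable_funM => //; exact/measurable_EFinP.
- by apply/measurable_EFinP/measurable_funM.
- by apply: filterS Dw => x -> _; rewrite EFinM.
Qed.

Let integral_w : (\int[mu]_x (w x)%:E = 1)%E.
Proof.
rewrite -k1; apply: ae_eq_integral => //; first exact/measurable_EFinP.
by apply: filterS Dw => x /= Dx _; rewrite -/(D x) Dx.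
Qed.

Let iw : mu.-integrable [set: X] (EFin \o w).
Proof.
by apply: integrable_ge0 => //; rewrite integral_w ltry.
Qed.

(** After exchanging the integrals, the inner one is the mass of the kernel at [y], at most K.
    Applied to a squared function, this is what bounds the score operator. *)
Lemma integral_mixture_le (f : Y -> R) : measurable_fun [set: Y] f ->
  (forall y, 0 <= f y) ->
  (\int[mu]_x \int[eta]_y (f y * k (x, y))%:E <= K%:E * \int[eta]_y (f y)%:E)%E.
Proof.
move=> mf f0.
have mfk := measurable_snd_mul mf.
rewrite (fubini_tonelli (fun p => (f p.2 * k p)%:E)); last 2 first.
- exact/measurable_EFinP.
- by move=> p; rewrite lee_fin mulr_ge0.
have K0 : 0 <= K.
  by rewrite -lee_fin (le_trans _ (kK point))// integral_ge0// => x _; rewrite lee_fin.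
rewrite -ge0_integralZl_EFin//; last 2 first.
- by move=> y _; rewrite lee_fin.
- exact/measurable_EFinP.
apply: ge0_le_integral => //.
- by move=> y _; apply: integral_ge0 => x _; rewrite lee_fin mulr_ge0.
- apply: (measurable_fun_fubini_tonelli_G (fun p => (f p.2 * k p)%:E)).
    exact/measurable_EFinP.
  by move=> p; rewrite lee_fin mulr_ge0.
- by apply: emeasurable_funM => //; exact/measurable_EFinP.
- move=> y _; rewrite (eq_integral (fun x => (f y)%:E * (k (x, y))%:E)%E); last first.
    by move=> x _; rewrite EFinM.
  rewrite ge0_integralZl_EFin//.
  + by rewrite muleC lee_wpmul2r// lee_fin.
  + by move=> x _; rewrite lee_fin.
  + by apply/measurable_EFinP; exact: (measurableT_comp mk (@pair2_measurable _ _ _ _ y)).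
Qed.


Section second_moment.
(** In the application [phi] is a direction with small score, [m] its mean, and [b] an element of
    the tangent space close to phi - m, so that [psi] below is the approximation error. *)
Variables (b phi : Y -> R) (M m h : R).
Hypotheses (mb : measurable_fun [set: Y] b) (mphi : measurable_fun [set: Y] phi).
Hypotheses (phiM : forall y, `|phi y| <= M) (h0 : 0 <= h).
Hypothesis phi_small :
  forall x, D x \is a fin_num ->
    (`|\int[eta]_y (phi y * k (x, y))%:E| <= h%:E * D x)%E.
Let psi y := b y - phi y + m.

Let mpsi : measurable_fun [set: Y] psi.
Proof. by apply: measurable_funD => //; exact: measurable_funB. Qed.

Let Q x := (\int[eta]_y (psi y ^+ 2 * k (x, y))%:E)%E.

Let Q0 x : (0 <= Q x)%E.
Proof. by apply: integral_ge0 => y _; rewrite lee_fin mulr_ge0// sqr_ge0. Qed.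

(** Since b + m = phi + psi, the posterior mean splits in two: the part from [phi] is small by
    [phi_small], and the part from [psi] is controlled by Cauchy-Schwarz under the posterior. *)
Let cond_mean_pointwise x :
  (((cond_mean b x + m) ^+ 2 * w x)%:E <= (2 * h ^+ 2)%:E * D x + 2%:E * Q x)%E.
Proof.
(* This case includes an infinite D x, for which [fine] gives 0. *)
have [w_eq0|wneq0] := eqVneq (w x) 0.
  rewrite w_eq0 mulr0 adde_ge0// mule_ge0// lee_fin.
  by rewrite mulr_ge0// sqr_ge0.
have wx0 : 0 < w x by rewrite lt_neqAle eq_sym wneq0 w0.
have Dfin : D x \is a fin_num.
  by apply: contra_neqT wneq0 => Dx; rewrite /w; move: Dx; case: (D x).
have DE : D x = (w x)%:E by rewrite /w fineK.
have [Qfin|] := boolP (Q x \is a fin_num); last first.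
  rewrite ge0_fin_numE// -leNgt leye_eq => /eqP ->.
  by rewrite gt0_muley ?lte_fin// addey ?leey// DE -EFinM.
pose kx y := k (x, y).
have mkx' : measurable_fun [set: Y] kx := mkx x.
have ik : eta.-integrable [set: Y] (EFin \o kx).
  apply: integrable_ge0; [exact: mkx|by move=> y; exact: k0|].
  by rewrite -ge0_fin_numE//; exact: D0.
have ipsi2 : eta.-integrable [set: Y] (EFin \o (fun y => psi y ^+ 2 * kx y)).
  apply: integrable_ge0.
  - by apply: measurable_funM; [exact: measurable_funX|exact: mkx].
  - by move=> y; rewrite mulr_ge0// ?sqr_ge0//; exact: k0.
  - by rewrite -ge0_fin_numE//; exact: Q0.
have kx0 y : 0 <= kx y by exact: k0.
have ipsi := weighted_integrable mkx' mpsi kx0 ik ipsi2.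
have iphi : eta.-integrable [set: Y] (EFin \o (fun y => phi y * kx y)).
  apply: (le_integrable measurableT _ _ (integrableZl measurableT M ik)).
    by apply/measurable_EFinP; exact: measurable_funM.
  move=> y _ /=; rewrite lee_fin !normrM ler_wpM2r//.
  exact: le_trans (ler_norm _).
have wE : \int[eta]_y kx y = w x by [].
have CS := weighted_cauchy_schwarz mkx' mpsi kx0 ik ipsi2.
rewrite wE in CS; have {}CS := CS wx0.
have im : eta.-integrable [set: Y] (EFin \o (fun y => - m * kx y)).
  exact: (integrableZl measurableT (- m) ik).
have ipp : eta.-integrable [set: Y] (EFin \o (fun y => phi y * kx y + psi y * kx y)).
  under [X in _.-integrable _ X]funext do rewrite /= EFinD.
  exact: (integrableD measurableT iphi ipsi).
set p := \int[eta]_y (phi y * kx y) in CS *.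
set c := \int[eta]_y (psi y * kx y) in CS *.
set q := \int[eta]_y (psi y ^+ 2 * kx y) in CS *.
have bE : cond_mean b x + m = (p + c) / w x.
  rewrite cond_meanE// -/(w x).
  have -> : fine (N b x) = p + c - m * w x.
    rewrite (_ : fine _ = \int[eta]_y (phi y * kx y + psi y * kx y + - m * kx y)).
      rewrite (RintegralD measurableT ipp im) (RintegralD measurableT iphi ipsi).
      by rewrite RintegralZl// wE mulNr.
    by apply: eq_Rintegral => y _; rewrite /psi /kx; ring.
  by field.
have ph : p ^+ 2 <= h ^+ 2 * w x ^+ 2.
  have := phi_small Dfin; rewrite DE -EFinM.
  rewrite -(fineK (integrable_fin_num measurableT iphi)) /= lee_fin => pw.
  by rewrite -exprMn -(real_normK (num_real p)) lerXn2r ?nnegrE// mulr_ge0.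
have QE : Q x = q%:E by rewrite /q /Rintegral fineK.
rewrite bE DE QE -!EFinM -EFinD lee_fin.
rewrite (_ : _ ^+ 2 * w x = (p + c) ^+ 2 / w x); last by field.
rewrite ler_pdivrMr//.
exact: sqr_add_le.
Qed.

(** Centering removes the constant m, and a variance is at most the second moment, here that of
    [cond_mean b + m]. The pointwise bound then integrates, the density having total mass 1 and the
    kernel mass at most K. *)
Lemma cond_mean_variance_le :
  (\int[eta]_y (psi y ^+ 2)%:E < +oo)%E ->
  (\int[mu]_x (((cond_mean b x -
       fine (\int[mu]_x ((cond_mean b x)%:E * D x))) ^+ 2)%:E * D x) <=
   (2 * h ^+ 2)%:E + (2 * K)%:E * \int[eta]_y (psi y ^+ 2)%:E)%E.
Proof.
move=> psi2.
pose V x := cond_mean b x + m.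
have mu_ : measurable_fun [set: X] (cond_mean b) by exact: measurable_cond_mean.
have mV : measurable_fun [set: X] V by exact: measurable_funD.
have mpsi2 : measurable_fun [set: Y] (fun y => psi y ^+ 2) by exact: measurable_funX.
have mQ : measurable_fun [set: X] Q by exact: mN.
have VQ : (\int[mu]_x (V x ^+ 2 * w x)%:E <=
    (2 * h ^+ 2)%:E + (2 * K)%:E * \int[eta]_y (psi y ^+ 2)%:E)%E.
  have le1 : (\int[mu]_x (V x ^+ 2 * w x)%:E <=
    \int[mu]_x ((2 * h ^+ 2)%:E * D x + 2%:E * Q x))%E.
    apply: ge0_le_integral => //.
    - by move=> x _; rewrite lee_fin mulr_ge0// sqr_ge0.
    - by apply/measurable_EFinP/measurable_funM => //; exact: measurable_funX.
    - apply: emeasurable_funD; exact: emeasurable_funM.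
    - by move=> x _; exact: cond_mean_pointwise.
  apply: (le_trans le1); rewrite ge0_integralD//; last 4 first.
  - by move=> x _; rewrite mule_ge0// lee_fin mulr_ge0// sqr_ge0.
  - exact: emeasurable_funM.
  - by move=> x _; rewrite mule_ge0.
  - exact: emeasurable_funM.
  rewrite ge0_integralZl_EFin//; last by rewrite mulr_ge0// sqr_ge0.
  rewrite k1 mule1 ge0_integralZl_EFin// leeD2l// EFinM -muleA lee_wpmul2l//.
  apply: integral_mixture_le => //.
  by move=> y; exact: sqr_ge0.
have bound_fin : ((2 * h ^+ 2)%:E + (2 * K)%:E * \int[eta]_y (psi y ^+ 2)%:E < +oo)%E.
  rewrite -(@fineK _ (\int[eta]_y (psi y ^+ 2)%:E)%E).
    by rewrite -EFinM -EFinD ltry.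
  by rewrite ge0_fin_numE// integral_ge0// => y _; rewrite lee_fin sqr_ge0.
have iVV : mu.-integrable [set: X] (EFin \o (fun x => V x ^+ 2 * w x)).
  apply: integrable_ge0.
  - by apply: measurable_funM => //; exact: measurable_funX.
  - by move=> x; rewrite mulr_ge0// sqr_ge0.
  - exact: le_lt_trans VQ bound_fin.
have iV := weighted_integrable mw mV w0 iw iVV.
have w1 : \int[mu]_x w x = 1 by rewrite /Rintegral integral_w.
have var := weighted_variance_le mw mV w0 iw iVV w1.
have meanE : fine (\int[mu]_x ((cond_mean b x)%:E * D x)) =
    \int[mu]_x (V x * w x) - m.
  rewrite integral_mulD//.
  rewrite (_ : fine _ = \int[mu]_x (V x * w x - m * w x)).
    rewrite (RintegralB measurableT iV (integrableZl measurableT m iw)).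
    by rewrite RintegralZl// w1 mulr1.
  by apply: eq_Rintegral => x _; rewrite /V; ring.
rewrite meanE; set e := \int[mu]_x (V x * w x) in var *.
have -> : (\int[mu]_x (((cond_mean b x - (e - m)) ^+ 2)%:E * D x) =
    \int[mu]_x ((V x - e) ^+ 2 * w x)%:E)%E.
  rewrite (integral_mulD (f := fun x => (cond_mean b x - (e - m)) ^+ 2)); last first.
    by apply: measurable_funX; exact: measurable_funB.
  by apply: eq_integral => x _; rewrite /V; congr (_ ^+ 2 * _)%:E; ring.
apply: le_trans VQ.
have iVe := integrable_shifted mw mV w0 iw iVV e.
rewrite -(fineK (integrable_fin_num measurableT iVe)).
by rewrite -(fineK (integrable_fin_num measurableT iVV)) lee_fin.
Qed.

End second_moment.

End conditional_mean.

(** Makes a convex [T] measurable, since intervals are. *)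
Lemma convex_set_is_interval {R : realType} (T : set R) :
  @convex_set R R^o T -> is_interval T.
Proof.
move=> cT; apply/is_intervalPlt => x y Tx Ty z /andP[xz zy].
have yx : 0 < y - x by rewrite subr_gt0 (lt_trans xz).
pose t := (y - z) / (y - x).
have t0 : 0 <= t by rewrite divr_ge0// ?subr_ge0 ltW// (lt_trans xz).
have t1 : t <= 1 by rewrite ler_pdivrMr// mul1r lerD2l lerN2 ltW.
have := cT x y (Itv01 t0 t1); rewrite !inE => /(_ Tx Ty).
have E : t * x + (1 - t) * y = z by rewrite /t; field; rewrite gt_eqF.
by move=> h; rewrite -E; exact: h.
Qed.

Lemma open_setX (S T : topologicalType) (A : set S) (B : set T) :
  open A -> open B -> open (A `*` B).
Proof.
rewrite !openE => oA oB [x y] [/= Ax By].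
by exists (A, B) => //=; split; [exact: oA|exact: oB].
Qed.

(** * Mass of the kernel over pairs of times *)

Section kernel_mass.
Context {R : realType}.
Notation mu := (@lebesgue_measure R).
Variable T : set R.
Hypotheses (mT : measurable T) (T_ge0 : T `<=` [set t | 0 <= t]).

(** The kernel factors over the two times, so Tonelli reduces its mass to the square of a
    one-dimensional mass. *)
Lemma kernel_z_mass (a : R * R) : 0 <= a.2 ->
  (\int[@lebesgue2 R]_(z in T `*` T) (kernel_z a z)%:E <= ((4 * pi) ^+ 2)%:E)%E.
Proof.
move=> a20.
pose f t := ig_dens a.1 a.2 t * \1_T t.
have f0 t : 0 <= f t by rewrite mulr_ge0// ?ig_dens_ge0.
have mf : measurable_fun [set: R] f.
  apply: measurable_funM; first exact: measurable_ig_dens.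
  exact: measurable_indic.
have If : (\int[mu]_t (f t)%:E <= (4 * pi)%:E)%E.
  apply: le_trans (ig_dens_mass a.1 a20).
  rewrite [leRHS]integral_mkcond; apply: ge0_le_integral => //.
  - by move=> t _; rewrite lee_fin.
  - exact/measurable_EFinP.
  - apply/(measurable_restrictT _ _).1 => //.
    by apply/measurable_EFinP; apply: measurable_funTS; exact: measurable_ig_dens.
  - move=> t _; rewrite patchE; case: ifPn => [|]; rewrite ?inE/= ?notin_setE/= in_itv/= andbT.
      by move=> t0; rewrite lee_fin /f indicE; case: (_ \in _); rewrite ?mulr1 ?mulr0 ?ig_dens_ge0.
    (* The time 0 may belong to [T] although it lies outside the open half-line; there [ig_dens] is
       0. *)
    move=> /negP; rewrite -leNgt => t0; rewrite lee_fin /f indicE.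
    case: (boolP (t \in T)) => [/set_mem/T_ge0/= t0'|]; last by rewrite mulr0.
    have -> : t = 0 by apply/eqP; rewrite eq_le t0.
    have h32 : 3%:R / 2%:R != 0 :> R by rewrite mulf_neq0 ?invr_eq0 ?pnatr_eq0.
    by rewrite /ig_dens (powR0 h32) invr0 mulr0 !mul0r.
have If0 : (0 <= \int[mu]_t (f t)%:E)%E by apply: integral_ge0 => t _; rewrite lee_fin.
have mff : measurable_fun [set: R * R] (fun z => (f z.1 * f z.2)%:E).
  by apply/measurable_EFinP/measurable_funM; exact: measurableT_comp.
have -> : (\int[@lebesgue2 R]_(z in T `*` T) (kernel_z a z)%:E =
    \int[@lebesgue2 R]_z (f z.1 * f z.2)%:E)%E.
  rewrite /lebesgue2 integral_mkcond; apply: eq_integral => z _.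
  rewrite patchE /f !indicE in_setX.
  case: (z.1 \in T) => /=; last by rewrite mulr0 mul0r.
  case: (z.2 \in T) => /=; last by rewrite !mulr0.
  by rewrite !mulr1 kernel_z_prod.
have -> : (\int[@lebesgue2 R]_z (f z.1 * f z.2)%:E =
    \int[mu]_x ((f x)%:E * \int[mu]_t (f t)%:E))%E.
  rewrite /lebesgue2; etransitivity.
    apply: fubini_tonelli1; first exact: mff.
    by move=> z; rewrite lee_fin mulr_ge0.
  apply: eq_integral => x _; rewrite /fubini_F/= -ge0_integralZl_EFin//.
  - by move=> y _; rewrite lee_fin.
  - exact/measurable_EFinP.
have Ifin : (\int[mu]_t (f t)%:E)%E \is a fin_num.
  by rewrite ge0_fin_numE// (le_lt_trans If)// ltry.
move: If If0; rewrite -(fineK Ifin); set I := fine _; rewrite !lee_fin => If If0.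
rewrite ge0_integralZr//; last 2 first.
- exact/measurable_EFinP.
- by move=> t _; rewrite lee_fin.
rewrite -(fineK Ifin) -/I -EFinM lee_fin expr2 ler_pM//.
Qed.

End kernel_mass.

(** * The support of the heterogeneity *)

Section support.
Context {R : realType}.
Variable eta : probability (R * R)%type R.

(** A product of balls is open, hence charged, and also measurable for the product sigma-algebra,
    which an arbitrary neighbourhood need not be. *)
Lemma supp_box (p : R * R) (A : set (R * R)) : supp eta p -> nbhs p A ->
  exists U, [/\ measurable U, U `<=` A & (0 < eta U)%E].
Proof.
move=> sp /nbhs_ballP[e /= e0 eA]; exists (ball p.1 e `*` ball p.2 e); split.
- by apply: measurableX; exact: measurable_ball.
- by move=> x [x1 x2]; apply: eA; split.
- apply: sp; last by split; exact: ballxx.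
  by apply: open_setX; exact: ball_open.
Qed.

(** The complement of the domain is an open null set. *)
Lemma supp_UHdom : eta (@UHdom R) = 1%E -> supp eta `<=` @UHdom R.
Proof.
move=> H p sp; rewrite /UHdom/= leNgt; apply/negP => p2.
have mU : measurable (@UHdom R).
  rewrite (_ : @UHdom R = setT `*` `[0, +oo[%classic).
    exact: measurableX.
  by apply/seteqP; split=> [x /=|x [_ /=]]; rewrite /UHdom/= in_itv/= andbT.
have oU : open (~` @UHdom R).
  rewrite (_ : ~` @UHdom R = setT `*` [set t | t < 0]).
    by apply: open_setX; [exact: openT|exact: open_lt].
  apply/seteqP; split => x /=; rewrite /UHdom/=.
    by move=> /negP; rewrite -ltNge.
  by move=> [_ x0]; apply/negP; rewrite -ltNge.
have pU : (~` @UHdom R) p by rewrite /UHdom/=; apply/negP; rewrite -ltNge.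
by have := sp _ oU pU; rewrite probability_setC// [eta _]H subee// ltxx.
Qed.

(** An interior point can be moved down a little without leaving the support, hence without its
    second coordinate becoming negative. *)
Lemma interior_supp_gt0 (p : R * R) : eta (@UHdom R) = 1%E ->
  (supp eta)° p -> 0 < p.2.
Proof.
move=> H ip.
have : nbhs p (@UHdom R) by apply: filterS ip; exact: supp_UHdom.
move=> /nbhs_ballP[e /= e0 /(_ (p.1, p.2 - e / 2))]; rewrite /UHdom/=.
have e2 : 0 < e / 2 by rewrite divr_gt0.
move=> eU; apply: (lt_le_trans e2).
rewrite -subr_ge0; apply: eU; split; first exact: ballxx.
by rewrite /ball/= opprB addrC subrK gtr0_norm// ltr_pdivrMr// ltr_pMr// ltr1n.
Qed.

End support.

(** * The mixture density and the variance of a score *)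

Section mixture.
Context {R : realType}.
Variables (T : set R) (eta : probability (R * R)%type R).
Hypotheses (T_ge0 : T `<=` [set t | 0 <= t]) (T_convex : @convex_set R R^o T).
Hypotheses (T_int : T° !=set0) (eta1 : eta (@UHdom R) = 1%E).
Hypothesis supp_int : (supp eta)° !=set0.

Let mT : measurable T.
Proof. exact: is_interval_measurable (convex_set_is_interval T_convex). Qed.

Let mTT : measurable (T `*` T).
Proof. exact: measurableX. Qed.

Lemma measurable_UHdom : measurable (@UHdom R).
Proof.
rewrite (_ : @UHdom R = setT `*` `[0, +oo[%classic); first exact: measurableX.
by apply/seteqP; split=> [x /=|x [_ /=]]; rewrite /UHdom/= in_itv/= andbT.
Qed.

Lemma measurable_kernel_z1 z :
  measurable_fun [set: R * R] (fun a : R * R => kernel_z a z).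
Proof.
exact: (measurableT_comp (@measurable_kernel_z R) (@pair1_measurable _ _ _ _ z)).
Qed.

Definition mixture (z : R * R) : \bar R :=
  (\int[eta]_(a in @UHdom R) (kernel_z a z)%:E)%E.

Lemma mixture_ge0 z : (0 <= mixture z)%E.
Proof. by apply: integral_ge0 => a _; rewrite lee_fin kernel_z_ge0. Qed.

Lemma near_snd_gt0 (p : R * R) : 0 < p.2 -> \forall a \near p, 0 < a.2.
Proof.
move=> p2; have c2 : (fun a : R * R => a.2) @ p --> p.2 by exact: cvg_snd.
exact: (cvgr_gt _ c2).
Qed.

(** The mixture is at least its part over a small charged set around p, on which the kernel has a
    common lower bound. That set is kept inside a.2 > 0, so that it belongs to the domain of
    integration. *)
Lemma mixture_lower_bound (u v : R) (p : R * R) : supp eta p ->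
  p.1 ^+ 2 < u -> p.2 ^+ 2 < v -> 0 < p.2 ->
  exists2 c : R, 0 < c & forall z : R * R, 0 <= z.1 -> 0 <= z.2 ->
    ((c * dominator u v z)%:E <= mixture z)%E.
Proof.
move=> sp pu pv p2.
have [c c0 cA] := kernel_z_lower_bound pu pv (lt0r_neq0 p2).
have [U [mU UA U0]] := supp_box sp (filterI cA (near_snd_gt0 p2)).
have Ufin : eta U \is a fin_num by rewrite fin_num_measure.
exists (c * fine (eta U)); first by rewrite mulr_gt0// -lte_fin fineK.
move=> z z1 z2.
have mk := @measurable_kernel_z1 z.
apply: (@le_trans _ _ (\int[eta]_(a in U) (kernel_z a z)%:E)%E); last first.
  apply: ge0_subset_integral => //.
  - exact: measurable_UHdom.
  - by apply/measurable_EFinP; exact: measurable_funTS.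
  - by move=> a _; rewrite lee_fin kernel_z_ge0.
  - by move=> a /UA[_] /ltW.
rewrite mulrAC EFinM (fineK Ufin) -integral_cst//.
apply: ge0_le_integral => //.
- by move=> a _; rewrite lee_fin mulr_ge0 ?dominator_ge0// ltW.
- by apply/measurable_EFinP; exact: measurable_funTS.
- by move=> a /UA[+ _]; rewrite lee_fin; apply.
Qed.

Let kappa := (\int[@lebesgue2 R]_(z in T `*` T) mixture z)%E.

Let measurable_mixture : measurable_fun [set: R * R] mixture.
Proof.
pose f (x : (R * R) * (R * R)) := ((kernel_z x.2 x.1 * \1_(@UHdom R) x.2)%:E).
rewrite (_ : mixture = fubini_F eta f).
  apply: measurable_fun_fubini_tonelli_F; last first.
    by move=> x; rewrite lee_fin mulr_ge0// kernel_z_ge0.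
  apply/measurable_EFinP/measurable_funM; first exact: measurable_kernel_z.
  apply: (measurableT_comp (measurable_indic measurable_UHdom)) => //.
apply/funext => z; rewrite /mixture integral_mkcond /fubini_F.
apply: eq_integral => a _; rewrite patchE /f/= indicE.
by case: ifPn => _; rewrite ?mulr1 ?mulr0.
Qed.

(** If the mass were 0, the mixture would vanish almost everywhere on a square inside T x T; but it
    is positive at every point of that square, which has positive area. *)
Lemma mixture_mass_gt0 : (0 < kappa)%E.
Proof.
have [p ip] := supp_int; have sp := interior_subset ip.
have p2 := interior_supp_gt0 eta1 ip.
have lt1 (x : R) : x < x + 1 by rewrite ltrDl.
have [c c0 lc] := mixture_lower_bound sp (lt1 _) (lt1 _) p2.
set u := p.1 ^+ 2 + 1 in lc; set v := p.2 ^+ 2 + 1 in lc.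
have [t0 /nbhs_ballP[e /= e0 eT]] := T_int.
have t00 : 0 <= t0 by apply: T_ge0; apply: eT; exact: ballxx.
(* The right half of the ball around t0 >= 0, so that all its times are strictly positive. *)
pose I : set R := `]t0, t0 + e[%classic.
have IT : I `<=` T.
  move=> t; rewrite /I/= in_itv/= => /andP[t0t te]; apply: eT.
  by rewrite /ball/= distrC gtr0_norm ?subr_gt0// ltrBlDl.
have mI : measurable I by exact: measurable_itv.
have I0 t : I t -> 0 < t by rewrite /I/= in_itv/= => /andP[+ _]; exact: le_lt_trans.
have mII : measurable (I `*` I) by exact: measurableX.
rewrite lt_neqAle integral_ge0 ?andbT//; last by move=> z _; exact: mixture_ge0.
apply/negP => /eqP kappa0.
have mm : measurable_fun (I `*` I) mixture by exact: measurable_funTS.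
have II0 : (\int[@lebesgue2 R]_(z in I `*` I) `|mixture z| = 0)%E.
  apply/eqP; rewrite eq_le integral_ge0// andbT kappa0 /kappa.
  have -> : (\int[@lebesgue2 R]_(z in I `*` I) `|mixture z| =
      \int[@lebesgue2 R]_(z in I `*` I) mixture z)%E.
    by apply: eq_integral => z _; rewrite gee0_abs// mixture_ge0.
  apply: ge0_subset_integral => //.
  - exact: measurable_funTS.
  - by move=> z _; exact: mixture_ge0.
  - by move=> z [z1 z2]; split; exact: IT.
have [N [mN N0 sN]] := (ae_eq_integral_abs (product_measure1 (@lebesgue_measure R) (@lebesgue_measure R)) mII mm).1 II0.
have IIN : I `*` I `<=` N.
  move=> z [z1 z2]; apply: sN => /= /(_ (conj z1 z2)) z0.
  have := lc z (ltW (I0 _ z1)) (ltW (I0 _ z2)); rewrite z0 lee_fin leNgt.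
  by rewrite mulr_gt0// dominator_gt0// I0.
have : ((@lebesgue_measure R \x @lebesgue_measure R) (I `*` I) <= 0)%E.
  by rewrite -N0; apply: le_measure; rewrite ?inE.
have muI : @lebesgue_measure R I = e%:E.
  by rewrite /I lebesgue_measure_itv/= lte_fin ltrDl e0 -EFinB addrAC subrr add0r.
have -> : ((@lebesgue_measure R \x @lebesgue_measure R) (I `*` I) = (e * e)%:E)%E.
  transitivity (@lebesgue_measure R I * @lebesgue_measure R I)%E; last by rewrite muI.
  exact: product_measure1E.
by rewrite lee_fin leNgt mulr_gt0.
Qed.


(** The restrictions to T x T and to the domain of the heterogeneity become indicators, so that the
    abstract mixture model, with its unrestricted integrals, applies. *)
Let kk0 (x : (R * R) * (R * R)) : R :=
  kernel_z x.2 x.1 * (\1_(T `*` T) x.1 * \1_(@UHdom R) x.2).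

Let mkk0 : measurable_fun [set: (R * R) * (R * R)] kk0.
Proof.
apply: measurable_funM; first exact: measurable_kernel_z.
apply: measurable_funM.
  exact: (measurableT_comp (measurable_indic mTT) measurable_fst).
exact: (measurableT_comp (measurable_indic measurable_UHdom) measurable_snd).
Qed.

Let kk0_ge0 x : 0 <= kk0 x.
Proof. by rewrite /kk0 mulr_ge0 ?kernel_z_ge0// mulr_ge0. Qed.

Let pi2 : R := (4 * pi) ^+ 2.

Let kk0_mass a : (\int[@lebesgue2 R]_z (kk0 (z, a))%:E <= pi2%:E)%E.
Proof.
have [a2|a2] := leP 0 a.2; last first.
  rewrite (_ : (fun _ => _) = cst 0%E).
    by rewrite /lebesgue2 integral0 lee_fin sqr_ge0.
  apply/funext => z; rewrite /kk0/= [in X in _ * (_ * X)]indicE memNset ?mulr0//.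
  by rewrite /UHdom/=; apply/negP; rewrite -ltNge.
apply: le_trans (kernel_z_mass mT T_ge0 a2).
rewrite [leRHS]integral_mkcond le_eqVlt; apply/predU1P; left.
apply: eq_integral => z _; rewrite patchE /kk0/= !indicE.
by rewrite (mem_set (a2 : UHdom a)) mulr1; case: ifPn => _; rewrite ?mulr1 ?mulr0.
Qed.

Let integral_kk0 (f : R * R -> R) z : (T `*` T) z ->
  (\int[eta]_a (f a * kk0 (z, a))%:E =
   \int[eta]_(a in @UHdom R) (f a * kernel_z a z)%:E)%E.
Proof.
move=> Tz; rewrite [RHS]integral_mkcond; apply: eq_integral => a _.
rewrite patchE /kk0/= !indicE (mem_set Tz) mul1r.
by case: ifPn => _; rewrite ?mulr1 ?mulr0.
Qed.

Let integral_kk0_out (f : R * R -> R) z : ~ (T `*` T) z ->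
  (\int[eta]_a (f a * kk0 (z, a))%:E = 0)%E.
Proof.
move=> Tz; rewrite (_ : (fun _ => _) = cst 0%E) ?integral0//.
by apply/funext => a; rewrite /kk0/= [in X in _ * (_ * (X * _))]indicE memNset// mul0r !mulr0.
Qed.

Let kappaE : kappa = (\int[@lebesgue2 R]_z \int[eta]_a (1 * kk0 (z, a))%:E)%E.
Proof.
rewrite /kappa [LHS]integral_mkcond; apply: eq_integral => z _; rewrite patchE.
case: ifPn => [|/negP] zT.
  rewrite integral_kk0; last exact: set_mem.
  by apply: eq_integral => a _; rewrite mul1r.
by rewrite integral_kk0_out// => ?; apply: zT; exact: mem_set.
Qed.

Let kappa_fin : kappa \is a fin_num.
Proof.
rewrite ge0_fin_numE; last exact/ltW/mixture_mass_gt0.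
rewrite kappaE; apply: (@le_lt_trans _ _ (pi2%:E * \int[eta]_a 1%:E)%E); last first.
  by have := expectation_cst eta 1; rewrite unlock => ->; rewrite mule1 ltry.
exact: (@integral_mixture_le _ _ _ _ _
  (product_sigma_finite (@lebesgue_measure R) (@lebesgue_measure R)) eta kk0 mkk0 kk0_ge0 pi2).
Qed.

Let C : R := (fine kappa)^-1.

Let C_gt0 : 0 < C.
Proof. by rewrite invr_gt0 -lte_fin fineK// mixture_mass_gt0. Qed.

Let norm_constE : norm_const T eta = C%:E.
Proof.
rewrite /norm_const -[X in (X^-1)%E]/kappa -(fineK kappa_fin) inver gt_eqF//.
by rewrite -lte_fin fineK// mixture_mass_gt0.
Qed.

Let kk x : R := C * kk0 x.

Let mkk : measurable_fun [set: (R * R) * (R * R)] kk.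
Proof. exact: measurable_funM. Qed.

Let kk_ge0 x : 0 <= kk x.
Proof. by rewrite /kk mulr_ge0// ltW. Qed.

Let mkk01 z : measurable_fun [set: R * R] (fun a => kk0 (z, a)).
Proof. exact: (measurableT_comp mkk0 (@pair1_measurable _ _ _ _ z)). Qed.

Let mkk02 a : measurable_fun [set: R * R] (fun z => kk0 (z, a)).
Proof. exact: (measurableT_comp mkk0 (@pair2_measurable _ _ _ _ a)). Qed.

(** Bounds the mass of the normalized kernel, hence the squared operator norm of the uncentered
    score operator between the L2 spaces. *)
Definition score_gain : R := C * pi2.

Let kk_mass a : (\int[product_sigma_finite (@lebesgue_measure R) (@lebesgue_measure R)]_z
  (kk (z, a))%:E <= score_gain%:E)%E.
Proof.
rewrite (_ : (\int[_]_z _)%E = (\int[product_sigma_finite (@lebesgue_measure R)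
  (@lebesgue_measure R)]_z (C%:E * (kk0 (z, a))%:E))%E)//.
rewrite ge0_integralZl_EFin//.
- by rewrite /score_gain EFinM; apply: lee_wpmul2l; [rewrite lee_fin ltW|exact: kk0_mass].
- by move=> z _; rewrite lee_fin.
- by apply/measurable_EFinP; exact: mkk02.
- exact: ltW.
Qed.

Let D z := (\int[eta]_a (kk (z, a))%:E)%E.

Let DE z : D z = (C%:E * \int[eta]_a (1 * kk0 (z, a))%:E)%E.
Proof.
rewrite /D -ge0_integralZl_EFin//.
- by apply: eq_integral => a _; rewrite mul1r.
- by move=> a _; rewrite lee_fin mul1r.
- by apply/measurable_EFinP; under eq_fun do rewrite mul1r; exact: mkk01.
- exact: ltW.
Qed.

Let kk_total : (\int[product_sigma_finite (@lebesgue_measure R) (@lebesgue_measure R)]_z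
  \int[eta]_a (kk (z, a))%:E = 1)%E.
Proof.
rewrite (_ : (\int[_]_z _)%E = (\int[product_sigma_finite (@lebesgue_measure R)
    (@lebesgue_measure R)]_z (C%:E * \int[eta]_a (1 * kk0 (z, a))%:E))%E); last first.
  by apply: eq_integral => z _; exact: DE.
rewrite ge0_integralZl_EFin//.
- rewrite (_ : (\int[_]_z _)%E = kappa); last exact/esym/kappaE.
  rewrite -(fineK kappa_fin) -EFinM mulVf// gt_eqF// -lte_fin fineK//.
  exact: mixture_mass_gt0.
- by move=> z _; apply: integral_ge0 => a _; rewrite lee_fin mul1r.
- apply: (measurable_fun_fubini_tonelli_F (fun x => (1 * kk0 x)%:E)).
    by apply/measurable_EFinP; under eq_fun do rewrite mul1r.
  by move=> x; rewrite mul1r lee_fin.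
- exact: ltW.
Qed.

Let densE z : (T `*` T) z -> dens T eta z = D z.
Proof.
move=> Tz; rewrite /dens integral_mkcond; apply: eq_integral => a _.
rewrite patchE /cond_dens norm_constE -EFinM /kk /kk0/= !indicE (mem_set Tz) mul1r.
by case: ifPn => _; rewrite ?mulr1 ?mulr0.
Qed.

Let D_out z : ~ (T `*` T) z -> D z = 0%E.
Proof. by move=> Tz; rewrite DE integral_kk0_out// mule0. Qed.

Let D_in z : (T `*` T) z -> D z = (C%:E * mixture z)%E.
Proof.
move=> Tz; rewrite DE integral_kk0//; congr (_ * _)%E.
by apply: eq_integral => a _; rewrite mul1r.
Qed.

Let raw_scoreE b z : (T `*` T) z -> score_op_raw T eta b z = cond_mean eta kk b z.
Proof.
move=> Tz; rewrite /score_op_raw /cond_mean densE//; congr (fine (_ / _))%E.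
rewrite integral_mkcond; apply: eq_integral => a _.
rewrite patchE /cond_dens norm_constE -!EFinM /kk /kk0/= !indicE (mem_set Tz) mul1r.
by case: ifPn => _; rewrite ?mulr1 ?mulr0.
Qed.

Let expectZE h h' : (forall z, (T `*` T) z -> h z = h' z) ->
  expectZ T eta h = (\int[@lebesgue2 R]_z ((h' z)%:E * D z))%E.
Proof.
move=> hh'; rewrite /expectZ [LHS]integral_mkcond; apply: eq_integral => z _.
rewrite patchE; case: ifPn => [|/negP] zT.
  by have Tz := set_mem zT; rewrite hh'// densE.
by rewrite D_out ?mule0// => ?; apply: zT; exact: mem_set.
Qed.

(* The score of [b] differs by a constant from that of [b + m], which is the
   conditional mean of [phi] plus that of [b - phi + m]. *)
Lemma expectZ_score_le (b phi : R * R -> R) (M m h : R) :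
  measurable_fun [set: R * R] b -> measurable_fun [set: R * R] phi ->
  (forall a, `|phi a| <= M) -> 0 <= h ->
  (forall z : R * R, 0 <= z.1 -> 0 <= z.2 -> mixture z \is a fin_num ->
    (`|\int[eta]_(a in @UHdom R) (phi a * kernel_z a z)%:E| <= h%:E * mixture z)%E) ->
  (\int[eta]_a ((b a - phi a + m) ^+ 2)%:E < +oo)%E ->
  (expectZ T eta (fun z => (score_op T eta b z ^+ 2)%R) <=
   (2 * h ^+ 2)%:E +
   (2 * score_gain)%:E * \int[eta]_a ((b a - phi a + m) ^+ 2)%:E)%E.
Proof.
move=> mb mphi phiM h0 small psi2.
have small' z : D z \is a fin_num ->
    (`|\int[eta]_a (phi a * kk (z, a))%:E| <= h%:E * D z)%E.
  move=> Dfin; have [zT|zT] := pselect ((T `*` T) z); last first.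
    rewrite D_out// mule0 (_ : (fun _ => _) = cst 0%E) ?integral0 ?abse0//.
    apply/funext => a; rewrite /kk /kk0/=.
    by rewrite [in X in _ * (_ * (_ * (X * _)))]indicE memNset// mul0r !mulr0.
  (* Finiteness passes from [D z] to the mixture because the constant C is positive. *)
  have mixfin : mixture z \is a fin_num.
    have := mixture_ge0 z; move: Dfin; rewrite D_in//; case: (mixture z) => [r| |]//.
    by rewrite gt0_muley// lte_fin.
  have ikk0 : eta.-integrable [set: R * R] (EFin \o (fun a => kk0 (z, a))).
    apply: integrable_ge0; [exact: mkk01|by move=> a; exact: kk0_ge0|].
    rewrite (_ : (\int[eta]_a _)%E = mixture z).
      by rewrite -ge0_fin_numE// mixture_ge0.
    transitivity (\int[eta]_a (1 * kk0 (z, a))%:E)%E.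
      by apply: eq_integral => a _; rewrite mul1r.
    by rewrite integral_kk0//; apply: eq_integral => a _; rewrite mul1r.
  have iphi : eta.-integrable [set: R * R] (EFin \o (fun a => phi a * kk0 (z, a))).
    apply: (le_integrable measurableT _ _ (integrableZl measurableT M ikk0)).
      by apply/measurable_EFinP; exact: measurable_funM.
    move=> a _ /=; rewrite lee_fin !normrM ler_wpM2r//.
    exact: le_trans (ler_norm _).
  have -> : (\int[eta]_a (phi a * kk (z, a))%:E =
      C%:E * \int[eta]_a (phi a * kk0 (z, a))%:E)%E.
    rewrite -(integralZl measurableT iphi).
    by apply: eq_integral => a _; rewrite -EFinM /kk mulrCA.
  have [z1 z2] := zT.
  have := small z (T_ge0 z1) (T_ge0 z2) mixfin.
  rewrite D_in// -integral_kk0// muleCA abseM/= (gtr0_norm C_gt0).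
  by move=> sm; rewrite lee_wpmul2l// lee_fin ltW.
have scoreE z : (T `*` T) z -> score_op T eta b z ^+ 2 =
    (cond_mean eta kk b z -
     fine (\int[@lebesgue2 R]_z ((cond_mean eta kk b z)%:E * D z))%E) ^+ 2.
  move=> Tz; rewrite /score_op (raw_scoreE b Tz).
  by rewrite (expectZE (@raw_scoreE b)).
rewrite (expectZE scoreE).
have := @cond_mean_variance_le _ _ _ _ R (product_sigma_finite (@lebesgue_measure R)
  (@lebesgue_measure R)) eta kk mkk kk_ge0 score_gain kk_mass kk_total b phi M m h
  mb mphi phiM h0 small' psi2.
exact.
Qed.

End mixture.

(** * Integration against a density *)

Section density.
Context d (T : measurableType d) {R : realType}.
Variables (mu : probability T R) (nu : {sigma_finite_measure set T -> \bar R}).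
Variable p : T -> R.
Hypotheses (mp : measurable_fun [set: T] p) (p0 : forall a, 0 <= p a).
Hypothesis mu_p : forall A, measurable A -> (mu A = \int[nu]_(a in A) (p a)%:E)%E.

Lemma integrable_density : nu.-integrable [set: T] (EFin \o p).
Proof.
by apply: integrable_ge0 => //; rewrite -mu_p// probability_setT ltry.
Qed.

Lemma ge0_integral_density (f : T -> R) : measurable_fun [set: T] f ->
  (forall a, 0 <= f a) ->
  (\int[mu]_a (f a)%:E = \int[nu]_a (f a * p a)%:E)%E.
Proof.
move=> mf f0.
have munu : mu `<< nu.
  move=> A A0 B mB BA; rewrite mu_p//; apply: null_set_integral => //.
    exact/measurable_EFinP/measurable_funTS.
  exact: A0.
pose g := Radon_Nikodym_SigmaFinite.f mu nu.
have ig : nu.-integrable [set: T] g := Radon_Nikodym_SigmaFinite.f_integrable munu.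
have gp : ae_eq nu [set: T] g (EFin \o p).
  apply: integral_ae_eq => //; first exact/measurable_EFinP.
  move=> E _ mE; transitivity (mu E); last exact: mu_p.
  exact/esym/(Radon_Nikodym_SigmaFinite.f_integral munu).
rewrite -(Radon_Nikodym_SigmaFinite.change_of_variables munu)//.
apply: ae_eq_integral => //.
- by apply: emeasurable_funM; [exact/measurable_EFinP|exact: measurable_int ig].
- by apply/measurable_EFinP; exact: measurable_funM.
- by apply: filterS gp => a /= /(_ I) gE _; rewrite EFinM -gE.
- exact/measurable_EFinP.
Qed.

Lemma integrable_density_mul (f : T -> R) :
  mu.-integrable [set: T] (EFin \o f) ->
  nu.-integrable [set: T] (EFin \o (fun a => f a * p a)).
Proof.
move=> /integrableP[/measurable_EFinP mf fo].
apply/integrableP; split; first exact/measurable_EFinP/measurable_funM.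
rewrite (eq_integral (fun a => (`|f a| * p a)%:E)); last first.
  by move=> a _ /=; rewrite normrM (ger0_norm (p0 a)).
rewrite -(@ge0_integral_density (fun a => `|f a|))//.
exact: measurableT_comp.
Qed.

Lemma Rintegral_density (f : T -> R) :
  mu.-integrable [set: T] (EFin \o f) ->
  \int[mu]_a f a = \int[nu]_a (f a * p a).
Proof.
move=> fi; have := fi => /integrableP[/measurable_EFinP mf _].
rewrite /Rintegral; congr fine.
rewrite [LHS]integralE [RHS]integralE; congr (_ - _)%E.
  transitivity (\int[mu]_a (Num.max (f a) 0)%:E)%E.
    by apply: eq_integral => a _; rewrite funeposE EFin_max.
  rewrite ge0_integral_density//; last 2 first.
  - exact: measurable_maxr.
  - by move=> a; rewrite le_max lexx orbT.
  apply: eq_integral => a _; rewrite funeposE -EFin_max; congr EFin.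
  by rewrite maxr_pMl// mul0r.
transitivity (\int[mu]_a (Num.max (- f a) 0)%:E)%E.
  by apply: eq_integral => a _; rewrite funenegE EFin_max.
rewrite ge0_integral_density//; last 2 first.
- apply: measurable_maxr => //; exact: measurableT_comp.
- by move=> a; rewrite le_max lexx orbT.
apply: eq_integral => a _; rewrite funenegE -EFinN -EFin_max; congr EFin.
by rewrite -mulNr maxr_pMl// mul0r.
Qed.

End density.

(* With [s] and [s0] the square roots of the densities, the increment
   [s ^+ 2 - s0 ^+ 2] is [(s - s0) * (s + s0)]. *)
Lemma score_remainder_le (R : realFieldType) (s s0 b t l : R) : 0 < t -> 0 < l ->
  `|(s ^+ 2 - s0 ^+ 2) / t - b * s0 ^+ 2| <=
  ((s - s0) / t - 2^-1 * b * s0) ^+ 2 / l + l * s0 ^+ 2 +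
  t * (b ^+ 2 * s0 ^+ 2 / 2 + 2 * ((s - s0) / t - 2^-1 * b * s0) ^+ 2).
Proof.
move=> t0 l0; set r := (s - s0) / t - 2^-1 * b * s0.
have sE : s = s0 + t * (r + 2^-1 * b * s0) by rewrite /r; field; rewrite gt_eqF.
have -> : (s ^+ 2 - s0 ^+ 2) / t - b * s0 ^+ 2 =
    2 * s0 * r + t * (r + 2^-1 * b * s0) ^+ 2.
  by rewrite {1}sE; field; rewrite gt_eqF.
clearbody r; rewrite {sE}; apply: (le_trans (ler_normD _ _)); apply: lerD.
  (* Weighted inequality 2 |s0 r| <= r^2 / l + l s0^2; the free weight [l] will tend to 0 more
     slowly than the remainder. *)
  have h : 0 <= (`|r| - l * `|s0|) ^+ 2 / l by rewrite divr_ge0 ?sqr_ge0// ltW.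
  rewrite -subr_ge0; apply: (le_trans h); rewrite le_eqVlt; apply/predU1P; left.
  rewrite !normrM ger0_norm// sqrrB exprMn !real_normK ?num_real//.
  by field; rewrite gt_eqF.
rewrite ger0_norm; last by rewrite mulr_ge0 ?sqr_ge0// ltW.
rewrite ler_pM2l//; have := sqr_ge0 (r - 2^-1 * b * s0); rewrite sqrrB sqrrD.
have -> : (2^-1 * b * s0) ^+ 2 = b ^+ 2 * s0 ^+ 2 / 4 by field.
lra.
Qed.

(** * First-order expansion of expectations along a path *)

Section path_expansion.
Context d (T : measurableType d) {R : realType}.
Variables (mu mu0 : probability T R) (nu : {sigma_finite_measure set T -> \bar R}).
Variables p p0 : T -> R.
Hypotheses (mp : measurable_fun [set: T] p) (p_ge0 : forall a, 0 <= p a).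
Hypotheses (mp0 : measurable_fun [set: T] p0) (p0_ge0 : forall a, 0 <= p0 a).
Hypothesis mu_p : forall A, measurable A -> (mu A = \int[nu]_(a in A) (p a)%:E)%E.
Hypothesis mu0_p0 : forall A, measurable A -> (mu0 A = \int[nu]_(a in A) (p0 a)%:E)%E.
Variable b : T -> R.
Hypothesis mb : measurable_fun [set: T] b.
Hypothesis b2 : mu0.-integrable [set: T] (EFin \o (fun a => b a ^+ 2)).
Variables t l : R.
Hypotheses (t0 : 0 < t) (l0 : 0 < l).
Let r a := (Num.sqrt (p a) - Num.sqrt (p0 a)) / t - 2^-1 * b a * Num.sqrt (p0 a).
Hypothesis rfin : (\int[nu]_a (r a ^+ 2)%:E < +oo)%E.

Let mr : measurable_fun [set: T] r.
Proof.
have msq (q : T -> R) : measurable_fun [set: T] q ->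
    measurable_fun [set: T] (fun a => Num.sqrt (q a)).
  move=> mq; apply: (measurableT_comp _ mq).
  by apply: continuous_measurable_fun; exact: sqrt_continuous.
apply: measurable_funB; last by apply: measurable_funM; [exact: measurable_funM|exact: msq].
by apply: measurable_funM => //; apply: measurable_funB; exact: msq.
Qed.

Let ir : nu.-integrable [set: T] (EFin \o (fun a => r a ^+ 2)).
Proof.
by apply: integrable_ge0 => //; [exact: measurable_funX|move=> a; exact: sqr_ge0].
Qed.

(** The left-hand side is the integral of f times (p - p0) / t - b p0, and [score_remainder_le]
    bounds the second factor. As [f] enters only through its bound, it may vary with [t]. *)
Lemma path_expansion (f : T -> R) : measurable_fun [set: T] f ->
  (forall a, `|f a| <= 1) ->
  `|(\int[mu]_a f a - \int[mu0]_a f a) / t - \int[mu0]_a (f a * b a)| <=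
  \int[nu]_a (r a ^+ 2) / l + l +
  t * (\int[mu0]_a (b a ^+ 2) / 2 + 2 * \int[nu]_a (r a ^+ 2)).
Proof.
move=> mf f1.
have bdd (m : probability T R) : m.-integrable [set: T] (EFin \o f).
  apply: (@measurable_bounded_integrable _ _ _ m) => //.
    by apply: (le_lt_trans (probability_le1 _ _)) => //; rewrite ltry.
  by exists 1; split; [exact: num_real|move=> x x1 a _; exact: le_trans (f1 a) (ltW x1)].
have ib : mu0.-integrable [set: T] (EFin \o (fun a => b a * 1)).
  apply: weighted_integrable => //.
  - exact: (@finite_measure_integrable_cst _ _ _ mu0).
  - by under [X in _.-integrable _ X]funext do rewrite /= mulr1.
have ifb : mu0.-integrable [set: T] (EFin \o (fun a => f a * b a)).
  apply: (le_integrable measurableT _ _ ib).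
    by apply/measurable_EFinP; exact: measurable_funM.
  by move=> a _ /=; rewrite mulr1 lee_fin normrM ler_piMl.
have ip := integrable_density_mul mp p_ge0 mu_p (bdd mu).
have ip0 := integrable_density_mul mp0 p0_ge0 mu0_p0 (bdd mu0).
have ifbp0 := integrable_density_mul mp0 p0_ge0 mu0_p0 ifb.
have ib2 := integrable_density_mul mp0 p0_ge0 mu0_p0 b2.
have i0 := integrable_density mp0 p0_ge0 mu0_p0.
rewrite (Rintegral_density mp p_ge0 mu_p (bdd mu)).
rewrite (Rintegral_density mp0 p0_ge0 mu0_p0 (bdd mu0)).
rewrite (Rintegral_density mp0 p0_ge0 mu0_p0 ifb).
rewrite (Rintegral_density mp0 p0_ge0 mu0_p0 b2).
have p01 : \int[nu]_a p0 a = 1.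
  by rewrite /Rintegral -mu0_p0// probability_setT.
pose g a := (f a * p a - f a * p0 a) / t - f a * b a * p0 a.
pose G a := r a ^+ 2 / l + l * p0 a + t * (b a ^+ 2 * p0 a / 2 + 2 * r a ^+ 2).
have iD (u v : T -> R) : nu.-integrable [set: T] (EFin \o u) ->
    nu.-integrable [set: T] (EFin \o v) ->
    nu.-integrable [set: T] (EFin \o (fun a => u a + v a)).
  move=> iu iv; under [X in _.-integrable _ X]funext do rewrite /= EFinD.
  exact: (integrableD measurableT iu iv).
have iZ (c : R) (u : T -> R) : nu.-integrable [set: T] (EFin \o u) ->
    nu.-integrable [set: T] (EFin \o (fun a => c * u a)).
  by move=> iu; exact: (integrableZl measurableT c iu).
have IE : (\int[nu]_a (f a * p a) - \int[nu]_a (f a * p0 a)) / t -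
    \int[nu]_a (f a * b a * p0 a) = \int[nu]_a g a.
  have ig1 := iD _ _ ip (iZ (-1) _ ip0).
  have ig2 := iD _ _ (iZ t^-1 _ ig1) (iZ (-1) _ ifbp0).
  rewrite (_ : \int[nu]_a g a = \int[nu]_a (t^-1 * (f a * p a + -1 * (f a * p0 a)) +
    -1 * (f a * b a * p0 a))); last first.
    by apply: eq_Rintegral => a _; rewrite /g; ring.
  rewrite (RintegralD measurableT (iZ t^-1 _ ig1) (iZ (-1) _ ifbp0)).
  rewrite (RintegralZl _ measurableT ig1) (RintegralZl _ measurableT ifbp0).
  rewrite (RintegralD measurableT ip (iZ (-1) _ ip0)) (RintegralZl _ measurableT ip0).
  by ring.
have ig : nu.-integrable [set: T] (EFin \o g).
  have ig1 := iD _ _ ip (iZ (-1) _ ip0).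
  have := iD _ _ (iZ t^-1 _ ig1) (iZ (-1) _ ifbp0).
  apply: eq_integrable => // a _ /=; congr EFin; rewrite /g; ring.
have iG : nu.-integrable [set: T] (EFin \o G).
  have := iD _ _ (iD _ _ (iZ l^-1 _ ir) (iZ l _ i0))
    (iZ t _ (iD _ _ (iZ 2^-1 _ ib2) (iZ 2 _ ir))).
  apply: eq_integrable => // a _ /=; congr EFin; rewrite /G; ring.
have GE : \int[nu]_a G a = \int[nu]_a (r a ^+ 2) / l + l +
    t * (\int[nu]_a (b a ^+ 2 * p0 a) / 2 + 2 * \int[nu]_a (r a ^+ 2)).
  rewrite (_ : \int[nu]_a G a = \int[nu]_a (l^-1 * r a ^+ 2 + l * p0 a +
    t * (2^-1 * (b a ^+ 2 * p0 a) + 2 * r a ^+ 2))); last first.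
    by apply: eq_Rintegral => a _; rewrite /G; ring.
  rewrite (RintegralD measurableT (iD _ _ (iZ l^-1 _ ir) (iZ l _ i0))
    (iZ t _ (iD _ _ (iZ 2^-1 _ ib2) (iZ 2 _ ir)))).
  rewrite (RintegralD measurableT (iZ l^-1 _ ir) (iZ l _ i0)).
  rewrite (RintegralZl _ measurableT ir) (RintegralZl _ measurableT i0) p01.
  rewrite (RintegralZl _ measurableT (iD _ _ (iZ 2^-1 _ ib2) (iZ 2 _ ir))).
  rewrite (RintegralD measurableT (iZ 2^-1 _ ib2) (iZ 2 _ ir)).
  rewrite (RintegralZl _ measurableT ib2) (RintegralZl _ measurableT ir).
  by ring.
rewrite IE -GE; apply: (le_trans (le_normr_Rintegral measurableT ig)).
apply: le_Rintegral => //.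
  have := integrable_norm ig; apply: eq_integrable => //.
move=> a _; rewrite /g /G.
have -> : (f a * p a - f a * p0 a) / t - f a * b a * p0 a =
    f a * ((p a - p0 a) / t - b a * p0 a) by ring.
rewrite normrM; apply: (@le_trans _ _ `|(p a - p0 a) / t - b a * p0 a|).
  by rewrite ler_piMl.
have := @score_remainder_le R (Num.sqrt (p a)) (Num.sqrt (p0 a)) (b a) t l t0 l0.
by rewrite !sqr_sqrtr.
Qed.

End path_expansion.

(** * Square-integrable and bounded functions under a probability *)

Section square_integrable.
Context d (T : measurableType d) {R : realType} (mu : probability T R).

Lemma Lfun2_integrable (f : T -> R) : f \in Lfun mu 2%:E ->
  measurable_fun [set: T] f /\
  mu.-integrable [set: T] (EFin \o (fun a => f a ^+ 2)).
Proof.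
move=> fL; split; last exact: Lfun2_integrable_sqr.
by have := sub_Lfun_mfun fL; rewrite inE.
Qed.

Lemma integral_norm_powR2 (f : T -> R) :
  (\int[mu]_a `|(f a)%:E| `^ 2%:R = \int[mu]_a (f a ^+ 2)%:E)%E.
Proof.
apply: eq_integral => a _; rewrite /= powR_mulrn//.
by rewrite real_normK// num_real.
Qed.

Lemma integrable_Lfun2 (f : T -> R) : measurable_fun [set: T] f ->
  (\int[mu]_a (f a ^+ 2)%:E < +oo)%E -> f \in Lfun mu 2%:E.
Proof.
move=> mf f2; rewrite inE/=; apply/andP; split; rewrite inE//=.
rewrite /finite_norm unlock /= integral_norm_powR2.
by rewrite poweR_lty.
Qed.

Lemma Lnorm2_lt (f : T -> R) (e : R) : 0 < e ->
  ('N[mu]_2%:E[EFin \o f] < e%:E)%E ->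
  (\int[mu]_a (f a ^+ 2)%:E <= (e ^+ 2)%:E)%E.
Proof.
move=> e0 fe; rewrite -integral_norm_powR2 -(powR_Lnorm mu (EFin \o f) (r := 2))//.
have -> : (e ^+ 2)%:E = (e%:E `^ 2%:R)%E by rewrite poweR_EFin powR_mulrn// ltW.
apply: gt0_ler_poweR => //.
- by rewrite in_itv/= Lnorm_ge0 leey.
- by rewrite in_itv/= leey lee_fin ltW.
- exact: ltW.
Qed.

Lemma Lfun2_mul_integrable (f g : T -> R) : f \in Lfun mu 2%:E ->
  g \in Lfun mu 2%:E -> mu.-integrable [set: T] (EFin \o (fun a => f a * g a)).
Proof. by move=> fL gL; apply/Lfun1_integrable; exact: Lfun2_mul_Lfun1. Qed.

Lemma Lfun2_sum (n : nat) (c : 'I_n -> R) (s : 'I_n -> T -> R) :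
  (forall i, s i \in Lfun mu 2%:E) ->
  (fun a => \sum_(i < n) c i * s i a) \in Lfun mu 2%:E.
Proof.
have le12 : (1 <= 2%:E :> \bar R)%E by rewrite lee_fin ler1n.
have [L0 LD] := Lfun_submod_closed mu le12.
elim: n c s => [|n IH] c s sL.
  rewrite (_ : (fun _ => _) = 0)//.
  by apply/funext => a; rewrite big_ord0.
rewrite (_ : (fun _ => _) = c ord0 *: s ord0 +
    (fun a => \sum_(i < n) c (lift ord0 i) * s (lift ord0 i) a)).
  by apply: LD => //; apply: IH => i; exact: sL.
by apply/funext => a; rewrite big_ord_recl.
Qed.

Lemma Rintegral_indic (U : set T) : measurable U ->
  \int[mu]_a (\1_U a : R) = fine (mu U).
Proof. by move=> mU; rewrite /Rintegral integral_indic// setIT. Qed.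

Lemma integrable_step (x y : R) (U V : set T) : measurable U -> measurable V ->
  mu.-integrable [set: T] (EFin \o (fun a => x * \1_U a + y * \1_V a)).
Proof.
move=> mU mV; under [X in _.-integrable _ X]funext do rewrite /= EFinD !EFinM.
by apply: integrableD => //; apply: integrableZl => //; exact: integrable_indic.
Qed.

Lemma Rintegral_step (x y : R) (U V : set T) : measurable U -> measurable V ->
  \int[mu]_a (x * \1_U a + y * \1_V a) = x * fine (mu U) + y * fine (mu V).
Proof.
move=> mU mV.
have i W : measurable W -> mu.-integrable [set: T] (EFin \o (\1_W : T -> R)).
  by move=> mW; exact: integrable_indic.
have iZ (z : R) W : measurable W ->
    mu.-integrable [set: T] (EFin \o (fun a => z * (\1_W a : R))).
  by move=> mW; exact: (integrableZl measurableT z (i W mW)).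
rewrite (RintegralD measurableT (iZ x U mU) (iZ y V mV)).
rewrite (RintegralZl _ measurableT (i U mU)) (RintegralZl _ measurableT (i V mV)).
by rewrite !Rintegral_indic.
Qed.

Lemma bounded_integrable (f : T -> R) (M : R) : measurable_fun [set: T] f ->
  (forall a, `|f a| <= M) -> mu.-integrable [set: T] (EFin \o f).
Proof.
move=> mf fM; apply: (@measurable_bounded_integrable _ _ _ mu) => //.
  by apply: (le_lt_trans (probability_le1 _ _)) => //; rewrite ltry.
exists M; split; first exact: num_real.
by move=> x Mx a _; exact: le_trans (fM a) (ltW Mx).
Qed.

End square_integrable.

(** * A criterion for an infinite efficiency bound *)

Section efficiency.
Context {R : realType}.

Lemma expectZ_ge0 (T : set R) (eta : probability (R * R)%type R) (h : R * R -> R) :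
  (forall z, 0 <= h z) -> (0 <= expectZ T eta h)%E.
Proof.
move=> h0; apply: integral_ge0 => z _; apply: mule_ge0; first by rewrite lee_fin.
apply: integral_ge0 => a _; apply: mule_ge0; last by rewrite lee_fin kernel_z_ge0.
rewrite /norm_const inve_ge0; apply: integral_ge0 => y _; apply: integral_ge0 => c _.
by rewrite lee_fin kernel_z_ge0.
Qed.

Lemma tangent_space_Lfun2 H (eta : probability (R * R)%type R) b :
  tangent_space H eta b -> b \in Lfun eta 2%:E.
Proof.
by move=> [n [c [s [sc ->]]]]; apply: Lfun2_sum => i; have [eta' []] := sc i.
Qed.

(** [x] is the covariance of gradient and direction, [y] the variance of the score. From |x| >= |D|
    / 2 follows x^2 >= D^2 / 4 = 2 M d >= M y. If y = 0 the quotient is infinite, because x != 0 and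
    0^-1 = +oo. *)
Lemma ratio_ge (M D x y d : R) : 0 < M -> 0 < d -> D ^+ 2 = 8 * M * d ->
  `|x - D| <= `|D| / 2 -> 0 <= y -> y <= 2 * d ->
  (M%:E <= x%:E ^+ 2 / y%:E)%E.
Proof.
move=> M0 d0 DE xD y0 yd.
have D0 : D != 0 by rewrite -sqrf_eq0 DE mulf_neq0 ?mulf_neq0 ?pnatr_eq0// gt_eqF.
have x2 : D ^+ 2 / 4 <= x ^+ 2.
  have : `|D| / 2 <= `|x|.
    have := ler_normD (D - x) x; rewrite subrK distrC.
    by move: xD; clear; lra.
  rewrite -(real_normK (num_real x)) -(real_normK (num_real D)).
  move=> /(@lerXn2r _ 2 (`|D| / 2) `|x|); rewrite !nnegrE => h.
  have -> : `|D| ^+ 2 / 4 = (`|D| / 2) ^+ 2 by field.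
  by apply: h => //; rewrite divr_ge0.
have xx0 : 0 < x ^+ 2.
  by apply: lt_le_trans x2; rewrite divr_gt0// exprn_even_gt0.
rewrite -EFin_expe; move: y0; rewrite le_eqVlt => /predU1P[<-|y0].
  by rewrite inver eqxx gt0_muley ?lte_fin// leey.
rewrite inver gt_eqF// -EFinM lee_fin ler_pdivlMr//.
apply: le_trans x2; rewrite DE.
have : M * y <= M * (2 * d) by rewrite ler_pM2l.
by clear; lra.
Qed.

Variables (T : set R) (eta : probability (R * R)%type R).
Hypotheses (T_ge0 : T `<=` [set t | 0 <= t]) (T_convex : @convex_set R R^o T).
Hypotheses (T_int : T° !=set0) (eta1 : eta (@UHdom R) = 1%E).
Hypothesis supp_int : (supp eta)° !=set0.

(** The covariance [D] is the same for all directions [phi] while their scores become arbitrarily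
    small. A tangent element close enough to the centered [phi] keeps at least half of this
    covariance, and its score has small variance by boundedness of the score operator. *)
Lemma efficiency_bound_pinfty H (r : R * R -> R) (D : R) :
  nonparametric H eta -> L20 eta r -> D != 0 ->
  (forall h : R, 0 < h -> exists phi : R * R -> R, exists M : R,
    [/\ measurable_fun [set: R * R] phi, forall a, `|phi a| <= M,
        \int[eta]_a (r a * phi a) = D &
        forall z : R * R, 0 <= z.1 -> 0 <= z.2 -> mixture eta z \is a fin_num ->
          (`|\int[eta]_(a in @UHdom R) (phi a * kernel_z a z)%:E| <=
           h%:E * mixture eta z)%E]) ->
  efficiency_bound T H eta r = +oo%E.
Proof.
move=> np [rL Er] D0 dir; apply/eqyP => M M0.
have [mr ir2] := Lfun2_integrable rL.
set r2 := \int[eta]_a (r a ^+ 2).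
have r20 : 0 <= r2 by apply: Rintegral_ge0 => a _; exact: sqr_ge0.
set K := score_gain T eta.
pose d := D ^+ 2 / (8 * M).
have d0 : 0 < d by apply: divr_gt0; [rewrite exprn_even_gt0|exact: mulr_gt0].
(* The variance is at most 2 h^2 + 2 K e^2, and both summands must be at most d; the bounds by 1
   allow h^2 <= h and e^2 <= e. The first term in [e] gives e (r2 + 1) <= |D|, for the covariance
   error. The added 1s keep the divisors positive. *)
pose h := Num.min 1 (d / 2); pose e := Num.min (`|D| / (r2 + 1)) (Num.min 1 (d / (2 * `|K| + 1))).
have K1 : 0 < 2 * `|K| + 1 by rewrite ltr_wpDl// mulr_ge0.
have r21 : 0 < r2 + 1 by rewrite ltr_wpDl.
have h0 : 0 < h by rewrite lt_min ltr01/= divr_gt0.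
have e0 : 0 < e by rewrite !lt_min ltr01 (divr_gt0 d0 K1) divr_gt0// normr_gt0.
have [phi [B [mphi phiB rphi small]]] := dir h h0.
pose m := \int[eta]_a phi a.
have iphi := bounded_integrable eta mphi phiB.
have phiL : (fun a => phi a - m) \in Lfun eta 2%:E.
  apply: integrable_Lfun2; first exact: measurable_funB.
  have : eta.-integrable [set: R * R] (EFin \o (fun a => (phi a - m) ^+ 2)).
    apply: (bounded_integrable eta (M := (B + `|m|) ^+ 2)).
      by apply: measurable_funX; exact: measurable_funB.
    move=> a; rewrite normrX lerXn2r ?nnegrE ?addr_ge0// ?(le_trans _ (phiB a))//.
    by rewrite (le_trans (ler_normB _ _))// lerD2r.
  move=> /integrable_lty; rewrite -/(\int[eta]_(x in setT) _)%E.
  by apply.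
have i1 : eta.-integrable [set: R * R] (EFin \o (fun=> m : R)).
  by apply: (@bounded_integrable _ _ _ eta (fun=> m) `|m|).
have Ephi : ('E_eta[fun a => (phi a - m)%R] = 0)%E.
  rewrite unlock -(fineK (integrable_fin_num measurableT (_ : eta.-integrable _ (EFin \o (fun a => phi a - m))))).
    rewrite -/(Rintegral _ _ _) (RintegralB measurableT iphi i1) /Rintegral.
    by have := expectation_cst eta m; rewrite unlock => ->; rewrite /= subrr.
  by under [X in _.-integrable _ X]funext do rewrite /= EFinB; exact: integrableB.
have [b bT /(Lnorm2_lt e0) be] := np _ (conj phiL Ephi) e e0.
have bL := tangent_space_Lfun2 bT.
have [mb _] := Lfun2_integrable bL.
pose psi a := b a - phi a + m.
have psiE : (\int[eta]_a (psi a ^+ 2)%:E <= (e ^+ 2)%:E)%E.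
  apply: le_trans be; rewrite le_eqVlt; apply/predU1P; left.
  by apply: eq_integral => a _; rewrite /psi; congr EFin; rewrite -sqrrN; congr (_ ^+ 2); rewrite /=; ring.
have mpsi : measurable_fun [set: R * R] psi.
  by apply: measurable_funD => //; exact: measurable_funB.
have psi2 : (\int[eta]_a (psi a ^+ 2)%:E < +oo)%E by rewrite (le_lt_trans psiE)// ltry.
have ipsi2 : eta.-integrable [set: R * R] (EFin \o (fun a => psi a ^+ 2)).
  by apply: integrable_ge0 => //; [exact: measurable_funX|move=> a; exact: sqr_ge0].
have psi2e : \int[eta]_a (psi a ^+ 2) <= e ^+ 2.
  by rewrite -lee_fin /Rintegral fineK//; exact: integrable_fin_num.
have psiL : psi \in Lfun eta 2%:E by exact: integrable_Lfun2.
have irpsi := Lfun2_mul_integrable rL psiL.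
have irb := Lfun2_mul_integrable rL bL.
have irp : eta.-integrable [set: R * R] (EFin \o (fun a => r a * (phi a - m))).
  exact: Lfun2_mul_integrable rL phiL.
have r1 : \int[eta]_a r a = 0 by move: Er; rewrite unlock /Rintegral => ->.
have ir : eta.-integrable [set: R * R] (EFin \o r).
  have := Lfun2_mul_integrable rL (_ : (fun=> 1) \in Lfun eta 2%:E).
  have L1 : (fun=> 1) \in Lfun eta 2%:E by exact: Lfun_cst.
  by move=> /(_ L1); apply: eq_integrable => // a _ /=; rewrite mulr1.
set x := \int[eta]_a (r a * b a).
have irphi : eta.-integrable [set: R * R] (EFin \o (fun a => r a * phi a)).
  have := integrableD measurableT irp (integrableZl measurableT m ir).
  by apply: eq_integrable => // a _ /=; rewrite -EFinM -EFinD; congr EFin; ring.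
(* The mean [m] does not affect the covariance, since [r] has mean 0. *)
have xD : x - D = \int[eta]_a (r a * psi a).
  rewrite -rphi.
  have -> : \int[eta]_a (r a * psi a) = \int[eta]_a ((r a * b a - r a * phi a) + m * r a).
    by apply: eq_Rintegral => a _; rewrite /psi; ring.
  have imr := integrableZl measurableT m ir.
  have irbp : eta.-integrable [set: R * R] (EFin \o (fun a => r a * b a - r a * phi a)).
    by under [X in _.-integrable _ X]funext do rewrite /= EFinB; exact: integrableB.
  rewrite (RintegralD measurableT irbp imr) (RintegralB measurableT irb irphi).
  by rewrite (RintegralZl _ measurableT ir) r1 mulr0 addr0.
have xDle : `|x - D| <= `|D| / 2.
  rewrite xD; apply: (le_trans (le_normr_Rintegral measurableT irpsi)).
  (* Weighted inequality |r psi| <= (e / 2) r^2 + psi^2 / (2 e), suited to a psi whose squared norm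
     is at most e^2. *)
  apply: (@le_trans _ _ (\int[eta]_a (e / 2 * r a ^+ 2 + (2 * e)^-1 * psi a ^+ 2))).
    have iR1 := integrableZl measurableT (e / 2) ir2.
    have iR2 := integrableZl measurableT ((2 * e)^-1) ipsi2.
    apply: le_Rintegral => //.
    - by have := integrable_norm irpsi; exact: eq_integrable.
    - by under [X in _.-integrable _ X]funext do rewrite /= EFinD; exact: integrableD.
    move=> a _; rewrite normrM -subr_ge0.
    have -> : e / 2 * r a ^+ 2 + (2 * e)^-1 * psi a ^+ 2 - `|r a| * `|psi a| =
        (e * `|r a| - `|psi a|) ^+ 2 / (2 * e).
      rewrite -(real_normK (num_real (r a))) -(real_normK (num_real (psi a))).
      by field; rewrite gt_eqF.
    by rewrite divr_ge0 ?sqr_ge0// mulr_ge0// ltW.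
  rewrite (RintegralD measurableT (integrableZl measurableT (e / 2) ir2)
    (integrableZl measurableT ((2 * e)^-1) ipsi2)).
  rewrite (RintegralZl _ measurableT ir2) (RintegralZl _ measurableT ipsi2) -/r2.
  apply: (@le_trans _ _ (e / 2 * r2 + (2 * e)^-1 * e ^+ 2)).
    by rewrite lerD2l ler_wpM2l// invr_ge0 mulr_ge0// ltW.
  have -> : e / 2 * r2 + (2 * e)^-1 * e ^+ 2 = e * (r2 + 1) / 2.
    by field; rewrite gt_eqF.
  by rewrite ler_pM2r// -ler_pdivlMr// /e ge_min lexx.
pose den := expectZ T eta (fun z => (score_op T eta b z ^+ 2)%R).
have den_le : (den <= (2 * d)%:E)%E.
  apply: (le_trans (expectZ_score_le T_ge0 T_convex T_int eta1 supp_int mb mphi phiB (ltW h0) small psi2)).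
  rewrite -/psi -(fineK (integrable_fin_num measurableT ipsi2)) -EFinM -EFinD lee_fin.
  rewrite -/(Rintegral _ _ _) -/K; set q := Rintegral _ _ _ in psi2e *.
  have q0 : 0 <= q by apply: Rintegral_ge0 => a _; exact: sqr_ge0.
  have h1 : h <= 1 by rewrite ge_min lexx.
  have h2 : h <= d / 2 by rewrite ge_min lexx orbT.
  have e1 : e <= 1 by rewrite !ge_min lexx !orbT.
  have e2 : e * (2 * `|K| + 1) <= d by rewrite -ler_pdivlMr// !ge_min lexx !orbT.
  have hh : h ^+ 2 <= h by rewrite expr2 ler_piMl// ltW.
  have ee : e ^+ 2 <= e by rewrite expr2 ler_piMl// ltW.
  have Kq : 2 * K * q <= 2 * `|K| * e.
    apply: (@le_trans _ _ (2 * `|K| * q)).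
      by rewrite ler_wpM2r// ler_wpM2l// ler_norm.
    by rewrite ler_wpM2l ?mulr_ge0// (le_trans psi2e).
  have e2' : 2 * `|K| * e <= d.
    by apply: le_trans e2; rewrite mulrC ler_wpM2l ?(ltW e0)// lerDl.
  have := lerD (ler_wpM2l (ler0n _ 2) (le_trans hh h2)) (le_trans Kq e2').
  have -> : 2 * (d / 2) + d = 2 * d by field.
  exact.
have den_ge0 : (0 <= den)%E by apply: expectZ_ge0 => z; exact: sqr_ge0.
have DE : D ^+ 2 = 8 * M * d by rewrite /d; field; rewrite gt_eqF.
apply: (@le_trans _ _ ('E_eta[r \* b] ^+ 2 / den)%E); last first.
  by apply: ereal_sup_ubound; exists b.
have -> : ('E_eta[r \* b] = x%:E)%E.
  by rewrite unlock /x /Rintegral fineK//; exact: integrable_fin_num.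
move: den_le den_ge0; case: den => [y| |]//; rewrite !lee_fin => yd y0.
exact: ratio_ge d0 DE xDle y0 yd.
Qed.

End efficiency.

(** * Step directions with small score *)

Section step_direction.
Context {R : realType}.
Variable eta : probability (R * R)%type R.
Hypothesis eta1 : eta (@UHdom R) = 1%E.

(** Near p the open set [W] meets the interior of the support, and around such a common point there
    are charged sets inside [W] and the given neighbourhood. *)
Lemma approach (p : R * R) (W A : set (R * R)) : (supp eta)° p -> open W ->
  closure W p -> nbhs p A ->
  exists U, [/\ measurable U, U `<=` W `&` A & (0 < eta U)%E].
Proof.
move=> ip oW cW pA.
have [q [Wq Bq]] := cW _ (nbhs_interior (filterI pA ip)).
have [sq qA] : supp eta q /\ nbhs q A.
  have := Bq; rewrite interiorI => -[qA qs]; split=> //.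
  exact: interior_subset qs.
have [U [mU UA U0]] := supp_box sq (filterI (open_nbhs_nbhs (conj oW Wq)) qA).
by exists U.
Qed.

(** An interior point of the support can be pulled slightly towards the origin within the support.
    This supplies the parameter at which the mixture is bounded below. *)
Lemma shrink_supp (p : R * R) : (supp eta)° p -> exists l : R,
  [/\ 0 < l, l < 1 & supp eta (l * p.1, l * p.2)].
Proof.
move=> /nbhs_ballP[e /= e0 ball_e].
have n0 : 0 < 2 * (`|p.1| + `|p.2| + 1).
  by rewrite mulr_gt0// ltr_wpDl// addr_ge0.
(* The bound 1/2 keeps l = 1 - d positive; the other one keeps the displacement below e in both
   coordinates. *)
pose d := Num.min (1 / 2) (e / (2 * (`|p.1| + `|p.2| + 1))).
have d0 : 0 < d by rewrite lt_min !divr_gt0.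
have d1 : d <= 1 / 2 by rewrite ge_min lexx.
have de : d * (2 * (`|p.1| + `|p.2| + 1)) <= e.
  by rewrite -ler_pdivlMr// ge_min lexx orbT.
have small (x : R) : `|x| <= `|p.1| + `|p.2| -> `|x - (1 - d) * x| < e.
  move=> xp; rewrite (_ : x - (1 - d) * x = d * x); last by ring.
  rewrite normrM (gtr0_norm d0); apply: lt_le_trans de.
  by rewrite ltr_pM2l//; have := normr_ge0 x; lra.
exists (1 - d); split; [lra|lra|apply: ball_e].
by split; apply: small; rewrite ?lerDl ?lerDr.
Qed.

(** The points p and p' have equal squared coordinates, so one dominator serves both. Taking p' = p
    with w = w' = 1 is the ordinary case; the general form is for a jump along a.1 = 0. *)
Lemma step_direction (p p' : R * R) (W W' : set (R * R)) (w w' c c' h : R)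
    (r : R * R -> R) :
  (supp eta)° p -> (supp eta)° p' -> p.1 != 0 ->
  p'.1 ^+ 2 = p.1 ^+ 2 -> p'.2 = p.2 ->
  open W -> open W' -> closure W p -> closure W' p' ->
  (forall z, 0 <= z.1 -> 0 <= z.2 -> w * kernel_z p z = w' * kernel_z p' z) ->
  (forall a, W a -> r a = c) -> (forall a, W' a -> r a = c') -> 0 < h ->
  exists phi : R * R -> R, exists M : R,
    [/\ measurable_fun [set: R * R] phi, forall a, `|phi a| <= M,
        \int[eta]_a (r a * phi a) = c * w - c' * w' &
        forall z : R * R, 0 <= z.1 -> 0 <= z.2 -> mixture eta z \is a fin_num ->
          (`|\int[eta]_(a in @UHdom R) (phi a * kernel_z a z)%:E| <=
           h%:E * mixture eta z)%E].
Proof.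
move=> ip ip' p10 p1' p2' oW oW' cW cW' ww' rW rW' h0.
have p20 := interior_supp_gt0 eta1 ip.
have p20' := interior_supp_gt0 eta1 ip'.
have [l [l0 l1 sl]] := shrink_supp ip.
have sq_lt (x : R) : x != 0 -> (l * x) ^+ 2 < x ^+ 2.
  move=> x0; rewrite exprMn gtr_pMl ?exprn_even_gt0//.
  by rewrite expr_lt1// ltW.
(* Midpoints: strictly above the squares at l p, for the lower bound on the mixture, and strictly
   below those at p, for the modulus of continuity. *)
pose u := ((l * p.1) ^+ 2 + p.1 ^+ 2) / 2; pose v := ((l * p.2) ^+ 2 + p.2 ^+ 2) / 2.
have [lu up] : (l * p.1) ^+ 2 < u /\ u < p.1 ^+ 2 by split; have := sq_lt _ p10; rewrite /u; lra.
have [lv vp] : (l * p.2) ^+ 2 < v /\ v < p.2 ^+ 2.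
  by split; have := sq_lt _ (lt0r_neq0 p20); rewrite /v; lra.
have [c0 c00 low] := mixture_lower_bound sl lu lv (mulr_gt0 l0 p20).
(* Chosen so that (|w| + |w'|) h' <= h c0, the total error allowed relative to the dominator. *)
pose h' := h * c0 / (`|w| + `|w'| + 1).
have n0 : 0 < `|w| + `|w'| + 1 by rewrite ltr_wpDl// addr_ge0.
have h'0 : 0 < h' by rewrite divr_gt0// mulr_gt0.
have nA := kernel_z_near up vp h'0.
have up' : u < p'.1 ^+ 2 by rewrite p1'.
have vp' : v < p'.2 ^+ 2 by rewrite p2'.
have nA' := kernel_z_near up' vp' h'0.
have [U [mU UA U0]] := approach ip oW cW (filterI nA (near_snd_gt0 p20)).
have [U' [mU' UA' U0']] := approach ip' oW' cW' (filterI nA' (near_snd_gt0 p20')).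
have finU V : measurable V -> eta V \is a fin_num by move=> mV; rewrite fin_num_measure.
pose e := fine (eta U); pose e' := fine (eta U').
have e0 : 0 < e by rewrite -lte_fin fineK// finU.
have e0' : 0 < e' by rewrite -lte_fin fineK// finU.
(* Dividing by the masses fixes the totals w and - w', however small [U] and [U'] are. *)
pose phi a := w / e * \1_U a + - w' / e' * \1_U' a : R.
have mphi : measurable_fun [set: R * R] phi.
  by apply: measurable_funD; apply: measurable_funM => //; exact: measurable_indic.
exists phi, (`|w / e| + `|- w' / e'|); split=> //.
- move=> a; apply: (le_trans (ler_normD _ _)); apply: lerD; rewrite normrM ler_piMr//.
    by rewrite indicE ger0_norm//; case: (_ \in _).
  by rewrite indicE ger0_norm//; case: (_ \in _).
- rewrite (_ : \int[eta]_a _ =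
      \int[eta]_a (c * (w / e) * \1_U a + c' * (- w' / e') * \1_U' a)).
    by rewrite Rintegral_step// -/e -/e'; field; rewrite !gt_eqF.
  apply: eq_Rintegral => a _; rewrite /phi mulrDr !mulrA !indicE.
  congr (_ + _).
    case: (boolP (a \in U)) => [/set_mem/UA[/rW -> _]|_]; last by rewrite !mulr0.
    by ring.
  case: (boolP (a \in U')) => [/set_mem/UA'[/rW' -> _]|_]; last by rewrite !mulr0.
  by ring.
move=> z z1 z2 _.
pose D : R := dominator u v z; pose k a : R := kernel_z a z.
have D0 : 0 <= D by exact: dominator_ge0.
have kU a : U a -> `|k a - k p| <= h' * D by move=> /UA[_ [/(_ z z1 z2)]].
have kU' a : U' a -> `|k a - k p'| <= h' * D by move=> /UA'[_ [/(_ z z1 z2)]].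
(* [s] freezes the kernel at p on [U] and at p' on [U'], so that its integral w k(p) - w' k(p')
   vanishes; [g] bounds the error made. *)
pose s a := w / e * k p * \1_U a + - w' / e' * k p' * \1_U' a : R.
pose g a := `|w| / e * (h' * D) * \1_U a + `|w'| / e' * (h' * D) * \1_U' a : R.
have hD0 : 0 <= h' * D by rewrite mulr_ge0// ltW.
have ig : eta.-integrable [set: R * R] (EFin \o g) by exact: integrable_step.
have is_ : eta.-integrable [set: R * R] (EFin \o s) by exact: integrable_step.
have mk : measurable_fun [set: R * R] k := @measurable_kernel_z1 _ z.
have dg a : `|phi a * k a - s a| <= g a.
  rewrite (_ : phi a * k a - s a =
    w / e * (\1_U a * (k a - k p)) + - w' / e' * (\1_U' a * (k a - k p'))).
    apply: (le_trans (ler_normD _ _)); rewrite !normrM /g.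
    rewrite normrN !normfV (gtr0_norm e0) (gtr0_norm e0') -!(mulrA _ (h' * D)).
    apply: lerD; apply: ler_wpM2l; rewrite ?divr_ge0 ?(ltW e0) ?(ltW e0')//.
      rewrite indicE; case: (boolP (a \in U)) => [/set_mem aU|_].
        by rewrite normr1 mul1r mulr1 kU.
      by rewrite normr0 mul0r mulr0.
    rewrite indicE; case: (boolP (a \in U')) => [/set_mem aU|_].
      by rewrite normr1 mul1r mulr1 kU'.
    by rewrite normr0 mul0r mulr0.
  by rewrite /phi /s; ring.
have idf : eta.-integrable [set: R * R] (EFin \o (fun a => phi a * k a - s a)).
  apply: (le_integrable measurableT _ _ ig).
    apply/measurable_EFinP; apply: measurable_funB; first exact: measurable_funM.
    by apply/measurable_EFinP; exact: measurable_int is_.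
  by move=> a _ /=; rewrite lee_fin (le_trans (dg a))// ler_norm.
have ipk : eta.-integrable [set: R * R] (EFin \o (fun a => phi a * k a)).
  have := integrableD measurableT idf is_.
  by apply: eq_integrable => // a _ /=; rewrite -EFinD subrK.
have -> : (\int[eta]_(a in @UHdom R) (phi a * kernel_z a z)%:E =
    \int[eta]_a (phi a * k a)%:E)%E.
  rewrite integral_mkcond; apply: eq_integral => a _; rewrite patchE.
  case: ifPn => // /negP aUH; rewrite /phi !indicE.
  have aU : a \notin U.
    apply/negP => /set_mem/UA[_ [_ a2]]; apply: aUH; apply: mem_set.
    exact: ltW.
  have aU' : a \notin U'.
    apply/negP => /set_mem/UA'[_ [_ a2]]; apply: aUH; apply: mem_set.
    exact: ltW.
  by rewrite (negbTE aU) (negbTE aU') !mulr0 addr0 mul0r.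
rewrite -(fineK (integrable_fin_num measurableT ipk)) abse_EFin.
apply: (@le_trans _ _ (h * (c0 * D))%:E); last first.
  by rewrite EFinM lee_wpmul2l ?low// lee_fin ltW.
rewrite lee_fin -/(Rintegral _ _ _).
have -> : \int[eta]_a (phi a * k a) = \int[eta]_a (phi a * k a - s a).
  have s0 : \int[eta]_a s a = 0.
    rewrite Rintegral_step// -/e -/e'.
    have -> : w / e * k p * e + - w' / e' * k p' * e' = w * k p - w' * k p'.
      by field; rewrite !gt_eqF.
    by rewrite /k ww'// subrr.
  by rewrite (RintegralB measurableT ipk is_) s0 subr0.
apply: (le_trans (le_normr_Rintegral measurableT idf)).
apply: (@le_trans _ _ (\int[eta]_a g a)).
  apply: le_Rintegral => //.
  by have := integrable_norm idf; exact: eq_integrable.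
rewrite Rintegral_step// -/e -/e'.
have -> : `|w| / e * (h' * D) * e + `|w'| / e' * (h' * D) * e' =
    (`|w| + `|w'|) * h' * D by field; rewrite !gt_eqF.
rewrite mulrA ler_wpM2r// /h' mulrA ler_pdivrMr// mulrC ler_wpM2l//.
  by rewrite mulr_ge0// ltW.
by rewrite lerDl.
Qed.

End step_direction.

(** * Expansions along paths, and the gradient of the CDF value *)

Section gradients.
Context {R : realType}.
Variables (H : set (probability (R * R)%type R)) (eta0 : probability (R * R)%type R).

Lemma path_limit (eta : R -> probability (R * R)%type R) (b : R * R -> R) (e : R) :
  path_with_score H eta0 eta b -> 0 < e ->
  \forall t \near 0^'+, forall f : R * R -> R, measurable_fun [set: R * R] f ->
    (forall a, `|f a| <= 1) ->
    `|(\int[eta t]_a f a - \int[eta0]_a f a) / t - \int[eta0]_a (f a * b a)| <= e.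
Proof.
move=> [bL [eps [nu [p [p0 [eps0 _ _ dens]]]]]] /fine_cvgP[rfin rlim] e0.
have [mb ib2] := Lfun2_integrable bL.
set B := \int[eta0]_a (b a ^+ 2).
have B0 : 0 <= B by apply: Rintegral_ge0 => a _; exact: sqr_ge0.
(* Three error terms of at most l each: the squared remainder is kept below l^2 and below 1, and t
   below l / (B / 2 + 2). *)
pose l := e / 4; have l0 : 0 < l by rewrite divr_gt0.
pose d := Num.min 1 (l ^+ 2); have d0 : 0 < d by rewrite lt_min ltr01 exprn_gt0.
have t10 : 0 < l / (B / 2 + 2) by rewrite divr_gt0// ltr_wpDl// divr_ge0.
pose r t a := (Num.sqrt (p t a) - Num.sqrt (p0 t a)) / t - 2^-1 * b a * Num.sqrt (p0 t a).
have rlt : \forall t \near 0^'+, fine (\int[nu t]_a (r t a ^+ 2)%:E)%E < d.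
  exact: (cvgr_lt _ rlim).
have rf' : \forall t \near 0^'+, (\int[nu t]_a (r t a ^+ 2)%:E)%E \is a fin_num by [].
near=> t => f mf f1.
have t0 : 0 < t by near: t; exact: nbhs_right_gt.
have teps : t < eps by near: t; exact: nbhs_right_lt.
have tB : t <= l / (B / 2 + 2) by near: t; exact: nbhs_right_le.
have [[mp p_ge0 mu_p] [mp0 p0_ge0 mu0_p0]] := dens t (introT andP (conj t0 teps)).
have rf : (\int[nu t]_a (r t a ^+ 2)%:E)%E \is a fin_num by near: t.
have rl : fine (\int[nu t]_a (r t a ^+ 2)%:E)%E < d by near: t.
have rfin' : (\int[nu t]_a (r t a ^+ 2)%:E < +oo)%E by rewrite ltey_eq rf.
have := path_expansion mp p_ge0 mp0 p0_ge0 mu_p mu0_p0 mb ib2 t0 l0 rfin' mf f1.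
rewrite -/B; set rho := \int[nu t]_a _ => h; apply: (le_trans h).
have {}rl : rho < d by [].
have rho0 : 0 <= rho by apply: Rintegral_ge0 => a _; exact: sqr_ge0.
have rl1 : rho / l <= l.
  by rewrite ler_pdivrMr// -expr2 (le_trans (ltW rl))// ge_min lexx orbT.
have rho1 : rho <= 1 by rewrite (le_trans (ltW rl))// ge_min lexx.
have tl : t * (B / 2 + 2 * rho) <= l.
  rewrite (@le_trans _ _ (t * (B / 2 + 2)))//.
    by rewrite ler_pM2l// lerD2l ger_pMr.
  by rewrite -ler_pdivlMr// ltr_wpDl// divr_ge0.
by apply: (le_trans (lerD (lerD rl1 (lexx l)) tl)); rewrite /l; lra.
Unshelve. all: by end_near. Qed.

(** Take the constant function 1 in the expansion: its expectation does not change along the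
    path. *)
Lemma score_mean0 eta b : path_with_score H eta0 eta b -> \int[eta0]_a b a = 0.
Proof.
move=> path; apply/eqP; rewrite -normr_le0; apply/ler_addgt0Pl => e e0.
rewrite addr0; have pl := path_limit path e0.
near ((0 : R)^'+) => t.
have one : `|(\int[eta t]_a (1 : R) - \int[eta0]_a (1 : R)) / t - \int[eta0]_a (1 * b a)| <= e.
  have ht : forall f : R * R -> R, measurable_fun [set: R * R] f ->
    (forall a, `|f a| <= 1) ->
    `|(\int[eta t]_a f a - \int[eta0]_a f a) / t - \int[eta0]_a (f a * b a)| <= e.
    by near: t.
  by apply: (ht (fun=> 1)) => // a; rewrite normr1.
have E1 (m : probability (R * R)%type R) : \int[m]_a (1 : R) = 1.
  by have := expectation_cst m 1; rewrite unlock /Rintegral => ->.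
rewrite !E1 subrr mul0r sub0r normrN in one; apply: le_trans one.
rewrite le_eqVlt; apply/predU1P; left; congr (`|_|).
by apply: eq_Rintegral => a _; rewrite mul1r.
Unshelve. all: by end_near. Qed.

Lemma path_derivative (eta : R -> probability (R * R)%type R) (b f : R * R -> R) :
  path_with_score H eta0 eta b -> measurable_fun [set: R * R] f ->
  (forall a, `|f a| <= 1) ->
  (\int[eta t]_a f a - \int[eta0]_a f a) / t @[t --> 0^'+] -->
    \int[eta0]_a (f a * b a).
Proof.
move=> path mf f1; apply/cvgrPdist_le => e e0.
apply: filterS (path_limit path e0) => t /(_ f mf f1).
by rewrite distrC.
Qed.

Lemma bounded_L20 (r : R * R -> R) (M : R) : measurable_fun [set: R * R] r ->
  (forall a, `|r a| <= M) -> \int[eta0]_a r a = 0 -> L20 eta0 r.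
Proof.
move=> mr rM r0; split.
  apply: integrable_Lfun2 => //.
  have : eta0.-integrable [set: R * R] (EFin \o (fun a => r a ^+ 2)).
    apply: (bounded_integrable eta0 (M := M ^+ 2)); first exact: measurable_funX.
    move=> a; rewrite normrX lerXn2r ?nnegrE//.
    exact: le_trans (rM a).
  by move=> /integrable_lty; apply.
have ir := bounded_integrable eta0 mr rM.
by rewrite unlock -(fineK (integrable_fin_num measurableT ir)) -[fine _]/(Rintegral _ _ _) r0.
Qed.

Lemma measurable_cdf_integrand (a0 : R * R) :
  measurable_fun [set: R * R] (cdf_integrand a0).
Proof.
have m (c : R) : measurable_fun [set: R] (\1_[set x : R | x <= c] : R -> R).
  by apply: measurable_indic; rewrite -set_itvNyc; exact: measurable_itv.
by apply: measurable_funM; [exact: (measurableT_comp (m _) measurable_fst)|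
  exact: (measurableT_comp (m _) measurable_snd)].
Qed.

Lemma cdf_integrand_le1 (a0 a : R * R) : `|cdf_integrand a0 a| <= 1.
Proof.
by rewrite /cdf_integrand !indicE; do 2 case: (_ \in _);
  rewrite ?mulr1 ?mulr0 ?normr1 ?normr0.
Qed.

Lemma cdf_gradient_L20 (a0 : R * R) : L20 eta0 (cdf_gradient eta0 a0).
Proof.
have mf := measurable_cdf_integrand a0.
apply: (@bounded_L20 _ (1 + `|cdf_value a0 eta0|)).
- exact: measurable_funB.
- by move=> a; rewrite (le_trans (ler_normB _ _))// lerD2r cdf_integrand_le1.
have ic : eta0.-integrable [set: R * R] (EFin \o (fun=> cdf_value a0 eta0)).
  by apply: (@bounded_integrable _ _ _ eta0 (fun=> cdf_value a0 eta0) `|cdf_value a0 eta0|).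
rewrite (RintegralB measurableT (bounded_integrable eta0 mf (cdf_integrand_le1 a0)) ic).
have E1 : \int[eta0]_a (cdf_value a0 eta0) = cdf_value a0 eta0.
  by have := expectation_cst eta0 (cdf_value a0 eta0); rewrite unlock /Rintegral => ->.
by rewrite E1 /cdf_value unlock subrr.
Qed.

Lemma EFin_cvg_right (u : R -> R) (l : R) : u t @[t --> 0^'+] --> l ->
  (u t)%:E @[t --> 0^'+] --> l%:E.
Proof. by move=> ul; apply/fine_cvgP; split=> //; exact: nearW. Qed.

(** The expansion applies to the indicator itself; subtracting the CDF value changes nothing because
    scores have mean 0. *)
Lemma is_gradient_cdf (a0 : R * R) :
  is_gradient H eta0 (cdf_value a0) (cdf_gradient eta0 a0).
Proof.
split; first exact: cdf_gradient_L20.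
move=> eta b path; have [bL _] := path.
have [mb ib2] := Lfun2_integrable bL.
have mf := measurable_cdf_integrand a0.
have f1 := cdf_integrand_le1 a0.
have [rL _] := cdf_gradient_L20 a0.
have irb := Lfun2_mul_integrable rL bL.
have L1 : (fun=> 1) \in Lfun eta0 2%:E by exact: Lfun_cst.
have ib : eta0.-integrable [set: R * R] (EFin \o b).
  have := Lfun2_mul_integrable bL L1.
  by apply: eq_integrable => // a _ /=; rewrite mulr1.
have -> : ('E_eta0[cdf_gradient eta0 a0 \* b] =
    (\int[eta0]_a (cdf_integrand a0 a * b a))%:E)%E.
  rewrite unlock -(fineK (integrable_fin_num measurableT irb)); congr EFin.
  have ifb : eta0.-integrable [set: R * R] (EFin \o (fun a => cdf_integrand a0 a * b a)).
    have := integrableD measurableT irb (integrableZl measurableT (cdf_value a0 eta0) ib).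
    by apply: eq_integrable => // a _ /=; rewrite -EFinM -EFinD /cdf_gradient; congr EFin; ring.
  transitivity (\int[eta0]_a (cdf_integrand a0 a * b a - cdf_value a0 eta0 * b a)).
    by apply: eq_Rintegral => a _; rewrite /cdf_gradient; ring.
  rewrite (RintegralB measurableT ifb (integrableZl measurableT (cdf_value a0 eta0) ib)).
  by rewrite (RintegralZl _ measurableT ib) (score_mean0 path) mulr0 subr0.
apply: EFin_cvg_right; have := path_derivative path mf f1.
by rewrite /cdf_value unlock.
Qed.

End gradients.

(** * The gradient of a quantile *)

Section quantile.
Context {R : realType}.
Variables (H : set (probability (R * R)%type R)) (eta0 : probability (R * R)%type R).
Variables (k : 'I_2) (tau q : R) (g : R -> R).
Hypotheses (tau01 : 0 < tau < 1) (qE : q = quantile k tau eta0).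
Hypothesis gq : positive_density_near eta0 k q g.

Let X : R * R -> R := ucoord k.
Let below (x : R) : R * R -> R := \1_[set a | X a <= x].
Let F (eta : probability (R * R)%type R) (x : R) : R := \int[eta]_a below x a.

Lemma measurable_ucoord (j : 'I_2) : measurable_fun [set: R * R] (@ucoord R j).
Proof.
by rewrite /ucoord; case: (j == ord0); [exact: measurable_fst|exact: measurable_snd].
Qed.

Let mX (A : set R) : measurable A -> measurable (X @^-1` A).
Proof. by move=> mA; rewrite -[_ @^-1` _]setTI; exact: measurable_ucoord. Qed.

Let m_le x : measurable [set a | X a <= x].
Proof.
rewrite (_ : [set a | X a <= x] = X @^-1` `]-oo, x]); first exact: mX.
by apply/seteqP; split=> a /=; rewrite in_itv.
Qed.

Let mbelow x : measurable_fun [set: R * R] (below x).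
Proof. exact: measurable_indic. Qed.

Let below_le1 x a : `|below x a| <= 1.
Proof. by rewrite /below indicE; case: (_ \in _); rewrite ?normr1 ?normr0. Qed.

Let FE (eta : probability (R * R)%type R) x : eta [set a | X a <= x] = (F eta x)%:E.
Proof. by rewrite /F Rintegral_indic// fineK// fin_num_measure. Qed.

Let F_nd (eta : probability (R * R)%type R) x y : x <= y -> F eta x <= F eta y.
Proof.
move=> xy; rewrite -lee_fin -!FE; apply: le_measure; rewrite ?inE//.
by move=> a /= /le_trans; apply.
Qed.

Let quantileE (eta : probability (R * R)%type R) : quantile k tau eta = inf [set x : R | tau <= F eta x].
Proof. by rewrite /quantile; congr inf; apply/seteqP; split=> x /=; rewrite FE lee_fin. Qed.

Let cvgF : F eta0 (n%:R) @[n --> \oo] --> (1 : R).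
Proof.
have nd : nondecreasing_seq (fun n : nat => [set a | X a <= n%:R]).
  move=> m n mn; rewrite subsetEset => a /= /le_trans; apply.
  by rewrite ler_nat.
have := @nondecreasing_cvg_mu _ _ _ eta0 _ (fun n => m_le n%:R) _ nd.
have -> : \bigcup_n [set a | X a <= n%:R] = [set: R * R].
  apply/seteqP; split=> // a _; exists (Num.truncn `|X a|).+1 => //=.
  by rewrite (le_trans (ler_norm _))// ltW// truncnS_gt.
move=> /(_ measurableT) cv.
have {cv} : eta0 [set a | X a <= n%:R] @[n --> \oo] --> eta0 [set: R * R] := cv.
by rewrite probability_setT; under eq_fun do rewrite FE; move=> /fine_cvgP[].
Qed.

Let cvgF0 : F eta0 (- n%:R) @[n --> \oo] --> (0 : R).
Proof.
have ni : nonincreasing_seq (fun n : nat => [set a | X a <= - n%:R]).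
  move=> m n mn; rewrite subsetEset => a /= /le_trans; apply.
  by rewrite lerN2 ler_nat.
have := @nonincreasing_cvg_mu _ _ _ eta0 (fun n => [set a | X a <= - n%:R]) _ (fun n => m_le _) _ ni.
have -> : \bigcap_n [set a | X a <= - n%:R] = set0.
  apply/seteqP; split=> // a /(_ (Num.truncn `|X a|).+1 I)/= h.
  have := truncnS_gt `|X a|; rewrite ltNge => /negP; apply.
  by rewrite -[X in _ <= X]normrN (le_trans _ (ler_norm _))// lerNr.
move=> h.
have cv : eta0 [set a | X a <= - n%:R] @[n --> \oo] --> eta0 set0.
  apply: h => //; exact: (le_lt_trans (probability_le1 eta0 (m_le _)) (ltry 1)).
move: cv; rewrite measure0; under eq_fun do rewrite FE.
by move=> /fine_cvgP[].
Qed.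

(** The CDF tends to 1 and to 0 at the two ends and tau lies strictly between, so the infimum
    defining the quantile is a genuine one. *)
Let has_inf_S : has_inf [set x : R | tau <= F eta0 x].
Proof.
have [t0 t1] := andP tau01; split.
  near \oo => n; exists (n%:R) => /=; apply/ltW; near: n.
  exact: (cvgr_gt _ cvgF).
near \oo => n; exists (- n%:R) => x /= tx; rewrite leNgt; apply/negP => xn.
have : F eta0 (- n%:R) < tau by near: n; exact: (cvgr_lt _ cvgF0).
by rewrite ltNge => /negP; apply; apply: (le_trans tx); exact/F_nd/ltW.
Unshelve. all: by end_near. Qed.

Let F_lt x : x < q -> F eta0 x < tau.
Proof.
move=> xq; rewrite ltNge; apply/negP => tx; move: xq; rewrite ltNge => /negP; apply.
by rewrite qE quantileE; apply: ge_inf => //; have [] := has_inf_S.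
Qed.

Let F_gt x : q < x -> tau <= F eta0 x.
Proof.
rewrite qE quantileE => qx.
rewrite -subr_gt0 in qx; have [y ty] := inf_adherent qx has_inf_S.
rewrite addrC subrK => yx.
by apply: (le_trans ty); exact/F_nd/ltW.
Qed.

Let d0 : exists d : R, [/\ 0 < d, measurable_fun `]q - d, q + d[ g,
        (forall x, x \in `]q - d, q + d[ -> 0 < g x) &
        forall A : set R, measurable A -> A `<=` `]q - d, q + d[ ->
          (eta0 (X @^-1` A) = \int[@lebesgue_measure R]_(x in A) (g x)%:E)%E] := gq.

Lemma density_at_gt0 : 0 < g q.
Proof.
by have [d [d1 _ gpos _]] := d0; apply: gpos; rewrite in_itv/= ltrBlDr ltrDl d1.
Qed.

Let null_q : eta0 (X @^-1` [set q]) = 0%E.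
Proof.
have [d [d1 _ _ gA]] := d0; rewrite gA//; first exact: integral_set1.
by move=> x ->; rewrite /= in_itv/= ltrBlDr ltrDl d1.
Qed.

Let ae_neq_q : {ae eta0, forall a, X a <> q}.
Proof.
exists (X @^-1` [set q]); split=> //; first exact: mX.
by move=> a /= /contrapT.
Qed.

Let measure_diff_null (A B : set (R * R)) : measurable A -> measurable B ->
  eta0 B = 0%E -> eta0 (A `\` B) = eta0 A.
Proof.
move=> mA mB B0.
have -> : eta0 (A `\` B) = (eta0 A - eta0 (A `&` B))%E.
  by apply: measureD => //; exact: (le_lt_trans (probability_le1 eta0 mA) (ltry 1)).
have -> : eta0 (A `&` B) = 0%E.
  have : (eta0 (A `&` B) <= eta0 B)%E.
    by apply: le_measure; rewrite ?inE//; exact: measurableI.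
  by rewrite B0 => AB; apply/eqP; rewrite eq_le AB measure_ge0.
by rewrite sube0.
Qed.

(** Right continuity of the CDF, with tau <= F at every point to the right of q. *)
Let F_q_ge : tau <= F eta0 q.
Proof.
have ni : nonincreasing_seq (fun n : nat => [set a | X a <= q + n.+1%:R^-1]).
  move=> m n mn; rewrite subsetEset => a /= /le_trans; apply.
  by rewrite lerD2l lef_pV2 ?posrE// ler_nat.
have := @nonincreasing_cvg_mu _ _ _ eta0 (fun n => [set a | X a <= q + n.+1%:R^-1]) _ (fun n => m_le _) _ ni.
have -> : \bigcap_n [set a | X a <= q + n.+1%:R^-1] = [set a | X a <= q].
  apply/seteqP; split=> [a h /=|a /= aq n _ /=]; last first.
    by rewrite (le_trans aq)// lerDl.
  apply/ler_addgt0Pr => e e0.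
  have [n ne] := ltr_add_invr e0; rewrite add0r in ne.
  by apply: (le_trans (h n I)); rewrite lerD2l ltW.
move=> h.
have cv : eta0 [set a | X a <= q + n.+1%:R^-1] @[n --> \oo] --> eta0 [set a | X a <= q].
  apply: h => //; exact: (le_lt_trans (probability_le1 eta0 (m_le _)) (ltry 1)).
move: cv; rewrite FE; under eq_fun do rewrite FE.
move=> /fine_cvgP[_ cv].
apply: (cvgr_to_ge cv); apply: nearW => n /=.
by apply: F_gt; rewrite ltrDl.
Qed.

(** The left limit of the CDF at q is at most tau, and it equals F q because the density near q
    excludes an atom. *)
Let F_q_le : F eta0 q <= tau.
Proof.
have nd : nondecreasing_seq (fun n : nat => [set a | X a <= q - n.+1%:R^-1]).
  move=> m n mn; rewrite subsetEset => a /= /le_trans; apply.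
  by rewrite lerD2l lerN2 lef_pV2 ?posrE// ler_nat.
have := @nondecreasing_cvg_mu _ _ _ eta0 _ (fun n => m_le (q - n.+1%:R^-1)) _ nd.
have -> : \bigcup_n [set a | X a <= q - n.+1%:R^-1] = [set a | X a <= q] `\` X @^-1` [set q].
  apply/seteqP; split=> [a [n _ /= aq]|a /= [aq /eqP aneq]].
    have aq' : X a < q by rewrite (le_lt_trans aq)// ltrBlDr ltrDl.
    by split; [exact: ltW|move=> aE; rewrite aE ltxx in aq'].
  have : 0 < q - X a by rewrite subr_gt0 lt_neqAle aneq.
  move=> /ltr_add_invr[n]; rewrite add0r => /ltW h; exists n => //=.
  by rewrite lerBrDl addrC -lerBrDl.
have mD : measurable ([set a | X a <= q] `\` X @^-1` [set q]).
  by apply: measurableD; [exact: m_le|exact: mX].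
move=> /(_ mD) cv.
have {cv} : eta0 [set a | X a <= q - n.+1%:R^-1] @[n --> \oo] -->
  eta0 ([set a | X a <= q] `\` X @^-1` [set q]) := cv.
have -> : eta0 ([set a | X a <= q] `\` X @^-1` [set q]) = (F eta0 q)%:E.
  rewrite -FE measure_diff_null//; exact: mX.
under eq_fun do rewrite FE.
move=> /fine_cvgP[_ cv].
apply: (cvgr_to_le cv); apply: nearW => n /=.
by apply/ltW/F_lt; rewrite ltrBlDr ltrDl.
Qed.

Let F_q : F eta0 q = tau.
Proof. by apply/eqP; rewrite eq_le F_q_le F_q_ge. Qed.

Let r := quantile_gradient k tau q g.
Let lt_q : R * R -> R := \1_[set a | X a < q].

Let rE a : r a = - ((lt_q a - tau) / g q).
Proof. by rewrite /r /quantile_gradient /lt_q !indicE. Qed.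

Let mlt_q : measurable_fun [set: R * R] lt_q.
Proof.
apply: measurable_indic; rewrite (_ : [set a | X a < q] = X @^-1` `]-oo, q[).
  exact: mX.
by apply/seteqP; split=> a /=; rewrite in_itv.
Qed.

(** The gradient is written with a strict inequality and the CDF with a weak one; they differ on a
    null set, as q carries no atom. *)
Let lt_q_ae : {ae eta0, forall a, lt_q a = below q a}.
Proof.
apply: filterS ae_neq_q => a aq; rewrite /lt_q /below !indicE.
congr (nat_of_bool _)%:R; apply/idP/idP => /set_mem/= h; apply: mem_set => //=.
  exact: ltW.
by rewrite lt_neqAle h andbT; apply/eqP.
Qed.

Let integral_lt_q (f : R * R -> R) : measurable_fun [set: R * R] f ->
  \int[eta0]_a (lt_q a * f a) = \int[eta0]_a (below q a * f a).
Proof.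
move=> mf; rewrite /Rintegral; congr fine; apply: ae_eq_integral => //.
- by apply/measurable_EFinP; exact: measurable_funM.
- by apply/measurable_EFinP; exact: measurable_funM.
- by apply: filterS lt_q_ae => a /= -> _.
Qed.

Lemma quantile_gradient_L20 : L20 eta0 (quantile_gradient k tau q g).
Proof.
have g0 := density_at_gt0; have [t0 t1] := andP tau01.
have mr : measurable_fun [set: R * R] r.
  rewrite (_ : r = fun a => (lt_q a - tau) * - (g q)^-1).
    by apply: measurable_funM => //; exact: measurable_funB.
  by apply/funext => a; rewrite rE mulrN.
have rM a : `|r a| <= 2 / g q.
  rewrite rE normrN normrM normfV (gtr0_norm g0) ler_pM2r ?invr_gt0//.
  rewrite (le_trans (ler_normB _ _))// -[leRHS]/(1 + 1) lerD//.
    by rewrite /lt_q indicE; case: (_ \in _); rewrite ?normr1 ?normr0.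
  by rewrite gtr0_norm// ltW.
apply: (bounded_L20 mr rM).
have i1 : eta0.-integrable [set: R * R] (EFin \o lt_q).
  apply: (bounded_integrable eta0 (M := 1)) => // a.
  by rewrite /lt_q indicE; case: (_ \in _); rewrite ?normr1 ?normr0.
have ic (c : R) : eta0.-integrable [set: R * R] (EFin \o (fun=> c)).
  by apply: (@bounded_integrable _ _ _ eta0 (fun=> c) `|c|).
rewrite (_ : Rintegral _ _ _ = \int[eta0]_a (- (g q)^-1 * lt_q a + tau / g q)).
  rewrite (RintegralD measurableT (integrableZl measurableT _ i1) (ic _)).
  rewrite (RintegralZl _ measurableT i1).
  have -> : \int[eta0]_a lt_q a = tau.
    rewrite -F_q; have := @integral_lt_q (fun=> 1) (measurable_cst _).
    under eq_Rintegral do rewrite mulr1.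
    by move=> ->; apply: eq_Rintegral => a _; rewrite mulr1.
  have -> : \int[eta0]_a (tau / g q) = tau / g q.
    by have := expectation_cst eta0 (tau / g q); rewrite unlock /Rintegral => ->.
  by ring.
by apply: eq_Rintegral => a _; rewrite -/(r a) rE; ring.
Qed.

(** The increment is the integral of [g] over ]x, y], where continuity at q keeps [g] within e of g
    q. *)
Let F_increment (e : R) : {for q, continuous g} -> 0 < e ->
  exists2 d : R, 0 < d & forall x y : R, q - d < x -> x <= y -> y < q + d ->
    `|F eta0 y - F eta0 x - g q * (y - x)| <= e * (y - x).
Proof.
move=> cg e0; have [d [d1 mg gpos gA]] := d0.
have /nbhs_ballP[d2 /= d20 gd2] : \forall y \near q, `|g q - g y| <= e.
  exact: (@cvgr_dist_le _ R^o _ _ _ _ _ cg).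
exists (Num.min d d2); first by rewrite lt_min d1.
move=> x y qx xy yq.
have mind : Num.min d d2 <= d by rewrite ge_min lexx.
have mind2 : Num.min d d2 <= d2 by rewrite ge_min lexx orbT.
set A : set R := `]x, y]%classic.
have Ad : A `<=` `]q - d, q + d[.
  move=> z; rewrite /A /= !in_itv/= => /andP[xz zy].
  by apply/andP; split; [move: qx xz mind|move: zy yq mind]; lra.
have mA : measurable A by exact: measurable_itv.
have gbd z : A z -> `|g q - g z| <= e.
  rewrite /A/= in_itv/= => /andP[xz zy]; apply: gd2.
  by rewrite /ball/= ltr_norml; apply/andP; split; move: qx xz zy yq mind2; lra.
have Fd : (F eta0 y - F eta0 x)%:E = (\int[@lebesgue_measure R]_(z in A) (g z)%:E)%E.
  rewrite -gA// EFinB -!FE.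
  have -> : X @^-1` A = [set a | X a <= y] `\` [set a | X a <= x].
    apply/seteqP; split=> a; rewrite /A/= in_itv/=.
      by move=> /andP[xa ay]; split=> //; apply/negP; rewrite -ltNge.
    by move=> [ay /negP]; rewrite -ltNge => ->.
  have -> : eta0 ([set a | X a <= y] `\` [set a | X a <= x]) =
      (eta0 [set a | (X a <= y)%R] - eta0 ([set a | (X a <= y)%R] `&` [set a | (X a <= x)%R]))%E.
    by apply: measureD => //; exact: (le_lt_trans (probability_le1 eta0 (m_le _)) (ltry 1)).
  congr (_ - eta0 _)%E; apply/seteqP; split=> a /=; last by case.
  by move=> ax; split=> //; exact: le_trans xy.
have ig : (@lebesgue_measure R).-integrable A (EFin \o g).
  apply/integrableP; split; first by apply/measurable_EFinP; exact: measurable_funS mg.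
  apply: le_lt_trans (_ : (_ <= (F eta0 y - F eta0 x)%:E)%E) (ltry _).
  rewrite Fd le_eqVlt; apply/predU1P; left; apply: eq_integral => z zA /=.
  by rewrite gtr0_norm// gpos//; apply: Ad; exact: set_mem.
have muA : fine (@lebesgue_measure R A) = y - x.
  rewrite /A lebesgue_measure_itv/= lte_fin; case: ltP => [|yx]; first by [].
  by apply/esym/eqP; rewrite subr_eq0 eq_le yx xy.
have muAfin : (@lebesgue_measure R A < +oo)%E.
  by rewrite /A lebesgue_measure_itv/= lte_fin; case: (ltP x y) => _; [exact: (ltry (y - x))|exact: (ltry 0)].
have ic (c : R) : (@lebesgue_measure R).-integrable A (EFin \o (fun=> c)).
  by apply: measurable_bounded_integrable => //; exact: bounded_cst.
have FdR : F eta0 y - F eta0 x = \int[@lebesgue_measure R]_(z in A) g z.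
  by rewrite /Rintegral -Fd.
have RC (c : R) : \int[@lebesgue_measure R]_(z in A) c = c * (y - x).
  by rewrite -muA; exact: (@Rintegral_cst _ _ _ (@lebesgue_measure R) A mA c).
rewrite FdR ler_norml; apply/andP; split.
  have : \int[@lebesgue_measure R]_(z in A) (g q - e) <= \int[@lebesgue_measure R]_(z in A) g z.
    apply: le_Rintegral => // z /gbd; rewrite ler_norml => /andP[_].
    lra.
  by rewrite RC mulrBl => h; rewrite lerBrDr addrC.
have : \int[@lebesgue_measure R]_(z in A) g z <= \int[@lebesgue_measure R]_(z in A) (g q + e).
  apply: le_Rintegral => // z /gbd; rewrite ler_norml => /andP[+ _].
  lra.
by rewrite RC mulrDl => h; rewrite lerBlDr addrC.
Qed.

Let F_increment_q (e : R) : {for q, continuous g} -> 0 < e ->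
  exists2 d : R, 0 < d & forall s : R, `|s| < d ->
    `|F eta0 (q + s) - tau - g q * s| <= e * `|s|.
Proof.
move=> cg e0; have [d dpos Fd] := F_increment cg e0.
exists d => // s; rewrite ltr_norml => /andP[s1 s2].
have [s0|s0] := leP 0 s.
  have := Fd q (q + s); rewrite F_q [q + s - q]addrAC subrr add0r (ger0_norm s0); apply.
  - by rewrite ltrBlDr ltrDl.
  - by rewrite lerDl.
  - by rewrite ltrD2l.
have := Fd (q + s) q; rewrite F_q (_ : q - (q + s) = - s); last by ring.
rewrite (ltr0_norm s0) -[X in _ -> X <= _]normrN.
rewrite (_ : - (F eta0 (q + s) - tau - g q * s) = tau - F eta0 (q + s) - g q * - s); last by ring.
apply.
- by rewrite ltrD2l.
- by rewrite gerDl ltW.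
- by rewrite ltrDl.
Qed.

Let Lfun2_le1 (f : R * R -> R) : measurable_fun [set: R * R] f ->
  (forall a, `|f a| <= 1) -> f \in Lfun eta0 2%:E.
Proof.
move=> mf f1; apply: integrable_Lfun2 => //.
have : eta0.-integrable [set: R * R] (EFin \o (fun a => f a ^+ 2)).
  apply: (bounded_integrable eta0 (M := 1)); first exact: measurable_funX.
  by move=> a; rewrite normrX expr_le1.
by move=> /integrable_lty; apply.
Qed.

(** Derivative along a path with score [b] of the CDF at the fixed point [x]. *)
Let S (b : R * R -> R) x := \int[eta0]_a (below x a * b a).

(** The difference of the indicators is 0 or 1, so its product with |b| is at most (l / 2) b^2 plus
    the difference divided by 2 l. *)
Let S_increment (b : R * R -> R) (l x y : R) : b \in Lfun eta0 2%:E -> 0 < l -> x <= y ->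
  `|S b y - S b x| <= l * \int[eta0]_a (b a ^+ 2) / 2 + (F eta0 y - F eta0 x) / (2 * l).
Proof.
move=> bL l0 xy; have [mb ib2] := Lfun2_integrable bL.
have ibl z : eta0.-integrable [set: R * R] (EFin \o below z).
  exact: (bounded_integrable eta0 (mbelow z) (below_le1 z)).
have bLz z := Lfun2_le1 (mbelow z) (below_le1 z).
have ibb z := Lfun2_mul_integrable (bLz z) bL.
have ibd : eta0.-integrable [set: R * R] (EFin \o (fun a => below y a * b a - below x a * b a)).
  by have := integrableB measurableT (ibb y) (ibb x); apply: eq_integrable.
have iBd : eta0.-integrable [set: R * R] (EFin \o (fun a => below y a - below x a)).
  by have := integrableB measurableT (ibl y) (ibl x); apply: eq_integrable.
rewrite /S -(RintegralB measurableT (ibb y) (ibb x)).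
apply: (le_trans (le_normr_Rintegral measurableT ibd)).
have i1 := integrableZl measurableT (l / 2) ib2.
have i2 := integrableZl measurableT ((2 * l)^-1) iBd.
apply: (@le_trans _ _ (\int[eta0]_a (l / 2 * b a ^+ 2 + (2 * l)^-1 * (below y a - below x a)))).
  apply: le_Rintegral => //.
  - by have := integrable_norm ibd; exact: eq_integrable.
  - by have := integrableD measurableT i1 i2; apply: eq_integrable.
  move=> a _; rewrite -mulrBl normrM.
  have [->|->] : below y a - below x a = 0 \/ below y a - below x a = 1.
    rewrite /below !indicE; case: (boolP (a \in _)) => [_|/negP ay].
      by case: (_ \in _); [left; rewrite subrr|right; rewrite subr0].
    rewrite memNset ?subr0; first by left.
    by move=> /= ax; apply: ay; apply: mem_set; exact: le_trans ax xy.
  - by rewrite normr0 mul0r mulr0 addr0 mulr_ge0 ?sqr_ge0// divr_ge0// ltW.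
  - rewrite normr1 mul1r mulr1 -subr_ge0 -(real_normK (num_real (b a))).
    have -> : l / 2 * `|b a| ^+ 2 + (2 * l)^-1 - `|b a| = (l * `|b a| - 1) ^+ 2 / (2 * l).
      by field; rewrite gt_eqF.
    by rewrite divr_ge0 ?sqr_ge0// mulr_ge0// ltW.
rewrite (RintegralD measurableT i1 i2) (RintegralZl _ measurableT ib2).
rewrite (RintegralZl _ measurableT iBd) (RintegralB measurableT (ibl y) (ibl x)).
by rewrite -!/(F eta0 _) [X in _ + X]mulrC mulrAC.
Qed.

Let S_small (b : R * R -> R) (e : R) : {for q, continuous g} ->
  b \in Lfun eta0 2%:E -> 0 < e ->
  exists2 d : R, 0 < d & forall s : R, `|s| < d -> `|S b (q + s) - S b q| <= e.
Proof.
move=> cg bL e0; have g0 := density_at_gt0.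
set B := \int[eta0]_a (b a ^+ 2).
have B0 : 0 <= B by apply: Rintegral_ge0 => a _; exact: sqr_ge0.
have B1 : 0 < B + 1 by rewrite ltr_wpDl.
(* Each of the two terms of [S_increment] is at most e / 2: l B <= e, and the increment of F is kept
   below e l. *)
pose l := e / (B + 1); have l0 : 0 < l by rewrite divr_gt0.
have g1 : 0 < g q + 1 by rewrite addr_gt0.
have [d dpos Fd] := F_increment_q cg ltr01.
exists (Num.min d (e * l / (g q + 1))); first by rewrite lt_min dpos divr_gt0// mulr_gt0.
move=> s; rewrite lt_min => /andP[sd sl].
have Fs : `|F eta0 (q + s) - F eta0 q| <= e * l.
  rewrite F_q -[_ - _](subrK (g q * s)) (le_trans (ler_normD _ _))//.
  rewrite (@le_trans _ _ ((g q + 1) * `|s|))//; last first.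
    by rewrite mulrC -ler_pdivlMr// ltW.
  by rewrite mulrDl addrC lerD// ?Fd// normrM (gtr0_norm g0).
have bound : l * B / 2 + e * l / (2 * l) <= e.
  have -> : e * l / (2 * l) = e / 2 by field; rewrite gt_eqF.
  have : l * B <= e by rewrite /l mulrAC ler_pdivrMr// ler_pM2l// lerDl.
  lra.
have [s0|s0] := leP 0 s.
  have qs : q <= q + s by rewrite lerDl.
  apply: (le_trans (S_increment bL l0 qs)); apply: le_trans bound.
  rewrite lerD2l; apply: ler_wpM2r; first by rewrite invr_ge0 mulr_ge0// ltW.
  exact: le_trans (ler_norm _) Fs.
have qs : q + s <= q by rewrite gerDl ltW.
rewrite distrC; apply: (le_trans (S_increment bL l0 qs)); apply: le_trans bound.
rewrite lerD2l; apply: ler_wpM2r; first by rewrite invr_ge0 mulr_ge0// ltW.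
by apply: le_trans (ler_norm _) _; rewrite distrC.
Qed.

(** [x] is a lower bound of the set defining the quantile and [y] a member of it, so nothing else
    has to be known about [eta]. *)
Let quantile_between (eta : probability (R * R)%type R) (x y : R) :
  F eta x < tau -> tau <= F eta y -> x <= quantile k tau eta <= y.
Proof.
move=> xt ty.
have lb : lbound [set x : R | tau <= F eta x] x.
  move=> z /= tz; rewrite leNgt; apply/negP => zx.
  have : F eta z < tau by rewrite (le_lt_trans _ xt)// F_nd// ltW.
  by rewrite ltNge tz.
rewrite quantileE; apply/andP; split; last by apply: ge_inf => //; exists x.
by apply: lb_le_inf => //; exists y.
Qed.

(** The limit L = - S b q / g q comes from differentiating F (eta t) (q_t) = tau implicitly. The
    quantile is caught by evaluating the perturbed CDF at points that move with t, whence the need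
    for a uniform expansion. *)
Lemma is_gradient_quantile : {for q, continuous g} ->
  is_gradient H eta0 (quantile k tau) (quantile_gradient k tau q g).
Proof.
move=> cg; split; first exact: quantile_gradient_L20.
move=> eta b path; have [bL _] := path; have g0 := density_at_gt0.
have [mb ib2] := Lfun2_integrable bL.
have [rL _] := quantile_gradient_L20.
have irb := Lfun2_mul_integrable rL bL.
have L1 : (fun=> 1) \in Lfun eta0 2%:E by exact: Lfun_cst.
have ib : eta0.-integrable [set: R * R] (EFin \o b).
  have := Lfun2_mul_integrable bL L1.
  by apply: eq_integrable => // a _ /=; rewrite mulr1.
have lt_q1 a : `|lt_q a| <= 1.
  by rewrite /lt_q indicE; case: (_ \in _); rewrite ?normr1 ?normr0.
have iqb := Lfun2_mul_integrable (Lfun2_le1 mlt_q lt_q1) bL.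
pose L := - S b q / g q.
have -> : ('E_eta0[quantile_gradient k tau q g \* b] = L%:E)%E.
  rewrite unlock -(fineK (integrable_fin_num measurableT irb)); congr EFin.
  transitivity (\int[eta0]_a (- (g q)^-1 * (lt_q a * b a) + tau / g q * b a)).
    by apply: eq_Rintegral => a _ /=; rewrite -/(r a) rE; ring.
  rewrite (RintegralD measurableT (integrableZl measurableT _ iqb) (integrableZl measurableT _ ib)).
  rewrite (RintegralZl _ measurableT ib) (score_mean0 path) mulr0 addr0.
  rewrite (RintegralZl _ measurableT iqb) (integral_lt_q mb) /L -/(S b q).
  by rewrite !mulNr [_^-1 * _]mulrC.
apply: EFin_cvg_right; apply/cvgrPdist_le => e e0.
(* M bounds both L - e and L + e. With 4 c = g q e, moving by t e changes the linearized CDF by 4 c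
   t, which exceeds the total error 3 c t. *)
pose M := `|L| + e; have M0 : 0 < M by rewrite ltr_wpDl.
pose c := g q * e / 4; have c0 : 0 < c by rewrite divr_gt0// mulr_gt0.
have [d1 d10 Fd] := F_increment_q cg (divr_gt0 c0 M0).
have [d2 d20 Sd] := S_small cg bL c0.
have pl := path_limit path c0.
near=> t.
have t0 : 0 < t by near: t; exact: nbhs_right_gt.
have tm1 : t < d1 / M by near: t; apply: nbhs_right_lt; rewrite divr_gt0.
have tm2 : t < d2 / M by near: t; apply: nbhs_right_lt; rewrite divr_gt0.
rewrite ltr_pdivlMr// in tm1; rewrite ltr_pdivlMr// in tm2.
have plt : forall f : R * R -> R, measurable_fun [set: R * R] f ->
    (forall a, `|f a| <= 1) ->
    `|(\int[eta t]_a f a - \int[eta0]_a f a) / t - \int[eta0]_a (f a * b a)| <= c.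
  by near: t.
(* Three errors of at most c t: the path expansion at the moving point, the linearization of F under
   [eta0], and the continuity of [S b] at q. *)
have key m : `|m| <= M ->
    `|F (eta t) (q + t * m) - tau - t * (g q * m + S b q)| <= 3 * c * t.
  move=> mM; have tm : `|t * m| <= t * M by rewrite normrM gtr0_norm// ler_pM2l.
  have h1 := Fd _ (le_lt_trans tm tm1); have h2 := Sd _ (le_lt_trans tm tm2).
  have h3 := plt _ (mbelow (q + t * m)) (below_le1 _).
  rewrite -!/(F _ _) -/(S b _) in h3.
  set x := q + t * m in h1 h2 h3 *.
  have h4 : `|F (eta t) x - F eta0 x - t * S b x| <= c * t.
    rewrite (_ : _ - _ = ((F (eta t) x - F eta0 x) / t - S b x) * t); last first.
      by field; rewrite gt_eqF.
    by rewrite normrM (gtr0_norm t0) ler_pM2r.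
  have h5 : `|F eta0 x - tau - g q * (t * m)| <= c * t.
    by apply: (le_trans h1); rewrite mulrAC ler_pdivrMr// -[leRHS]mulrA ler_pM2l.
  have h6 : `|t * (S b x - S b q)| <= c * t.
    by rewrite normrM (gtr0_norm t0) mulrC ler_pM2r.
  rewrite (_ : _ - _ = (F (eta t) x - F eta0 x - t * S b x) +
    (F eta0 x - tau - g q * (t * m)) + t * (S b x - S b q)); last by ring.
  apply: (le_trans (ler_normD _ _)); apply: (le_trans (lerD (ler_normD _ _) (lexx _))).
  by move: h4 h5 h6; lra.
have gL : g q * L = - S b q by rewrite /L mulrCA mulfV ?mulr1// gt_eqF.
have gc : g q * e = 4 * c by rewrite /c; field.
have ct : 0 < c * t by rewrite mulr_gt0.
have hi : tau <= F (eta t) (q + t * (L + e)).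
  have /key : `|L + e| <= M by rewrite /M (le_trans (ler_normD _ _))// (gtr0_norm e0).
  rewrite (_ : g q * (L + e) + S b q = 4 * c); last by rewrite mulrDr gL gc; ring.
  rewrite ler_norml => /andP[+ _].
  by move: ct; lra.
have lo : F (eta t) (q + t * (L - e)) < tau.
  have /key : `|L - e| <= M by rewrite /M (le_trans (ler_normB _ _))// (gtr0_norm e0).
  rewrite (_ : g q * (L - e) + S b q = - (4 * c)); last by rewrite mulrBr gL gc; ring.
  rewrite ler_norml => /andP[_].
  by move: ct; lra.
have /andP[q1 q2] := quantile_between lo hi.
rewrite distrC -qE ler_norml; apply/andP; split.
  by rewrite lerBrDr ler_pdivlMr//; move: q1; lra.
by rewrite lerBlDr ler_pdivrMr//; move: q2; lra.
Unshelve. all: by end_near. Qed.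

End quantile.

(** * Infinite efficiency bounds for the CDF and the quantiles *)

Section irregularity.
Context {R : realType}.

Lemma open_fst_preimage (B : set R) : open B -> open [set a : R * R | B a.1].
Proof. by move=> oB; apply: (@open_comp _ _ fst B) => // a _; exact: cvg_fst. Qed.

Lemma open_snd_preimage (B : set R) : open B -> open [set a : R * R | B a.2].
Proof. by move=> oB; apply: (@open_comp _ _ snd B) => // a _; exact: cvg_snd. Qed.

Lemma closure_direction (W : set (R * R)) (p v : R * R) :
  `|v.1| <= 1 -> `|v.2| <= 1 ->
  (forall e, 0 < e -> W (p.1 + e * v.1, p.2 + e * v.2)) -> closure W p.
Proof.
move=> v1 v2 Wp B /nbhs_ballP[d /= d0 dB].
have d2 : 0 < d / 2 by rewrite divr_gt0.
exists (p.1 + d / 2 * v.1, p.2 + d / 2 * v.2); split; first exact: Wp.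
have small x y : `|y| <= 1 -> `|x - (x + d / 2 * y)| < d.
  move=> y1; rewrite opprD addrA subrr sub0r normrN normrM (gtr0_norm d2).
  by rewrite (@le_lt_trans _ _ (d / 2))// ?ger_pMr// ltr_pdivrMr// mulr_natr mulr2n ltrDl.
by apply: dB; split; exact: small.
Qed.

(** At most one of the two shifts d / 2 and d / 3 leads to first coordinate 0. *)
Lemma interior_shift_neq0 (A : set (R * R)) (a : R * R) : A° a ->
  exists2 d, 0 < d & A° (a.1 - d, a.2) /\ a.1 - d != 0.
Proof.
move=> /nbhs_interior/nbhs_ballP[d /= d0 dA].
have dA' s : 0 < s -> s < d -> A° (a.1 - s, a.2).
  move=> s0 sd; apply: dA; split => /=; last exact: ballxx.
  by rewrite /ball/= opprB addrC subrK gtr0_norm.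
have d2 : 0 < d / 2 by rewrite divr_gt0.
have d3 : 0 < d / 3 by rewrite divr_gt0.
have d2d : d / 2 < d by move: d0; lra.
have d3d : d / 3 < d by move: d0; lra.
have [ad|ad] := eqVneq (a.1 - d / 2) 0.
  exists (d / 3) => //; split; first exact: dA'.
  by apply/negP => /eqP; move: ad d0; lra.
by exists (d / 2) => //; split; first exact: dA'.
Qed.

Lemma interior_shift_sym (A : set (R * R)) (a : R * R) : A° a -> a.1 = 0 ->
  exists2 d, 0 < d & A° (d, a.2) /\ A° (- d, a.2).
Proof.
move=> /nbhs_interior/nbhs_ballP[d /= d0 dA] a1.
have d2 : 0 < d / 2 by rewrite divr_gt0.
have d2d : d / 2 < d by move: d0; lra.
exists (d / 2) => //; split; apply: dA; split => /=; rewrite ?a1; try exact: ballxx.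
  by rewrite /ball/= sub0r normrN gtr0_norm.
by rewrite /ball/= opprK add0r gtr0_norm.
Qed.

Lemma quantile_gradient_lt (k : 'I_2) (tau q : R) (g : R -> R) (a : R * R) :
  ucoord k a < q -> quantile_gradient k tau q g a = - ((1 - tau) / g q).
Proof. by move=> aq; rewrite /quantile_gradient indicE mem_set. Qed.

Lemma quantile_gradient_ge (k : 'I_2) (tau q : R) (g : R -> R) (a : R * R) :
  q <= ucoord k a -> quantile_gradient k tau q g a = tau / g q.
Proof.
move=> qa; rewrite /quantile_gradient indicE memNset ?sub0r ?mulNr ?opprK//=.
by apply/negP; rewrite -leNgt.
Qed.

Variables (T : set R) (H : set (probability (R * R)%type R)).
Variable eta0 : probability (R * R)%type R.
Hypotheses (T_ge0 : T `<=` [set t | 0 <= t]) (T_convex : @convex_set R R^o T).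
Hypotheses (T_int : T° !=set0) (eta1 : eta0 (@UHdom R) = 1%E).
Hypothesis np : nonparametric H eta0.

Lemma efficiency_bound_step (p p' : R * R) (W W' : set (R * R))
    (w w' c c' : R) (r : R * R -> R) :
  L20 eta0 r -> (supp eta0)° p -> (supp eta0)° p' -> p.1 != 0 ->
  p'.1 ^+ 2 = p.1 ^+ 2 -> p'.2 = p.2 ->
  open W -> open W' -> closure W p -> closure W' p' ->
  (forall z, 0 <= z.1 -> 0 <= z.2 -> w * kernel_z p z = w' * kernel_z p' z) ->
  (forall a, W a -> r a = c) -> (forall a, W' a -> r a = c') ->
  c * w - c' * w' != 0 -> efficiency_bound T H eta0 r = +oo%E.
Proof.
move=> rL ip ip' p1 pp1 pp2 oW oW' cW cW' ww' rW rW' D0.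
apply: (efficiency_bound_pinfty T_ge0 T_convex T_int eta1 (ex_intro _ _ ip) np rL D0).
by move=> h h0; exact: (step_direction eta1 ip ip' p1 pp1 pp2 oW oW' cW cW' ww' rW rW' h0).
Qed.

(** Instead of the corner [a0], a point p on the horizontal edge of the quadrant is used, moved left
    so that its first coordinate is not 0. Across the edge the gradient jumps from 1 - F to - F, so
    the covariance is 1. *)
Lemma efficiency_bound_cdf (a0 : R * R) : (supp eta0)° a0 ->
  efficiency_bound T H eta0 (cdf_gradient eta0 a0) = +oo%E.
Proof.
move=> ia; have [d d0 [ip p0]] := interior_shift_neq0 ia.
pose W := [set a : R * R | a.1 < a0.1] `&` [set a : R * R | a.2 < a0.2].
pose W' := [set a : R * R | a0.2 < a.2].
have oW : open W.
  by apply: openI; [exact: (open_fst_preimage (@open_lt R a0.1))|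
    exact: (open_snd_preimage (@open_lt R a0.2))].
have oW' : open W' by exact: (open_snd_preimage (@open_gt R a0.2)).
have cW : closure W (a0.1 - d, a0.2).
  apply: (closure_direction (v := (0, -1))); rewrite /= ?normr0 ?normrN1// => e e0.
  by split; rewrite /= ?mulr0 ?addr0 ?mulrN1 ltrBlDr ltrDl.
have cW' : closure W' (a0.1 - d, a0.2).
  apply: (closure_direction (v := (0, 1))); rewrite /= ?normr0 ?normr1// => e e0.
  by rewrite /W'/= mulr1 ltrDl.
pose F := cdf_value a0 eta0.
have rW a : W a -> cdf_gradient eta0 a0 a = 1 - F.
  move=> [/= a1 a2]; rewrite /cdf_gradient /cdf_integrand !indicE.
  by rewrite !mem_set ?mulr1//= ltW.
have rW' a : W' a -> cdf_gradient eta0 a0 a = - F.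
  move=> /= a2; rewrite /cdf_gradient /cdf_integrand !indicE.
  rewrite [_.2 \in _]memNset ?mulr0 ?sub0r//=.
  by apply/negP; rewrite -ltNge.
apply: (efficiency_bound_step (w := 1) (w' := 1) (cdf_gradient_L20 eta0 a0) ip ip p0 _ _ oW oW' cW cW' _ rW rW') => //.
by rewrite !mulr1 opprK subrK oner_neq0.
Qed.

Variables (k : 'I_2) (tau q : R) (g : R -> R).
Hypotheses (tau01 : 0 < tau < 1) (qE : q = quantile k tau eta0).
Hypothesis gq : positive_density_near eta0 k q g.

(** For the second coordinate, the point can slide along the horizontal jump line to a nonzero first
    coordinate. For the first coordinate the jump line is a.1 = q: any of its points will do if q !=
    0, and mirror points off the line are needed if q = 0. *)
Lemma efficiency_bound_quantile (a : R * R) : (supp eta0)° a -> ucoord k a = q ->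
  efficiency_bound T H eta0 (quantile_gradient k tau q g) = +oo%E.
Proof.
move=> ia uq; have g0 := density_at_gt0 gq; have [t0 t1] := andP tau01.
have rL := quantile_gradient_L20 tau01 qE gq.
have rlt (b : R * R) : ucoord k b < q ->
    quantile_gradient k tau q g b = - ((1 - tau) / g q).
  exact: quantile_gradient_lt.
have rgt (b : R * R) : q < ucoord k b -> quantile_gradient k tau q g b = tau / g q.
  by move=> /ltW; exact: quantile_gradient_ge.
have D0 : - ((1 - tau) / g q) * 1 - tau / g q * 1 != 0.
  rewrite !mulr1 -opprD -mulrDl subrK mul1r oppr_eq0 invr_eq0 gt_eqF//.
have [k0|k0] := boolP (k == ord0); last first.
  have uE b : ucoord k b = b.2 by rewrite /ucoord (negbTE k0).
  have [d d0 [ip p0]] := interior_shift_neq0 ia.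
  rewrite uE in uq.
  apply: (efficiency_bound_step (w := 1) (w' := 1) (W := [set b : R * R | b.2 < q])
    (W' := [set b : R * R | q < b.2]) rL ip ip p0 _ _ _ _ _ _ _ _ _ D0) => //.
  - exact: (open_snd_preimage (@open_lt R q)).
  - exact: (open_snd_preimage (@open_gt R q)).
  - apply: (closure_direction (v := (0, -1))); rewrite /= ?normr0 ?normrN1// => e e0.
    by rewrite uq mulrN1 ltrBlDr ltrDl.
  - apply: (closure_direction (v := (0, 1))); rewrite /= ?normr0 ?normr1// => e e0.
    by rewrite uq mulr1 ltrDl.
  - by move=> b /= bq; apply: rlt; rewrite uE.
  - by move=> b /= bq; apply: rgt; rewrite uE.
have uE b : ucoord k b = b.1 by rewrite /ucoord k0.
rewrite uE in uq.
have [q0|q0] := eqVneq q 0; last first.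
  apply: (efficiency_bound_step (w := 1) (w' := 1) (W := [set b : R * R | b.1 < q])
    (W' := [set b : R * R | q < b.1]) rL ia ia _ _ _ _ _ _ _ _ _ _ D0) => //.
  - by rewrite uq.
  - exact: (open_fst_preimage (@open_lt R q)).
  - exact: (open_fst_preimage (@open_gt R q)).
  - apply: (closure_direction (v := (-1, 0))); rewrite /= ?normr0 ?normrN1// => e e0.
    by rewrite uq mulrN1 ltrBlDr ltrDl.
  - apply: (closure_direction (v := (1, 0))); rewrite /= ?normr0 ?normr1// => e e0.
    by rewrite uq mulr1 ltrDl.
  - by move=> b /= bq; apply: rlt; rewrite uE.
  - by move=> b /= bq; apply: rgt; rewrite uE.
have [d d0 [ip ip']] := interior_shift_sym ia (etrans uq q0).
(* [kernel_z] depends on the sign of [a.1] only through [kernel_factor]. *)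
apply: (@efficiency_bound_step (d, a.2) (- d, a.2) [set b : R * R | q < b.1]
  [set b : R * R | b.1 < q] (kernel_factor (- d, a.2)) (kernel_factor (d, a.2))
  (tau / g q) (- ((1 - tau) / g q)) _ rL ip ip') => //=.
- by rewrite gt_eqF.
- by rewrite sqrrN.
- exact: (open_fst_preimage (@open_gt R q)).
- exact: (open_fst_preimage (@open_lt R q)).
- apply: (closure_direction (v := (0, 0))); rewrite /= ?normr0// => e e0.
  by rewrite mulr0 addr0 q0.
- apply: (closure_direction (v := (0, 0))); rewrite /= ?normr0// => e e0.
  by rewrite mulr0 addr0 q0 oppr_lt0.
- by move=> z z1 z2; rewrite !kernel_zE//= sqrrN mulrCA.
- by move=> b /= bq; apply: rgt; rewrite uE.
- by move=> b /= bq; apply: rlt; rewrite uE.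
(* The gradient has opposite signs at the two points and the weights are positive, so the two
   contributions to the covariance add up. *)
have a2 := interior_supp_gt0 eta1 ip.
rewrite mulNr opprK gt_eqF// addr_gt0// mulr_gt0//.
- by rewrite divr_gt0.
- by rewrite kernel_factor_gt0//= gt_eqF.
- by rewrite divr_gt0// subr_gt0.
- by rewrite kernel_factor_gt0//= gt_eqF.
Qed.

End irregularity.

Lemma infinite_bound_not_regular (R : realType) (T : set R)
    (H : set (probability (R * R)%type R)) (eta0 : probability (R * R)%type R)
    (phi : probability (R * R)%type R -> R) (r : R * R -> R) :
  efficiency_bound T H eta0 r = +oo%E -> ~ regularly_identified T H eta0 phi r.
Proof. by move=> rE [_]; rewrite rE ltxx. Qed.

Theorem corollary3p3 (R : realType) (T : set R)
    (T_ge0 : T `<=` [set t | 0 <= t])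
    (T_convex : @convex_set R R^o T)
    (T_int : T° !=set0)
    (H : set (probability (R * R)%type R))
    (H_dom : forall eta, H eta -> eta (@UHdom R) = 1%E)
    (eta0 : probability (R * R)%type R) (H_eta0 : H eta0)
    (UH_nonparametric : nonparametric H eta0) :
  (forall a0 : R * R, (supp eta0)° a0 ->
     is_gradient H eta0 (cdf_value a0) (cdf_gradient eta0 a0) /\
     ~ regularly_identified T H eta0 (cdf_value a0) (cdf_gradient eta0 a0))
  /\
  (forall (k : 'I_2) (tau q : R) (g : R -> R),
     0 < tau < 1 ->
     q = quantile k tau eta0 ->
     positive_density_near eta0 k q g ->
     (exists2 a, (supp eta0)° a & ucoord k a = q) ->
     ({for q, continuous g} ->
        is_gradient H eta0 (quantile k tau) (quantile_gradient k tau q g)) /\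
     ~ regularly_identified T H eta0 (quantile k tau)
         (quantile_gradient k tau q g)).
Proof.
have eta1 := H_dom _ H_eta0.
split=> [a0 ia|k tau q g tau01 qE gq [a ia aq]]; split.
- exact: is_gradient_cdf.
- apply: infinite_bound_not_regular.
  exact: (efficiency_bound_cdf T_ge0 T_convex T_int eta1 UH_nonparametric ia).
- exact: (is_gradient_quantile H tau01 qE gq).
- apply: infinite_bound_not_regular.
  exact: (efficiency_bound_quantile T_ge0 T_convex T_int eta1 UH_nonparametric tau01 qE gq ia aq).
Qed.
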